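(* Let $X$ be a Banach space, $C$ the generator of a strongly continuous contraction semigroup $(V(t))_{t\ge0}$ on $X$, and $\Phi:\mathrm{L}^1([-1,0],X)\to X$ bounded linear. On $\mathcal{E}=X\times\mathrm{L}^1([-1,0],X)$ (max norm) let $\mathcal{G}=\begin{pmatrix}C&\Phi\\0&\frac{d}{d\sigma}\end{pmatrix}$ with $D(\mathcal{G})=\{\binom{\xi}{\eta}\in D(C)\times\mathrm{W}^{1,1}([-1,0],X):\eta(0)=\xi\}$; $\mathcal{G}$ generates a strongly continuous semigroup $(\mathcal{U}(t))_{t\ge0}$ (the delay semigroup). Split $\mathcal{G}=\mathcal{A}+\mathcal{B}$ with $\mathcal{A}=\begin{pmatrix}C&0\\0&\frac{d}{d\sigma}\end{pmatrix}$, $D(\mathcal{A})=D(\mathcal{G})$, and $\mathcal{B}=\begin{pmatrix}0&\Phi\\0&0\end{pmatrix}$, $D(\mathcal{B})=\mathcal{E}$, generating semigroups $\mathcal{T}$, $\mathcal{S}$. Let $X_m$, $P_m$, $J_m$, $\widetilde P_m$, $\widetilde J_m$, $\mathcal{E}_m$, $\mathcal{P}_m$, $\mathcal{J}_m$ be as in the context, and assume: (a) there are operators $C_m$ generating strongly continuous semigroups $(V_m(t))_{t\ge0}$ on $X_m$ with $\|V_m(t)\|\le1$ for all $t\ge0$, such that $P_mD(C)\subset D(C_m)$ and $J_mC_mP_mx\to Cx$ for all $x\in D(C)$; (b) there are bounded operators $\Phi_m:\mathrm{L}^1([-1,0],X_m)\to X_m$ with $\|\Phi_m\|\le c\|\Phi\|$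 for a constant $c$ independent of $m$, such that $J_m\Phi_m\widetilde P_mf\to\Phi f$ for every $f\in\mathrm{L}^1([-1,0],X)$. On $\mathcal{E}_m$ define $\mathcal{A}_m=\begin{pmatrix}C_m&0\\0&\frac{d}{d\sigma}\end{pmatrix}$ with $D(\mathcal{A}_m)=\{\binom{\xi_m}{\eta_m}\in D(C_m)\times\mathrm{W}^{1,1}([-1,0],X_m):\eta_m(0)=\xi_m\}$ and $\mathcal{B}_m=\begin{pmatrix}0&\Phi_m\\0&0\end{pmatrix}$, $D(\mathcal{B}_m)=\mathcal{E}_m$, generating semigroups $(\mathcal{T}_m(t))_{t\ge0}$, $(\mathcal{S}_m(t))_{t\ge0}$. Then the sequential, Strang and weighted splittings with spatial approximation are convergent for the delay semigroup: for every $t>0$, every $\Theta\in(0,1)$ and every $\binom{x}{f}\in\mathcal{E}$, $$\lim_{n,m\to\infty}\mathcal{J}_m[F_m(t/n)]^n\mathcal{P}_m\tbinom{x}{f}=\mathcal{U}(t)\tbinom{x}{f},$$ where $F_m(h)$ is either $\mathcal{S}_m(h)\mathcal{T}_m(h)$, or $\mathcal{T}_m(h/2)\mathcal{S}_m(h)\mathcal{T}_m(h/2)$, or $\Theta\mathcal{S}_m(h)\mathcal{T}_m(h)+(1-\Theta)\mathcal{T}_m(h)\mathcal{S}_m(h)$.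
   Context: $X_m$ ($m\in\mathbb{N}$) are Banach spaces, $P_m:X\to X_m$, $J_m:X_m\to X$ bounded linear operators with $P_mJ_m=I_m$, $J_mP_mx\to x$ for all $x\in X$, and $\|J_m\|\le M_J$, $\|P_m\|\le M_P$ for all $m$. $\widetilde P_m:\mathrm{L}^1([-1,0],X)\to\mathrm{L}^1([-1,0],X_m)$ and $\widetilde J_m:\mathrm{L}^1([-1,0],X_m)\to\mathrm{L}^1([-1,0],X)$ act pointwise: $(\widetilde P_mf)(\sigma)=P_mf(\sigma)$, $(\widetilde J_mf_m)(\sigma)=J_mf_m(\sigma)$. $\mathcal{E}_m=X_m\times\mathrm{L}^1([-1,0],X_m)$ with the max norm, $\mathcal{P}_m=\mathrm{diag}(P_m,\widetilde P_m)$, $\mathcal{J}_m=\mathrm{diag}(J_m,\widetilde J_m)$. The double limit $\lim_{n,m\to\infty}a_{n,m}=a$ means: for every $\varepsilon>0$ there is $N$ with $\|a_{n,m}-a\|\le\varepsilon$ for all $n,m\ge N$. *)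

(* Defs.v *)
From HB Require Import structures.
From mathcomp Require Import all_boot all_order all_algebra.
From mathcomp Require Import all_classical all_reals all_analysis.
Import Order.TTheory GRing.Theory Num.Theory.

Set Implicit Arguments.
Unset Strict Implicit.
Unset Printing Implicit Defensive.

Local Open Scope ring_scope.
Local Open Scope classical_set_scope.

(* Bochner space L^1([-1,0], Y) for a normed space Y, on representatives *)
Section Bochner.
Variables (R : realType) (Y : normedModType R).

Definition Iint : set R := `[(-1)%R, 0%R].

Record srep := SRep {
  sr_n : nat;
  sr_A : 'I_sr_n -> set R;
  sr_x : 'I_sr_n -> Y;
  sr_meas : forall i, measurable (sr_A i) }.

Definition sr_eval (s : srep) : R -> Y :=
  fun t => \sum_(i < sr_n s) (indic (@sr_A s i) t : R) *: @sr_x s i.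

(* integral of the simple function over D (D a subset of [-1,0]) *)
Definition sr_int (s : srep) (D : set R) : Y :=
  \sum_(i < sr_n s) fine (@lebesgue_measure R (@sr_A s i `&` D)) *: @sr_x s i.

Definition L1dist (f g : R -> Y) : \bar R :=
  (\int[@lebesgue_measure R]_(t in Iint) (`|f t - g t|)%:E)%E.

Definition L1norm (f : R -> Y) : R :=
  fine (\int[@lebesgue_measure R]_(t in Iint) (`|f t|)%:E)%E.

Definition approx_seq (s : nat -> srep) (f : R -> Y) : Prop :=
  {ae @lebesgue_measure R, forall t, Iint t ->
     (fun k => sr_eval (s k) t) @ \oo --> f t} /\
  (fun k => L1dist (sr_eval (s k)) f) @ \oo --> 0%E.

Definition is_L1 (f : R -> Y) : Prop := exists s, approx_seq s f.

(* v is the Bochner integral of f over D, D a subset of [-1,0] *)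
Definition bochner_int (f : R -> Y) (D : set R) (v : Y) : Prop :=
  exists s, approx_seq s f /\ (fun k => sr_int (s k) D) @ \oo --> v.

(* eta (an L^1 class) lies in W^{1,1}([-1,0],Y) with derivative g, and its
   (absolutely) continuous representative takes the value eta0 at 0 *)
Definition W11_deriv (eta g : R -> Y) (eta0 : Y) : Prop :=
  is_L1 eta /\ is_L1 g /\
  exists etac : R -> Y,
    {ae @lebesgue_measure R, forall t, Iint t -> etac t = eta t} /\
    (forall s, Iint s -> bochner_int g `[(-1)%R, s] (etac s - etac (-1))) /\
    etac 0 = eta0.

Definition bdd_lin_L1 (Phi : (R -> Y) -> Y) : Prop :=
  (forall (a : R) f g, is_L1 f -> is_L1 g ->
     Phi (a *: f + g) = a *: Phi f + Phi g) /\
  exists M : R, forall f, is_L1 f -> `|Phi f| <= M * L1norm f.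

Definition opnorm_L1 (Phi : (R -> Y) -> Y) : R :=
  sup [set `|Phi f| | f in [set f | is_L1 f /\ L1norm f <= 1]].

Definition Edom : set (Y * (R -> Y)) := fun p => is_L1 p.2.
Definition Enorm (p : Y * (R -> Y)) : R := Num.max `|p.1| (L1norm p.2).

Definition delay_graph (DC : set Y) (C : Y -> Y) (Phi : (R -> Y) -> Y)
  (p q : Y * (R -> Y)) : Prop :=
  DC p.1 /\ exists g, W11_deriv p.2 g p.1 /\ q = (C p.1 + Phi p.2, g).
Definition diag_graph (DC : set Y) (C : Y -> Y) (p q : Y * (R -> Y)) : Prop :=
  DC p.1 /\ exists g, W11_deriv p.2 g p.1 /\ q = (C p.1, g).
Definition B_graph (Phi : (R -> Y) -> Y) (p q : Y * (R -> Y)) : Prop :=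
  is_L1 p.2 /\ q = (Phi p.2, 0).

End Bochner.

Definition liftE (R : Type) (Y Z : Type) (P : Y -> Z) (p : Y * (R -> Y)) :
  Z * (R -> Z) := (P p.1, fun s => P (p.2 s)).

(* Strongly continuous semigroups on a seminormed space (dom, nrm)     *)
(* (all equalities are up to nrm-null elements)                        *)
Section Semigroups.
Variables (R : realType) (V : lmodType R) (dom : set V) (nrm : V -> R).

Definition bdd_lin (T : V -> V) : Prop :=
  (forall v, dom v -> dom (T v)) /\
  (forall (a : R) u v, dom u -> dom v ->
     nrm (T (a *: u + v) - (a *: T u + T v)) = 0) /\
  exists M : R, forall v, dom v -> nrm (T v) <= M * nrm v.

Definition C0_semigroup (U : R -> V -> V) : Prop :=
  (forall t, 0 <= t -> bdd_lin (U t)) /\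
  (forall v, dom v -> nrm (U 0 v - v) = 0) /\
  (forall t s v, 0 <= t -> 0 <= s -> dom v ->
     nrm (U (t + s) v - U t (U s v)) = 0) /\
  (forall v, dom v -> forall e : R, 0 < e -> exists d : R, 0 < d /\
     forall h : R, 0 < h -> h < d -> nrm (U h v - v) < e).

Definition sg_contraction (U : R -> V -> V) : Prop :=
  forall t v, 0 <= t -> dom v -> nrm (U t v) <= nrm v.

Definition tends0r (g : R -> V) (w : V) : Prop :=
  forall e : R, 0 < e -> exists d : R, 0 < d /\
    forall h : R, 0 < h -> h < d -> nrm (g h - w) < e.

Definition generates (Gr : V -> V -> Prop) (U : R -> V -> V) : Prop :=
  (forall v w, Gr v w ->
     dom v /\ dom w /\ tends0r (fun h => h^-1 *: (U h v - v)) w) /\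
  (forall v w, dom v -> dom w ->
     tends0r (fun h => h^-1 *: (U h v - v)) w -> exists w', Gr v w').

Definition seq_split (T S : R -> V -> V) (h : R) : V -> V :=
  fun v => S h (T h v).
Definition strang_split (T S : R -> V -> V) (h : R) : V -> V :=
  fun v => T (h / 2) (S h (T (h / 2) v)).
Definition weighted_split (Theta : R) (T S : R -> V -> V) (h : R) : V -> V :=
  fun v => Theta *: S h (T h v) + (1 - Theta) *: T h (S h v).

End Semigroups.

(* Main.v *)
Require Import Defs.
From HB Require Import structures.
From mathcomp Require Import all_boot all_order all_algebra.
From mathcomp Require Import all_classical all_reals all_analysis.
From mathcomp Require Import measurable_realfun ring lra.
Import Order.TTheory GRing.Theory Num.Theory.
Import numFieldNormedType.Exports.

(** Everything takes place in the Banach spaces obtained from [X * L^1] and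
    [X_m * L^1] by identifying functions that agree almost everywhere. Since the
    generators are only given through their graphs, growth bounds come from
    dissipativity: [|p - h A_m p| >= (1 - h) |p|], where the [L^1] component uses
    [|eta - h eta'|_1 >= |eta|_1 - h |eta(0)|], proved by telescoping the increments
    of [eta] over a fine partition. This yields [|T_m(h)| <= exp(2h)] and
    [|S_m(h)| <= exp(2kh)] with [k] independent of [m], hence the stability of the
    three schemes. Consistency on [D(G)] follows from [C_m P_m xi - P_m C xi -> 0]
    and [Phi_m P_m f - P_m Phi f -> 0], because [P_m J_m = 1].

    Consistency is only pointwise on [D(G)], so it cannot be summed along the orbit
    directly. As in Kato's proof of the Trotter-Kato theorem, the orbit is replaced by
    [z_k = R P_m U(kh) (l - G) y], where [R = (l - (F_m(h) - 1) / h)^-1] is uniformly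
    bounded. Then [z_k] is close to [P_m U(kh) y] uniformly on the compact orbit, and
    for [y] in [D(G^2)] the one-step defect [z_(k+1) - F_m(h) z_k] is [o(h)]. *)

Set Implicit Arguments.
Unset Strict Implicit.
Unset Printing Implicit Defensive.

Local Open Scope ring_scope.
Local Open Scope classical_set_scope.

(** The operators [(F_m(h) - 1) / h] have no bound uniform in [h], so compactness of an orbit does
    not make their pointwise consistency uniform. Their resolvents are bounded by 1, and for them it
    does. The resolvent of [G] itself is never constructed: only vectors of the form [(l - G) y]
    with [y] in the domain occur, and only the discrete operators are inverted, by a contraction.

    Consistency of one step also needs continuity of [T_m] and [S_m] at time 0 along [P_m q],
    uniformly in [m]. It is derived from the growth bounds and from the density of those [y] whose
    images [P_m y] lie in the domains of the generators.

    The rate 1 of [A_m] is due to the coupling [eta(0) = xi]: the derivative alone loses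
    [h |eta(0)|], which is at most [h |p|] in the max norm. The further factor 2 in the exponents is
    lost in the estimate [1 / (1 - w h) <= 1 + 2 w h]; only uniformity in [m] matters.

    All comparisons take place in [E_m]; [J_m] serves to translate the convergence hypotheses and
    the final error. *)

Section ModuleExpressions.
Variables (R : comPzRingType) (E : lmodType R).

Inductive mexpr :=
  | MVar of nat | MZero | MAdd of mexpr & mexpr | MOpp of mexpr
  | MScale of R & mexpr.

Fixpoint meval (s : seq E) (e : mexpr) : E :=
  match e with
  | MVar i => nth 0 s i
  | MZero => 0
  | MAdd e1 e2 => meval s e1 + meval s e2
  | MOpp e1 => - meval s e1
  | MScale a e1 => a *: meval s e1
  end.

(** [eqn] rather than [==], so that [cbn] evaluates the test on concrete indices. *)
Fixpoint mcoef (e : mexpr) (i : nat) : R :=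
  match e with
  | MVar j => if eqn i j then 1 else 0
  | MZero => 0
  | MAdd e1 e2 => mcoef e1 i + mcoef e2 i
  | MOpp e1 => - mcoef e1 i
  | MScale a e1 => a * mcoef e1 i
  end.

(** A recursive conjunction instead of a quantifier over indices: for a concrete list of atoms it
    unfolds into one scalar identity per atom. *)
Fixpoint mcoef_eq (n : nat) (e1 e2 : mexpr) : Prop :=
  if n is n'.+1 then mcoef e1 n' = mcoef e2 n' /\ mcoef_eq n' e1 e2 else True.

Lemma mcoef_var i j : mcoef (MVar j) i = if i == j then 1 else 0.
Proof. by []. Qed.

Lemma meval_coef s e : meval s e = \sum_(i < size s) mcoef e i *: s`_i.
Proof.
elim: e => [j||e1 IH1 e2 IH2|e1 IH1|a e1 IH1]; rewrite [LHS]/= ?IH1 ?IH2.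
- under eq_bigr do rewrite mcoef_var.
  have [js|sj] := ltnP j (size s).
    rewrite (bigD1 (Ordinal js))//= eqxx scale1r big1 ?addr0// => i ij.
    by rewrite ifN ?scale0r//; apply: contra ij => /eqP ij; apply/eqP/val_inj.
  rewrite nth_default// big1// => i _; rewrite ifN ?scale0r//.
  by rewrite neq_ltn (leq_trans (ltn_ord i) sj).
- by rewrite big1// => i _; rewrite scale0r.
- by rewrite -big_split/=; apply: eq_bigr => i _; rewrite scalerDl.
- by rewrite -sumrN; apply: eq_bigr => i _; rewrite scaleNr.
- by rewrite scaler_sumr; apply: eq_bigr => i _; rewrite scalerA.
Qed.

Lemma meval_eq s e1 e2 : mcoef_eq (size s) e1 e2 -> meval s e1 = meval s e2.
Proof.
rewrite !meval_coef => H; apply: eq_bigr => -[i]/= + _.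
elim: (size s) H => [//|n IH] /= [Hn H]; rewrite ltnS leq_eqVlt => /orP[/eqP ->|/IH].
  by rewrite Hn.
exact.
Qed.

End ModuleExpressions.

Ltac mod_mem x s :=
  lazymatch s with
  | nil => constr:(false)
  | cons x _ => constr:(true)
  | cons _ ?s' => mod_mem x s'
  end.

Ltac mod_atoms s t :=
  lazymatch t with
  | @GRing.add _ ?a ?b => let s' := mod_atoms s a in mod_atoms s' b
  | @GRing.opp _ ?a => mod_atoms s a
  | @GRing.scale _ _ _ ?a => mod_atoms s a
  | @GRing.zero _ => s
  | _ => lazymatch mod_mem t s with
         | true => s
         | false => constr:(cons t s)
         end
  end.

Ltac mod_index x s :=
  lazymatch s with
  | cons x _ => constr:(O)
  | cons _ ?s' => let n := mod_index x s' in constr:(S n)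
  end.

Ltac mod_reify R s t :=
  lazymatch t with
  | @GRing.add _ ?a ?b => let e1 := mod_reify R s a in
      let e2 := mod_reify R s b in constr:(@MAdd R e1 e2)
  | @GRing.opp _ ?a => let e1 := mod_reify R s a in constr:(@MOpp R e1)
  | @GRing.scale _ _ ?k ?a => let e1 := mod_reify R s a in constr:(@MScale R k e1)
  | @GRing.zero _ => constr:(@MZero R)
  | _ => let n := mod_index t s in constr:(@MVar R n)
  end.

(* Decides an identity of linear combinations in an [R]-module by comparing the
   coefficients of the atoms with [ring]. *)
Tactic Notation "module" constr(R) :=
  lazymatch goal with
  | |- @eq ?E ?a ?b =>
    let s0 := mod_atoms (@nil E) a in
    let s := mod_atoms s0 b in
    let e1 := mod_reify R s a in
    let e2 := mod_reify R s b in
    refine (@meval_eq R _ s e1 e2 _); cbn [mcoef mcoef_eq eqn size];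
    repeat split; try ring
  end.

(** * Strongly continuous semigroups *)

Section LinearMaps.
Variables (R : realType) (E F : lmodType R) (f : E -> F).
Hypothesis lf : linear f.

Let pf : {linear E -> F} := HB.pack f (GRing.isLinear.Build _ _ _ _ _ lf).

Lemma linfD x y : f (x + y) = f x + f y.
Proof. exact: (linearD pf). Qed.

Lemma linfB x y : f (x - y) = f x - f y.
Proof. exact: (linearB pf). Qed.

Lemma linfZ (a : R) x : f (a *: x) = a *: f x.
Proof. exact: (linearZZ pf). Qed.

Lemma linf0 : f 0 = 0.
Proof. exact: (linear0 pf). Qed.

End LinearMaps.

Section Sequences.
Variables (R : realType) (E : completeNormedModType R).

Lemma cauchy_seq_limit (u : nat -> E) :
  (forall e : R, 0 < e -> exists N, forall n, (N <= n)%N -> `|u n - u N| <= e) ->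
  exists l, forall e : R, 0 < e ->
    exists N, forall n, (N <= n)%N -> `|u n - l| <= e.
Proof.
move=> uC.
have : cvg (u @ \oo).
  apply: cauchy_cvg; apply: cauchy_exP => e e0.
  have e20 : 0 < e / 2 by lra.
  have [N HN] := uC _ e20.
  exists (u N), N => // n /= Nn.
  rewrite -ball_normE /ball_ /= distrC (le_lt_trans (HN _ Nn))//; lra.
rewrite cvg_ex => -[l Hl]; exists l => e e0.
move/cvgrPdist_le : Hl => /(_ _ e0)[N _ HN]; exists N => n Nn.
by rewrite distrC; exact: HN.
Qed.

Lemma ex_nat_div_lt (a d : R) : 0 <= a -> 0 < d -> exists N : nat,
  forall n, (N <= n)%N -> a / n.+1%:R < d.
Proof.
move=> a0 d0; exists (Num.truncn (a / d)) => n Nn.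
rewrite ltr_pdivrMr// mulrC -ltr_pdivrMr//.
by rewrite (lt_le_trans (truncnS_gt _))// ler_nat ltnS.
Qed.

End Sequences.

Section Semigroup.
Variables (R : realType) (E : completeNormedModType R).

(** The laws of [C0_semigroup] as genuine equalities. The semigroups of the statement satisfy them
    modulo null vectors, hence exactly on the quotient spaces. *)
Record csemigroup (T : R -> E -> E) : Prop := CSemigroup {
  csg_linear : forall t : R, 0 <= t -> linear (T t);
  csg_bounded : forall t : R, 0 <= t -> exists M : R, forall x, `|T t x| <= M * `|x|;
  csg0 : forall x, T 0 x = x;
  csgD : forall (t s : R) x, 0 <= t -> 0 <= s -> T (t + s) x = T t (T s x);
  csg_cont : forall x (e : R), 0 < e -> exists2 d : R, 0 < d &
    forall h : R, 0 < h -> h < d -> `|T h x - x| <= e }.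

(* [y] lies in the domain of the generator of [T], which maps it to [a];
   the quotient by [h] is cleared *)
Definition gen (T : R -> E -> E) (y a : E) : Prop :=
  forall e : R, 0 < e -> exists2 d : R, 0 < d &
    forall h : R, 0 < h -> h < d -> `|T h y - y - h *: a| <= e * h.

Variable T : R -> E -> E.
Hypothesis hT : csemigroup T.

(** Otherwise there are times tending to 0 along which the operator norms exceed every integer.
    Strong continuity at 0 makes this family pointwise bounded, which contradicts the
    Banach-Steinhaus theorem. *)
Lemma csg_local_bound : exists2 M : R, 1 <= M & exists2 d : R, 0 < d &
  forall h : R, 0 <= h -> h <= d -> forall x, `|T h x| <= M * `|x|.
Proof.
apply: contrapT => nex.
have H n : exists hx : R * E, [/\ 0 <= hx.1, hx.1 <= n.+1%:R^-1 &
    n.+1%:R * `|hx.2| < `|T hx.1 hx.2|].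
  apply: contrapT => nH; apply: nex; exists n.+1%:R; first by rewrite ler1n.
  exists n.+1%:R^-1; first by rewrite invr_gt0.
  move=> h h0 hn x; rewrite leNgt; apply/negP => hx.
  by apply: nH; exists (h, x).
have [u Hu] := choice H.
pose F : set (E -> E) := range (fun n => T (u n).1).
have unif : uniform_bounded F.
  apply: Banach_Steinhauss.
    move=> f [n _ <-]; have [h0 _ _] := Hu n; split; last exact: csg_linear hT _ h0.
    move=> r; have [M HM] := csg_bounded hT h0.
    exists (`|M| * r) => x xr; apply: (le_trans (HM x)).
    by rewrite (le_trans (ler_wpM2r _ (ler_norm M)))// ler_wpM2l.
  move=> x; have [d d0 Hd] := csg_cont hT x ltr01.
  have [N HN] := @ex_nat_div_lt R 1 d ler01 d0.
  (* From index [N] on, strong continuity gives the bound [|x| + 1]; the sum absorbs the finitely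
     many earlier operators. *)
  exists (`|x| + 1 + \sum_(k < N) `|T (u k).1 x|) => f [n _ <-].
  have S0 (P : pred 'I_N) : 0 <= \sum_(k < N | P k) `|T (u k).1 x| by exact: sumr_ge0.
  have x0 := normr_ge0 x.
  have [Nn|nN] := leqP N n; last first.
    rewrite (bigD1 (Ordinal nN))//=.
    by have := S0 (fun k => k != Ordinal nN); lra.
  have [h0 hn _] := Hu n.
  have hle : `|T (u n).1 x| <= `|x| + 1.
    move: h0; rewrite le_eqVlt => /orP[/eqP <-|h0].
      by rewrite (csg0 hT); lra.
    have {}Hd := Hd _ h0 (le_lt_trans hn _).
    have := Hd ltac:(by have := HN _ Nn; rewrite div1r).
    by have := ler_normD (T (u n).1 x - x) x; rewrite subrK; lra.
  by have := S0 predT; lra.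
have [M HM] := unif 1.
have [n nM] : exists n : nat, M <= n.+1%:R.
  by exists (Num.truncn M); rewrite ltW// truncnS_gt.
have [h0 _ Hx] := Hu n.
have xn0 : 0 < `|(u n).2|.
  rewrite normr_gt0; apply/eqP => x0; move: Hx; rewrite x0 (linf0 (csg_linear hT h0)).
  by rewrite normr0 mulr0 ltxx.
have := HM (T (u n).1) (ex_intro2 _ _ n Logic.I erefl) (`|(u n).2|^-1 *: (u n).2).
rewrite normrZ normfV normr_id mulVf ?gt_eqF// lexx => /(_ isT).
rewrite (linfZ (csg_linear hT h0)) normrZ normfV normr_id ler_pdivrMl// => Hle.
have : n.+1%:R * `|(u n).2| < M * `|(u n).2| by rewrite mulrC in Hle; exact: lt_le_trans Hx Hle.
by rewrite ltr_pM2r// ltNge nM.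
Qed.

Lemma csg_bound (t : R) : exists2 M : R, 1 <= M &
  forall s : R, 0 <= s -> s <= t -> forall x, `|T s x| <= M * `|x|.
Proof.
have [M M1 [d d0 Hd]] := csg_local_bound.
have M0 : 0 <= M by lra.
have bnd : forall n (s : R), 0 <= s -> s <= n%:R * d -> forall x, `|T s x| <= M ^+ n.+1 * `|x|.
  elim=> [|n IH] s s0 sn x.
    by rewrite expr1; apply: Hd => //; rewrite (le_trans sn)// mul0r ltW.
  have [sd|ds] := leP s d.
    rewrite (le_trans (Hd _ s0 sd x))// ler_wpM2r// exprS ler_peMr//.
    exact: exprn_ege1.
  have -> : s = d + (s - d) by lra.
  rewrite (csgD hT) ?subr_ge0 ?(ltW ds)// ?(ltW d0)// exprS -mulrA.
  apply: (le_trans (Hd _ (ltW d0) (lexx d) _)); apply: ler_wpM2l => //.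
  apply: IH; first by rewrite subr_ge0 ltW.
  move: sn; rewrite -natr1 mulrDl mul1r; lra.
pose n := Num.truncn (t / d).
exists (M ^+ n.+2); first exact: exprn_ege1.
move=> s s0 st x; apply: bnd => //; apply: (le_trans st).
by rewrite -ler_pdivrMr// ltW// truncnS_gt.
Qed.

(** Since [T r x - T s x = T s (T (r - s) x - x)], continuity at 0 and the bound on [[0, t]]
    suffice. *)
Lemma csg_uniform_cont (t : R) x (e : R) : 0 < e -> exists2 d : R, 0 < d &
  forall s r : R, 0 <= s -> s <= r -> r <= t -> r - s < d -> `|T r x - T s x| <= e.
Proof.
move=> e0; have [M M1 HM] := csg_bound t.
have eM : 0 < e / M by rewrite divr_gt0//; lra.
have [d d0 Hd] := csg_cont hT x eM.
exists d => // s r s0 sr rt rsd.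
have {1}-> : r = s + (r - s) by lra.
have rs0 : 0 <= r - s by lra.
rewrite (csgD hT)// -(linfB (csg_linear hT s0)).
apply: (le_trans (HM _ s0 (le_trans sr rt) _)).
move: rs0; rewrite le_eqVlt => /orP[/eqP <-|rs0].
  by rewrite (csg0 hT) subrr normr0 mulr0 ltW.
by rewrite mulrC -ler_pdivlMr; [exact: Hd|lra].
Qed.

Lemma genZ (b : R) y a : gen T y a -> gen T (b *: y) (b *: a).
Proof.
move=> H e e0.
have c0 : 0 < `|b| + 1 by have := normr_ge0 b; lra.
have ec : 0 < e / (`|b| + 1) by rewrite divr_gt0.
have [d d0 Hd] := H _ ec; exists d => // h h0 hd.
rewrite (linfZ (csg_linear hT (ltW h0))) scalerA mulrC -scalerA -!scalerBr normrZ.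
have {}Hd := Hd _ h0 hd.
apply: (le_trans (ler_wpM2l (normr_ge0 b) Hd)).
rewrite mulrA ler_wpM2r ?(ltW h0)// mulrCA ler_piMr ?(ltW e0)//.
rewrite ler_pdivrMr//; lra.
Qed.

Lemma genB y a y' a' : gen T y a -> gen T y' a' -> gen T (y - y') (a - a').
Proof.
move=> H H' e e0; have e2 : 0 < e / 2 by lra.
have [d d0 Hd] := H _ e2; have [d' d0' Hd'] := H' _ e2.
exists (Num.min d d'); first by rewrite lt_min d0.
move=> h h0; rewrite lt_min => /andP[hd hd'].
rewrite (linfB (csg_linear hT (ltW h0))) scalerBr.
rewrite (_ : _ - _ = (T h y - y - h *: a) - (T h y' - y' - h *: a')); last first.
  by module R.
apply: (le_trans (ler_normB _ _)).
have := Hd _ h0 hd; have := Hd' _ h0 hd'; lra.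
Qed.

Lemma gen_csg y a (s : R) : 0 <= s -> gen T y a -> gen T (T s y) (T s a).
Proof.
move=> s0 H e e0; have [M M1 HM] := csg_bound s.
have eM : 0 < e / M by rewrite divr_gt0//; lra.
have [d d0 Hd] := H _ eM; exists d => // h h0 hd.
have -> : T h (T s y) = T s (T h y).
  by rewrite -!(csgD hT) ?(ltW h0)// [h + s]addrC.
have lT := csg_linear hT s0.
rewrite -(linfB lT) -(linfZ lT) -(linfB lT) (le_trans (HM _ s0 (lexx s) _))//.
rewrite mulrC -ler_pdivlMr; last by lra.
rewrite mulrAC; exact: Hd.
Qed.

Lemma gen_unique y a a' : gen T y a -> gen T y a' -> a = a'.
Proof.
move=> H H'; apply/eqP; rewrite -subr_eq0 -normr_eq0; apply/eqP/le_anti.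
rewrite normr_ge0 andbT; apply/ler_addgt0Pr => e e0; rewrite add0r.
have e2 : 0 < e / 2 by lra.
have [d d0 Hd] := H _ e2; have [d' d0' Hd'] := H' _ e2.
pose h := Num.min d d' / 2.
have m0 : 0 < Num.min d d' by rewrite lt_min d0.
have h0 : 0 < h by rewrite /h; lra.
have md : Num.min d d' <= d by rewrite ge_min lexx.
have md' : Num.min d d' <= d' by rewrite ge_min lexx orbT.
have {}Hd := Hd h h0 ltac:(rewrite /h; lra); have {}Hd' := Hd' h h0 ltac:(rewrite /h; lra).
rewrite -(ler_pM2l h0) -[X in X * _](gtr0_norm h0) -normrZ.
rewrite (_ : _ *: _ = (T h y - y - h *: a') - (T h y - y - h *: a)); last first.
  by module R.
by apply: (le_trans (ler_normB _ _)); lra.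
Qed.

(* The increment over [h] is cut into [N] pieces on which the definition of the
   generator applies, and [N] tends to infinity. *)
Lemma gen_increment y a (h K : R) : 0 <= h -> gen T y a ->
  (forall r : R, 0 <= r -> r <= h -> `|T r a - a| <= K) ->
  `|T h y - y - h *: a| <= h * K.
Proof.
rewrite le_eqVlt => /orP[/eqP <- _ _|h0 H HK].
  by rewrite (csg0 hT) subrr scale0r subrr normr0 mul0r.
apply/ler_addgt0Pr => e e0; have [M M1 HM] := csg_bound h.
have hM0 : 0 < h * M by rewrite mulr_gt0//; lra.
(* This tolerance survives the factor [M] lost in applying [T (k s)] and then sums to [e] over the
   pieces, whose total length is [h]. *)
have ehM : 0 < e / (h * M) by rewrite divr_gt0.
have [d d0 Hd] := H _ ehM.
have [N HN] := ex_nat_div_lt (ltW h0) d0.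
have := HN _ (leqnn N); set n := N.+1; set s := h / n%:R => sd.
have n0 : 0 < n%:R :> R by rewrite ltr0n.
have s0 : 0 < s by rewrite divr_gt0.
have nsh : n%:R * s = h by rewrite mulrC divfK// gt_eqF.
suff /(_ _ (leqnn n)) : forall k, (k <= n)%N ->
    `|T (k%:R * s) y - y - (k%:R * s) *: a| <= k%:R * s * (K + e / h).
  rewrite nsh mulrDr mulrCA divff ?gt_eqF// mulr1 //.
elim=> [_|k IH kn].
  by rewrite !mul0r (csg0 hT) subrr scale0r subrr normr0.
have {}IH := IH (ltnW kn).
have ks0 : 0 <= k%:R * s by rewrite mulr_ge0// ltW.
have ksh : k%:R * s <= h by rewrite -nsh ler_pM2r// ler_nat ltnW.
have lT := csg_linear hT ks0.
rewrite -natr1 mulrDl mul1r.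
rewrite (_ : _ - _ = (T (k%:R * s) y - y - (k%:R * s) *: a) +
   (T (k%:R * s) (T s y - y - s *: a) + s *: (T (k%:R * s) a - a))); last first.
  rewrite (csgD hT)// ?(ltW s0)// !(linfB lT) (linfZ lT).
  by module R.
apply: (le_trans (ler_normD _ _)); rewrite mulrDl; apply: lerD => //.
apply: (le_trans (ler_normD _ _)); rewrite mulrDr addrC; apply: lerD.
  by rewrite normrZ gtr0_norm// ler_pM2l// HK.
rewrite (le_trans (HM _ ks0 ksh _))// (le_trans (ler_wpM2l _ (Hd _ s0 sd)))//; first by lra.
suff -> : M * (e / (h * M) * s) = s * (e / h) by [].
by field; rewrite !gt_eqF//; lra.
Qed.

End Semigroup.

Lemma ler_normD_le (R : realType) (E : normedModType R) (x y : E) (a b : R) :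
  `|x| <= a -> `|y| <= b -> `|x + y| <= a + b.
Proof. by move=> xa yb; rewrite (le_trans (ler_normD _ _))// lerD. Qed.

(** * Integrals of orbits as limits of Riemann sums *)

Section OrbitIntegral.
Variables (R : realType) (E : completeNormedModType R) (T : R -> E -> E).
Hypothesis hT : csemigroup T.
Variable v : E.

(** The left Riemann sum of the orbit over [[0, N d]], up to the factor [d]. *)
Let Q (N : nat) (d : R) : E := \sum_(k < N) T (k%:R * d) v.

Let QS N (d : R) : Q N.+1 d = Q N d + T (N%:R * d) v.
Proof. by rewrite /Q big_ord_recr. Qed.

Let QD A B (d : R) : 0 <= d -> Q (A + B) d = Q A d + T (A%:R * d) (Q B d).
Proof.
move=> d0; have Ad0 : 0 <= A%:R * d by rewrite mulr_ge0.
have lT := csg_linear hT Ad0.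
elim: B => [|B IH]; first by rewrite addn0 /Q big_ord0 (linf0 lT) addr0.
rewrite addnS !QS IH (linfD lT).
by rewrite -(csgD hT) ?mulr_ge0// -mulrDl -natrD addrA.
Qed.

Let Q_near N (d K : R) : 0 <= d ->
  (forall r : R, 0 <= r -> r <= N%:R * d -> `|T r v - v| <= K) ->
  `|Q N d - N%:R *: v| <= N%:R * K.
Proof.
move=> d0 HK; have -> : N%:R *: v = \sum_(k < N) v.
  by rewrite sumr_const card_ord scaler_nat.
have -> : N%:R * K = \sum_(k < N) K by rewrite sumr_const card_ord mulr_natl.
rewrite /Q -sumrB (le_trans (ler_norm_sum _ _ _))//.
apply: ler_sum => i _; apply: HK; first by rewrite mulr_ge0.
by rewrite ler_wpM2r// ler_nat ltnW.
Qed.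

(** On each coarse interval the two sums differ by [T] at its left end applied to the error over the
    first interval, and [Q_near] bounds that error. *)
Let Q_refine N c (d M K : R) : 0 <= d -> 0 <= M ->
  (forall s : R, 0 <= s -> s <= N%:R * (c%:R * d) -> forall x, `|T s x| <= M * `|x|) ->
  (forall r : R, 0 <= r -> r <= c%:R * d -> `|T r v - v| <= K) ->
  `|d *: Q (N * c) d - (c%:R * d) *: Q N (c%:R * d)| <= N%:R * (c%:R * d) * (M * K).
Proof.
move=> d0 M0; have cd0 : 0 <= c%:R * d by rewrite mulr_ge0.
elim: N => [|N IH] HM HK.
  by rewrite mul0n !mul0r /Q !big_ord0 !scaler0 subrr normr0.
have NN : N%:R * (c%:R * d) <= N.+1%:R * (c%:R * d) by rewrite ler_wpM2r// ler_nat.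
have Ns0 : 0 <= N%:R * (c%:R * d) by rewrite mulr_ge0.
have lT := csg_linear hT Ns0.
rewrite mulSn addnC QD// QS natrM -mulrA.
rewrite (_ : _ - _ = (d *: Q (N * c) d - (c%:R * d) *: Q N (c%:R * d)) +
   d *: T (N%:R * (c%:R * d)) (Q c d - c%:R *: v)); last first.
  by rewrite (linfB lT) (linfZ lT); module R.
apply: (le_trans (ler_normD _ _)); rewrite -natr1 mulrDl mul1r mulrDl; apply: lerD.
  apply: IH => // s s0 sN; apply: HM => //; exact: le_trans NN.
rewrite normrZ ger0_norm// (_ : c%:R * d * (M * K) = d * (M * (c%:R * K))); last by ring.
rewrite ler_wpM2l// (le_trans (HM _ Ns0 NN _))// ler_wpM2l//.
exact: Q_near.
Qed.

(* [w] is the integral of the orbit of [v] over [0, a], obtained as the limit of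
   the dyadic Riemann sums [S]. *)
Lemma orbit_integral (a K : R) : 0 < a ->
  (forall r : R, 0 <= r -> r <= a -> `|T r v - v| <= K) ->
  exists w, gen T w (T a v - v) /\ `|w - a *: v| <= a * K.
Proof.
move=> a0 HK.
pose d n : R := a / (2 ^ n)%:R.
pose S n : E := d n *: Q (2 ^ n) (d n).
have two0 n : 0 < (2 ^ n)%:R :> R by rewrite ltr0n expn_gt0.
have d0 n : 0 < d n by rewrite divr_gt0.
have dE n : (2 ^ n)%:R * d n = a by rewrite mulrC divfK// gt_eqF.
have [M M1 HM] := csg_bound hT (a + 1).
have M0 : 0 <= M by lra.
have HMa s : 0 <= s -> s <= a -> forall x, `|T s x| <= M * `|x|.
  by move=> s0 sa; apply: HM => //; lra.
have K0 : 0 <= K by rewrite (le_trans (normr_ge0 _) (HK _ (lexx 0) (ltW a0))).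
have dsmall (e : R) : 0 < e -> exists N, forall n, (N <= n)%N -> d n < e.
  move=> e0; have [N HN] := ex_nat_div_lt (ltW a0) e0; exists N.+1 => n Nn.
  have := HN _ (leqnn N); apply: le_lt_trans; rewrite /d ler_pM2l// lef_pV2 ?posrE//.
  by rewrite ler_nat (leq_trans Nn)// ltnW// ltn_expl.
have SC : forall e : R, 0 < e -> exists N, forall n, (N <= n)%N -> `|S n - S N| <= e.
  move=> e e0; have c0 : 0 < e / (a * M) by rewrite divr_gt0// mulr_gt0//; lra.
  have [del del0 Hdel] := csg_cont hT v c0.
  have [N HN] := dsmall _ del0; exists N => n Nn.
  have dN : d N = (2 ^ (n - N))%:R * d n.
    apply: (mulfI (lt0r_neq0 (two0 N))).
    by rewrite dE mulrA -natrM -expnD subnKC//.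
  have nE : (2 ^ n = 2 ^ N * 2 ^ (n - N))%N by rewrite -expnD subnKC.
  rewrite /S nE dN.
  have := @Q_refine (2 ^ N) (2 ^ (n - N)) (d n) M (e / (a * M)) (ltW (d0 n)) M0.
  rewrite -dN dE => /(_ HMa) Hr; apply: (le_trans (Hr _)).
    move=> r; rewrite le_eqVlt => /orP[/eqP <- _|r0 rN].
      by rewrite (csg0 hT) subrr normr0 ltW.
    by apply: Hdel => //; rewrite (le_lt_trans rN)// HN.
  suff -> : a * (M * (e / (a * M))) = e by [].
  by field; rewrite !gt_eqF//; lra.
have [w Hw] := cauchy_seq_limit SC; exists w; split; last first.
  apply/ler_addgt0Pr => e e0; have [N HN] := Hw _ e0.
  rewrite [leRHS]addrC (le_trans (ler_distD (S N) _ _))// lerD//.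
    by rewrite distrC HN.
  rewrite (_ : _ - _ = d N *: (Q (2 ^ N) (d N) - (2 ^ N)%:R *: v)); last first.
    by rewrite scalerBr scalerA (mulrC (d N)) dE.
  rewrite normrZ gtr0_norm// -[in leRHS](dE N) -mulrA mulrCA ler_wpM2l ?(ltW (d0 N))//.
  by apply: Q_near; [exact: ltW | rewrite dE].
move=> e e0; set g := T a v - v.
(* [M + 1] bounds the norm of [T a - 1], which is applied below to an error of this relative
   size. *)
have eM : 0 < e / (M + 1) by rewrite divr_gt0//; lra.
have [del del0 Hdel] := csg_cont hT v eM.
exists (Num.min del 1); first by rewrite lt_min del0 ltr01.
move=> h h0; rewrite lt_min => /andP[hdel h1].
apply/ler_addgt0Pr => e' e'0.
have e60 : 0 < e' / 6 by lra.
have e6M : 0 < e' / (6 * M) by rewrite divr_gt0//; lra.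
have e6M' : M * (e' / (6 * M)) = e' / 6 by field; rewrite gt_eqF//; lra.
have [n1 Hn1] := Hw _ e6M.
have e'6M : e' / (6 * M) <= e' / 6.
  by rewrite ler_pM2l// lef_pV2 ?posrE//; lra.
have [del2 del20 Hdel2] := csg_uniform_cont hT 1 w e60.
have g10 : 0 < `|g| + 1 by have := normr_ge0 g; lra.
have [n2 Hn2] := dsmall (Num.min del2 (e' / 6 / (`|g| + 1)))
  ltac:(by rewrite lt_min del20 divr_gt0).
pose n := maxn n1 n2.
have Sw : `|S n - w| <= e' / (6 * M) by rewrite Hn1// leq_maxl.
have := Hn2 n (leq_maxr _ _); rewrite lt_min => /andP[dn1 dn2].
(* Rounding [h] down to a multiple of the mesh makes [T s] shift the Riemann sum by exactly [j]
   terms. *)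
pose j := Num.truncn (h / d n); pose s := j%:R * d n.
have /andP[sh hs] : s <= h < s + d n.
  have := truncn_itv (ltW (divr_gt0 h0 (d0 n))) => /andP[]; rewrite -/j.
  by rewrite ler_pdivlMr// ltr_pdivrMr// -natr1 mulrDl mul1r /s => -> ->.
have s0 : 0 <= s by rewrite mulr_ge0// ltW.
have lTs := csg_linear hT s0.
have b1 : `|T h w - T s w| <= e' / 6 by apply: Hdel2 => //; lra.
have b2 : `|T s w - T s (S n)| <= e' / 6.
  rewrite -(linfB lTs) (le_trans (HM _ s0 _ _))//; first by lra.
  by rewrite -e6M' ler_wpM2l// distrC.
have b3 : `|T s (S n) - S n - s *: g| <= e * h.
  have -> : T s (S n) - S n - s *: g = d n *: (T a (Q j (d n) - j%:R *: v)
      - (Q j (d n) - j%:R *: v)).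
    have lTa := csg_linear hT (ltW a0).
    (* Splitting [Q (j + 2 ^ n)] in both ways: [T s - 1] acts on the whole sum as [T a - 1] acts on
       its first [j] terms. This is the discrete fundamental theorem of calculus. *)
    have e1 : Q j (d n) + T s (Q (2 ^ n) (d n)) = Q (2 ^ n) (d n) + T a (Q j (d n)).
      by rewrite -(dE n) -QD ?(ltW (d0 n))// addnC QD ?(ltW (d0 n))//.
    have -> : T s (S n) = d n *: (Q (2 ^ n) (d n) + T a (Q j (d n)) - Q j (d n)).
      by rewrite -e1 addrC addKr /S (linfZ lTs).
    by rewrite /S (linfB lTa) (linfZ lTa) /g /s; module R.
  have Hq : `|Q j (d n) - j%:R *: v| <= j%:R * (e / (M + 1)).
    apply: Q_near; first exact: ltW.
    move=> r; rewrite le_eqVlt => /orP[/eqP <- _|r0 rj].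
      by rewrite (csg0 hT) subrr normr0 ltW.
    by apply: Hdel => //; apply: le_lt_trans hdel; exact: le_trans rj sh.
  rewrite normrZ gtr0_norm//.
  have aa : `|T a (Q j (d n) - j%:R *: v) - (Q j (d n) - j%:R *: v)| <= j%:R * e.
    apply: (le_trans (ler_normB _ _)).
    rewrite (le_trans (lerD (HMa _ (ltW a0) (lexx a) _) (lexx _)))//.
    rewrite -{2}[`|_ - _|]mul1r -mulrDl (le_trans (ler_wpM2l _ Hq))//; first by lra.
    suff -> : (M + 1) * (j%:R * (e / (M + 1))) = j%:R * e by [].
    by field; rewrite gt_eqF//; lra.
  apply: (le_trans (ler_wpM2l (ltW (d0 n)) aa)).
  by rewrite mulrCA mulrA -/s mulrC ler_pM2l.
have b5 : `|s *: g - h *: g| <= e' / 6.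
  rewrite -scalerBl normrZ distrC ger0_norm ?subr_ge0//.
  have hsd : h - s <= d n by lra.
  rewrite (le_trans (ler_wpM2r (normr_ge0 g) hsd))//.
  move: dn2; rewrite ltr_pdivlMr// mulrDr mulr1 => dn2; have := d0 n; lra.
rewrite (_ : _ - _ = (T h w - T s w) + (T s w - T s (S n)) +
  (T s (S n) - S n - s *: g) + (S n - w) + (s *: g - h *: g)); last by module R.
apply: (le_trans (ler_normD_le (ler_normD_le (ler_normD_le (ler_normD_le b1 b2) b3)
  Sw) b5)); lra.
Qed.

End OrbitIntegral.

(** * Density of the domain, and growth bounds from dissipativity *)

Section GeneratorDomain.
Variables (R : realType) (E : completeNormedModType R) (T : R -> E -> E).
Hypothesis hT : csemigroup T.

(** [w] is the mean of the orbit over a short interval [[0, a]]. The value of the generator is kept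
    explicit so that the averaging can be applied to vectors already in the domain. *)
Lemma gen_average (v : E) (e : R) : 0 < e -> exists2 a : R, 0 < a & exists w,
  gen T w (a^-1 *: (T a v - v)) /\ `|w - v| <= e.
Proof.
move=> e0; have [d d0 Hd] := csg_cont hT v e0.
pose a := d / 2; have a0 : 0 < a by rewrite /a; lra.
exists a => //; have [|w [Hw wv]] := @orbit_integral _ _ _ hT v a e a0.
  move=> r; rewrite le_eqVlt => /orP[/eqP <- _|r0 ra].
    by rewrite (csg0 hT) subrr normr0 ltW.
  by apply: Hd => //; move: ra; rewrite /a; lra.
exists (a^-1 *: w); split; first exact: genZ.
rewrite -(ler_pM2l a0) -[X in X * `|_|](gtr0_norm a0) -normrZ scalerBr scalerA.
by rewrite divff ?gt_eqF// scale1r.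
Qed.

Lemma gen_dense (v : E) (e : R) : 0 < e -> exists w g, gen T w g /\ `|w - v| <= e.
Proof.
by move=> e0; have [a _ [w Hw]] := gen_average v e0; exists w, (a^-1 *: (T a v - v)).
Qed.

(** Averaging twice: for [u] in the domain, the generator maps the mean of its orbit to a multiple
    of [T a u - u], which lies in the domain again. *)
Lemma gen2_dense (v : E) (e : R) : 0 < e -> exists w g g2,
  [/\ gen T w g, gen T g g2 & `|w - v| <= e].
Proof.
move=> e0; have e2 : 0 < e / 2 by lra.
have [u [gu [Hu uv]]] := gen_dense v e2.
have [a a0 [w [Hw wu]]] := gen_average u e2.
exists w, (a^-1 *: (T a u - u)), (a^-1 *: (T a gu - gu)); split => //.
  by apply: genZ => //; apply: genB => //; apply: gen_csg => //; exact: ltW.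
by rewrite (le_trans (ler_distD u _ _))//; lra.
Qed.

(* Dissipativity bounds the backward Euler step [u_{k-1} = u_k - d A u_k + o(d)]
   from below; [o(d)] is uniform along the orbit. *)
Lemma dissipative_growth (w : R) : 0 <= w ->
  (forall y a (h : R), gen T y a -> 0 < h -> (1 - w * h) * `|y| <= `|y - h *: a|) ->
  forall (t : R) x, 0 <= t -> `|T t x| <= expR (2 * w * t) * `|x|.
Proof.
move=> w0 diss t x; rewrite le_eqVlt => /orP[/eqP <-|t0].
  by rewrite mulr0 expR0 mul1r (csg0 hT).
have [M M1 HM] := csg_bound hT t.
set G := expR _; have G0 : 0 < G by exact: expR_gt0.
have core y a : gen T y a -> `|T t y| <= G * `|y|.
  move=> Hy; apply/ler_addgt0Pr => e e0.
  have [c c0 cE] : exists2 c : R, 0 < c & G * (M * t * (2 * c)) <= e.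
    exists (e / (G * (M * t * 2))).
      by rewrite divr_gt0// !mulr_gt0//; lra.
    rewrite le_eqVlt; apply/orP; left; apply/eqP; field.
    by rewrite !gt_eqF//; lra.
  have c2 : 0 < c / 2 by lra.
  have [d1 d10 Hd1] := Hy _ c2; have [d2 d20 Hd2] := csg_cont hT a c2.
  (* Below this step size [w * d <= 1/2], where [(1 - w d)^-1 <= 1 + 2 w d]. This is the origin of
     the factor 2 in the exponent. *)
  have d30 : 0 < (2 * (w + 1))^-1 by rewrite invr_gt0; lra.
  have dm0 : 0 < Num.min (Num.min d1 d2) (2 * (w + 1))^-1 by rewrite !lt_min d10 d20 d30.
  have [N HN] := ex_nat_div_lt (ltW t0) dm0.
  have := HN _ (leqnn N); set n := N.+1; set d := t / n%:R.
  rewrite !lt_min => /andP[/andP[dd1 dd2] dd3].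
  have n0 : 0 < n%:R :> R by rewrite ltr0n.
  have d0 : 0 < d by rewrite divr_gt0.
  have nd : n%:R * d = t by rewrite mulrC divfK// gt_eqF.
  have wd : w * d <= 2^-1.
    have : (w + 1) * d <= 2^-1.
      move: dd3; rewrite invfM -[X in _ < X]mulr1 mulrAC ltr_pdivlMr; last by lra.
      by rewrite mulr1 mulrC => /ltW.
    by rewrite mulrDl; lra.
  have wd0 : 0 <= w * d by rewrite mulr_ge0// ltW.
  pose u k := T (k%:R * d) y.
  have step k : (k < n)%N -> `|u k.+1| <= (1 + 2 * (w * d)) * (`|u k| + M * (d * c)).
    move=> kn; have kd0 : 0 <= k%:R * d by rewrite mulr_ge0// ltW.
    have kd1 : 0 <= k.+1%:R * d by rewrite mulr_ge0// ltW.
    have kdt : k%:R * d <= t by rewrite -nd ler_pM2r// ler_nat ltnW.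
    have lT := csg_linear hT kd0.
    have kS : k.+1%:R * d = k%:R * d + d by rewrite -natr1 mulrDl mul1r.
    have := diss _ _ d (gen_csg hT kd1 Hy) d0; rewrite -/(u k.+1) => Hdiss.
    have : `|u k.+1 - d *: T (k.+1%:R * d) a| <= `|u k| + M * (d * c).
      rewrite (_ : _ - _ = u k + T (k%:R * d)
         ((T d y - y - d *: a) - d *: (T d a - a))); last first.
        rewrite /u kS !(csgD hT) ?(ltW d0)// !(linfB lT, linfZ lT).
        by module R.
      rewrite (le_trans (ler_normD _ _))// lerD2l (le_trans (HM _ kd0 kdt _))//.
      rewrite ler_wpM2l//; first by lra.
      rewrite (le_trans (ler_normB _ _))// normrZ (gtr0_norm d0).
      have := Hd1 _ d0 dd1; have := Hd2 _ d0 dd2.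
      move=> /(ler_wpM2l (ltW d0)); lra.
    set B := `|u k| + _ => HB.
    have B0 : 0 <= B by apply: le_trans HB.
    have q0 : 0 < 1 - w * d by lra.
    have : `|u k.+1| <= (1 - w * d)^-1 * B by rewrite ler_pdivlMl//; exact: le_trans HB.
    move/le_trans; apply; rewrite ler_wpM2r// -[leLHS]mul1r ler_pdivrMr//; nra.
  have {}step k : (k <= n)%N -> `|u k| <= (1 + 2 * (w * d)) ^+ k * (`|y| + k%:R * (M * (d * c))).
    elim: k => [_|k IH kn].
      by rewrite /u mul0r (csg0 hT) expr0 mul1r mul0r addr0.
    apply: (le_trans (step _ kn)); rewrite exprS -mulrA ler_wpM2l//; first by lra.
    have p1 : 1 <= (1 + 2 * (w * d)) ^+ k by apply: exprn_ege1; lra.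
    have Mdc : 0 <= M * (d * c) by rewrite !mulr_ge0//; lra.
    have H1 := IH (ltnW kn).
    rewrite -(natr1 k) [(k%:R + 1) * _]mulrDl mul1r (addrA `|y|) [leRHS]mulrDr.
    apply: lerD => //; rewrite ler_peMl//.
  have := step _ (leqnn n); rewrite /u nd.
  have -> : n%:R * (M * (d * c)) = M * t * c by rewrite -nd; ring.
  move=> H1; apply: (le_trans H1); apply: (@le_trans _ _ (G * (`|y| + M * t * c))).
    rewrite ler_wpM2r// ?addr_ge0// ?mulr_ge0//; [lra|lra|lra|].
    rewrite /G -nd (_ : 2 * w * (n%:R * d) = 2 * (w * d) * n%:R); last by ring.
    rewrite expRM_natr lerXn2r// ?nnegrE ?expR_ge0//; first by lra.
    by rewrite expR_ge1Dx.
  rewrite mulrDr lerD2l (le_trans _ cE)// ler_pM2l// ler_wpM2l// ?mulr_ge0//; lra.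
apply/ler_addgt0Pr => e e0.
have c0 : 0 < e / (M + G) by rewrite divr_gt0//; lra.
have [y [a [Hy yx]]] := gen_dense x c0.
have lT := csg_linear hT (ltW t0).
have -> : T t x = T t y - T t (y - x) by rewrite (linfB lT); module R.
apply: (le_trans (ler_normB _ _)).
have b1 := core _ _ Hy; have b2 := HM _ (ltW t0) (lexx t) (y - x).
have b3 : `|y| <= `|x| + `|y - x|.
  by have := ler_normD x (y - x); rewrite addrC subrK.
have b4 : (M + G) * `|y - x| <= e by rewrite mulrC -ler_pdivlMr//; lra.
have b5 := ler_wpM2l (ltW G0) b3.
lra.
Qed.

End GeneratorDomain.

(** * Chernoff approximation with varying spaces *)

Section JointLimits.
Variable R : realType.

(** The joint limit [m -> oo], [h -> 0+] without any coupling between the two; inserting [h = t / n]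
    turns it into the double limit in [n] and [m]. *)
Definition evm (Q : nat -> R -> Prop) : Prop := exists N : nat, exists2 d : R,
  0 < d & forall m (h : R), (N <= m)%N -> 0 < h -> h < d -> Q m h.

Lemma evmI Q Q' : evm Q -> evm Q' -> evm (fun m h => Q m h /\ Q' m h).
Proof.
move=> [N [d d0 H]] [N' [d' d'0 H']]; exists (maxn N N'), (Num.min d d').
  by rewrite lt_min d0.
move=> m h; rewrite geq_max lt_min => /andP[Nm N'm] h0 /andP[hd hd'].
by split; [exact: H|exact: H'].
Qed.

Lemma evmS (Q Q' : nat -> R -> Prop) : (forall m (h : R), 0 < h -> Q m h -> Q' m h) ->
  evm Q -> evm Q'.
Proof.
by move=> S [N [d d0 H]]; exists N, d => // m h Nm h0 hd; apply: S => //; exact: H.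
Qed.

Lemma evm_small (d : R) : 0 < d -> evm (fun _ h => h < d).
Proof. by move=> d0; exists 0%N, d. Qed.

Lemma evm_large (Q : nat -> Prop) : (exists N, forall m, (N <= m)%N -> Q m) ->
  evm (fun m _ => Q m).
Proof. by move=> [N H]; exists N, 1 => // m h Nm _ _; exact: H. Qed.

Lemma evm_forall_lt (Q : nat -> nat -> R -> Prop) (J : nat) :
  (forall j, evm (Q j)) -> evm (fun m h => forall j, (j < J)%N -> Q j m h).
Proof.
move=> HQ; elim: J => [|J IH]; first by exists 0%N, 1.
apply: evmS (evmI IH (HQ J)) => m h h0 [H1 H2] j.
by rewrite ltnS leq_eqVlt => /orP[/eqP ->|/H1].
Qed.

End JointLimits.

(** * Resolvent of a single time step *)

Section Resolvent.
Variables (R : realType) (E : completeNormedModType R) (A : E -> E) (q l h : R).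
Hypotheses (lA : linear A) (bA : forall x, `|A x| <= q * `|x|).
Hypotheses (h0 : 0 < h) (q0 : 0 <= q) (ql : q + h <= 1 + l * h).

Let resolvent_coef_gt0 : 0 < 1 + l * h.
Proof. by apply: lt_le_trans ql; rewrite ltr_wpDl. Qed.

(* [y = (l - (A - 1) / h)^-1 p] *)
Definition step_resolvent (y p : E) : Prop := (1 + l * h) *: y = A y + h *: p.

Lemma step_resolventB y p y' p' : step_resolvent y p -> step_resolvent y' p' ->
  step_resolvent (y - y') (p - p').
Proof.
by rewrite /step_resolvent (linfB lA) scalerBr => -> ->; module R.
Qed.

Lemma step_resolventZ (a : R) y p : step_resolvent y p ->
  step_resolvent (a *: y) (a *: p).
Proof.
rewrite /step_resolvent (linfZ lA) => H.
transitivity (a *: ((1 + l * h) *: y)); first by module R.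
by rewrite H; module R.
Qed.

(** The hypothesis [q + h <= 1 + l * h] is tailored to the constant 1: moving [A y] to the left
    leaves [h |y| <= h |p|]. *)
Lemma step_resolvent_bound y p : step_resolvent y p -> `|y| <= `|p|.
Proof.
move=> H; have b0 := resolvent_coef_gt0.
have : (1 + l * h) * `|y| <= q * `|y| + h * `|p|.
  rewrite -[X in X * _](gtr0_norm b0) -normrZ H (le_trans (ler_normD _ _))//.
  by rewrite lerD// normrZ gtr0_norm.
move=> H1; have : h * `|y| <= h * `|p|; last by rewrite ler_pM2l.
have := ler_wpM2r (normr_ge0 y) ql; rewrite [X in X <= _]mulrDl; lra.
Qed.

(** The map sending [x] to [(1 + l h)^-1 (A x + h p)] is a contraction because [q < 1 + l h]. *)
Lemma step_resolvent_exists p : exists y, step_resolvent y p.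
Proof.
have b0 := resolvent_coef_gt0.
pose f0 := fun x : E => (1 + l * h)^-1 *: (A x + h *: p).
have funf : set_fun setT setT f0 by [].
pose f : {fun [set: E] >-> [set: E]} := HB.pack f0 (isFun.Build _ _ _ _ f0 funf).
have c0 : 0 <= (1 + l * h)^-1 * q by rewrite mulr_ge0// invr_ge0 ltW.
have ctr : is_contraction f.
  exists (NngNum c0); split => /=; first by rewrite ltr_pdivrMl// mulr1; have := h0; have := ql; lra.
  move=> [x y] _ /=; rewrite /f0 -scalerBr normrZ gtr0_norm ?invr_gt0// -mulrA.
  rewrite ler_pM2l ?invr_gt0//.
  rewrite (_ : _ - _ = A (x - y)) ?bA//.
  by rewrite (linfB lA); module R.
have [y _ yE] := banach_fixed_point ctr closedT (ex_intro _ 0 Logic.I).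
exists y; rewrite /step_resolvent {1}yE /= /f0 scalerA divff ?gt_eqF//.
by rewrite scale1r.
Qed.

End Resolvent.

Lemma expR_le_affine (R : realType) (x : R) : 0 <= x -> x <= 2^-1 ->
  expR x <= 1 + 2 * x.
Proof.
move=> x0 x2; rewrite -[x in expR x]opprK expRN.
have H : 1 - x <= expR (- x) by exact: expR_ge1Dx.
apply: (@le_trans _ _ (1 - x)^-1).
  by rewrite lef_pV2// posrE ?expR_gt0//; lra.
rewrite -[leLHS]mul1r ler_pdivrMr; last by lra.
nra.
Qed.

(** * Convergence of iterates from stability and consistency *)

Section Chernoff.
Variables (R : realType) (E : completeNormedModType R).
Variables (Em : nat -> completeNormedModType R) (P : forall m, E -> Em m) (K : R).
Hypotheses (lP : forall m, linear (P m)) (bP : forall m x, `|P m x| <= K * `|x|).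
Hypothesis K0 : 0 <= K.
Variables (F : forall m, R -> Em m -> Em m) (w : R).
Arguments F : clear implicits.
Hypotheses (lF : forall m (h : R), 0 <= h -> linear (F m h)).
Hypotheses (bF : forall m (h : R) x, 0 <= h -> `|F m h x| <= expR (w * h) * `|x|).
Hypothesis w0 : 0 <= w.
Variable U : R -> E -> E.
Hypothesis hU : csemigroup U.
Hypothesis cons : forall y g, gen U y g -> forall e : R, 0 < e ->
  evm (fun m h => `|F m h (P m y) - P m y - h *: P m g| <= e * h).

(** The term [2 * w] pays for [expR (w h) <= 1 + 2 w h] at small [h]; the remaining 1 is the margin
    that bounds the resolvents by 1. *)
Let lam := 2 * w + 1.

Let small_step : evm (fun _ h => expR (w * h) + h <= 1 + lam * h).
Proof.
have w0' := w0; have d0 : 0 < (2 * (w + 1))^-1 by rewrite invr_gt0; lra.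
apply: evmS (evm_small d0) => _ h h0 hd.
have wh0 : 0 <= w * h by rewrite mulr_ge0// ltW.
have wh : w * h <= 2^-1.
  have : (w + 1) * h <= 2^-1.
    move: hd; rewrite invfM -[X in _ < X]mulr1 mulrAC ltr_pdivlMr; last by lra.
    by rewrite mulr1 mulrC => /ltW.
  by rewrite mulrDl; lra.
have := expR_le_affine wh0 wh; rewrite /lam; nra.
Qed.

(** [z - P m y] solves the resolvent equation whose right-hand side is the one-step defect at [y]
    divided by [h]. *)
Let resolvent_cvg_pointwise y g : gen U y g -> forall e : R, 0 < e ->
  evm (fun m h => forall z, step_resolvent (F m h) lam h z (P m (lam *: y - g)) ->
    `|z - P m y| <= e).
Proof.
move=> Hy e e0.
apply: evmS (evmI small_step (cons Hy e0)) => m h h0 [hs Hc] z Hz.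
have lFm := @lF m h (ltW h0).
have : step_resolvent (F m h) lam h (z - P m y)
    (h^-1 *: (F m h (P m y) - P m y - h *: P m g)).
  rewrite /step_resolvent (linfB lFm) scalerA divff ?gt_eqF// scale1r scalerBr.
  rewrite Hz (linfB (lP m)) (linfZ (lP m)); module R.
move/(step_resolvent_bound (fun x => bF x (ltW h0)) h0 (expR_ge0 _) hs) => Hb.
rewrite (le_trans Hb)// normrZ normfV (gtr0_norm h0) mulrC ler_pdivrMr//.
Qed.

(** Convergence at finitely many times [s_ j] suffices: between them [P m (U s y)] moves little, and
    so does [z], by the resolvent bound. *)
Let resolvent_cvg_uniform y g (t : R) : 0 < t -> gen U y g ->
  forall e : R, 0 < e -> evm (fun m h => forall s : R, 0 <= s -> s <= t -> forall z,
    step_resolvent (F m h) lam h z (P m (U s (lam *: y - g))) ->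
    `|z - P m (U s y)| <= e).
Proof.
move=> t0 Hy e e0; set v := lam *: y - g.
have K0' := K0; have K1 : 0 < K + 1 by lra.
have e3 : 0 < e / 3 / (K + 1) by rewrite !divr_gt0.
have [d1 d10 Hd1] := csg_uniform_cont hU t v e3.
have [d2 d20 Hd2] := csg_uniform_cont hU t y e3.
have dm0 : 0 < Num.min d1 d2 by rewrite lt_min d10.
have [J HJ] := ex_nat_div_lt (ltW t0) dm0.
have := HJ _ (leqnn J); set n := J.+1; set d := t / n%:R.
rewrite lt_min => /andP[dd1 dd2].
have n0 : 0 < n%:R :> R by rewrite ltr0n.
have d0 : 0 < d by rewrite divr_gt0.
have nd : n%:R * d = t by rewrite mulrC divfK// gt_eqF.
have e30 : 0 < e / 3 by lra.
pose s_ (j : nat) : R := j%:R * d.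
have s_0 j : 0 <= s_ j by rewrite mulr_ge0// ltW.
have Hpt j : evm (fun m h => forall z,
    step_resolvent (F m h) lam h z (P m (U (s_ j) v)) -> `|z - P m (U (s_ j) y)| <= e / 3).
  have := resolvent_cvg_pointwise (gen_csg hU (s_0 j) Hy) e30.
  apply: evmS => m h h0 H z; rewrite /v => Hz; apply: H; move: Hz.
  by rewrite (linfB (csg_linear hU (s_0 j))) (linfZ (csg_linear hU (s_0 j))).
apply: evmS (evmI small_step (evm_forall_lt n.+1 Hpt)) => m h h0 [hs Hc] s s0 st z Hz.
pose j := Num.truncn (s / d).
have /andP[js sj] : s_ j <= s < s_ j + d.
  have := truncn_itv (divr_ge0 s0 (ltW d0)) => /andP[]; rewrite -/j.
  by rewrite ler_pdivlMr// ltr_pdivrMr// -(natr1 j) mulrDl mul1r /s_ => -> ->.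
have jn : (j < n.+1)%N.
  by rewrite ltnS -(ler_nat R) -(ler_pM2r d0) nd; exact: le_trans st.
have lFm := @lF m h (ltW h0); have bFm x := bF x (ltW h0) : `|F m h x| <= _.
have [zj Hzj] := step_resolvent_exists lFm bFm h0 (expR_ge0 _) hs (P m (U (s_ j) v)).
have b1 := Hc _ jn _ Hzj.
have Ksmall x : `|x| <= e / 3 / (K + 1) -> `|P m x| <= e / 3.
  move=> xe; rewrite (le_trans (bP m x))// (le_trans (ler_wpM2l K0 xe))//.
  by rewrite mulrCA ler_piMr ?(ltW e30)// ler_pdivrMr//; lra.
have b2 : `|z - zj| <= e / 3.
  have := step_resolvent_bound bFm h0 (expR_ge0 _) hs (step_resolventB lFm Hz Hzj).
  move/le_trans; apply; rewrite -(linfB (lP m)); apply: Ksmall.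
  by apply: Hd1 => //; lra.
have b3 : `|P m (U (s_ j) y) - P m (U s y)| <= e / 3.
  rewrite -(linfB (lP m)); apply: Ksmall; rewrite distrC.
  by apply: Hd2 => //; lra.
rewrite (_ : z - _ = (z - zj) + (zj - P m (U (s_ j) y)) +
  (P m (U (s_ j) y) - P m (U s y))); last by module R.
by apply: (le_trans (ler_normD_le (ler_normD_le b2 b1) b3)); lra.
Qed.

Lemma iter_step_bound m (h : R) (n : nat) x : 0 <= h ->
  `|iter n (F m h) x| <= expR (w * (n%:R * h)) * `|x|.
Proof.
move=> h0; elim: n => [|n IH]; first by rewrite mul0r mulr0 expR0 mul1r.
rewrite iterS (le_trans (bF _ h0))// -(natr1 n) mulrDl mul1r mulrDr expRD.
by rewrite mulrC [leRHS]mulrAC ler_wpM2r// expR_ge0.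
Qed.

Lemma linear_iter_step m (h : R) (n : nat) : 0 <= h -> linear (iter n (F m h)).
Proof.
move=> h0 a x y; elim: n => [//|n IH]; rewrite !iterS IH.
exact: (@lF m h h0).
Qed.

Lemma chernoff_smooth y g g2 (t : R) : 0 < t -> gen U y g -> gen U g g2 ->
  forall e : R, 0 < e -> exists N : nat, forall n m : nat, (N <= n)%N -> (N <= m)%N ->
    `|iter n (F m (t / n%:R)) (P m y) - P m (U t y)| <= e.
Proof.
move=> t0 Hy Hg e e0.
(* With [G] the generator of [U], [v] is [(lam - G) y] and [gv] is [G v]. The second derivative [g2]
   is needed because the orbit of [v] must be differentiable. *)
pose v := lam *: y - g; pose gv := lam *: g - g2.
have K0' := K0; have Hv : gen U v gv by apply: (genB hU) => //; exact: (genZ hU).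
have [M M1 HM] := csg_bound hU t.
set G := expR (w * t); have G0 : 0 < G by exact: expR_gt0.
have e40 : 0 < e / 4 by lra.
have eG : 0 < e / 4 / G by rewrite divr_gt0.
have etG : 0 < e / 4 / (t * G) by rewrite divr_gt0// mulr_gt0.
have etGK : 0 < e / 4 / (t * G) / ((K + 1) * M) by rewrite divr_gt0// mulr_gt0//; lra.
have [d1 d10 Hd1] := Hv _ etGK.
(* [e / 4 / G] controls the initial error, which all the steps may amplify by [G]; [e / 4] controls
   the final one. *)
have em0 : 0 < Num.min (e / 4) (e / 4 / G) by rewrite lt_min e40.
have [N [d d0 H]] := evmI (evmI small_step (evm_small d10))
  (evmI (resolvent_cvg_uniform t0 Hy em0) (resolvent_cvg_uniform t0 Hv etG)).
have [N' HN'] := ex_nat_div_lt (ltW t0) d0.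
(* The successor excludes [n' = 0], for which [t / n'] takes the default value 0. *)
exists (maxn N N'.+1) => n' m; rewrite !geq_max => /andP[_ N'n] /andP[Nm _].
case: n' N'n => // n N'n.
have := HN' _ N'n; set h := t / n.+1%:R => hd.
have n0 : 0 < n.+1%:R :> R by rewrite ltr0n.
have h0 : 0 < h by rewrite divr_gt0.
have nh : n.+1%:R * h = t by rewrite mulrC divfK// gt_eqF.
have [[hs hd1] [ry rv]] := H m h Nm h0 hd.
have lFm := @lF m h (ltW h0); have bFm x := bF x (ltW h0) : `|F m h x| <= _.
have ex p := step_resolvent_exists lFm bFm h0 (expR_ge0 _) hs p.
have bd := step_resolvent_bound bFm h0 (expR_ge0 _) hs.
have [z_ Hz_] := choice (fun k : nat => ex (P m (U (k%:R * h) v))).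
have kh0 k : 0 <= k%:R * h by rewrite mulr_ge0// ltW.
have kht k : (k <= n.+1)%N -> k%:R * h <= t by move=> kn; rewrite -nh ler_pM2r// ler_nat.
have z_y k : (k <= n.+1)%N -> `|z_ k - P m (U (k%:R * h) y)| <= Num.min (e / 4) (e / 4 / G).
  by move=> kn; apply: ry => //; exact: kht.
(* Let [x] be the resolvent at [U (k h) gv]. Differentiability of the orbit of [v] gives
   [z_ k.+1 - z_ k = h x + o(h)]. On the other hand [lam z_ k - x] is the resolvent at
   [(lam - G) U (k h) v], hence close to [P m (U (k h) v)], so that the resolvent equation gives
   [F m h (z_ k) - z_ k = h x + o(h)]. *)
have step k : (k < n.+1)%N -> `|z_ k.+1 - F m h (z_ k)| <= h * (e / 2 / (t * G)).
  move=> kn; have [x Hx] := ex (P m (U (k%:R * h) gv)).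
  have lU := csg_linear hU (kh0 k).
  have b1 : `|z_ k.+1 - z_ k - h *: x| <= e / 4 / (t * G) * h.
    have := step_resolventB lFm (step_resolventB lFm (Hz_ k.+1) (Hz_ k))
      (step_resolventZ lFm h Hx) => /bd.
    have -> : P m (U (k.+1%:R * h) v) - P m (U (k%:R * h) v) - h *: P m (U (k%:R * h) gv)
        = P m (U (k%:R * h) (U h v - v - h *: gv)).
      rewrite -(natr1 k) mulrDl mul1r (csgD hU) ?(ltW h0)//.
      by rewrite (linfB lU (_ - _)) (linfB lU (U h v)) (linfZ lU) !(linfB (lP m)) (linfZ (lP m)).
    move/le_trans; apply; rewrite (le_trans (bP m _))//.
    have c1 := HM _ (kh0 k) (kht _ (ltnW kn)) (U h v - v - h *: gv).
    have c2 := Hd1 _ h0 hd1.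
    apply: (@le_trans _ _ ((K + 1) * (M * (e / 4 / (t * G) / ((K + 1) * M) * h)))).
      apply: ler_pM => //; first by lra.
      by rewrite (le_trans c1)// ler_wpM2l//; lra.
    rewrite le_eqVlt; apply/orP; left; apply/eqP; field.
    by rewrite !gt_eqF//; lra.
  have b2 : `|lam *: z_ k - x - P m (U (k%:R * h) v)| <= e / 4 / (t * G).
    apply: (rv _ (kh0 k) (kht _ (ltnW kn))).
    rewrite (linfB lU) (linfZ lU) (linfB (lP m)) (linfZ (lP m)).
    by apply: (step_resolventB lFm) => //; exact: (step_resolventZ lFm).
  have Fz : F m h (z_ k) = (1 + lam * h) *: z_ k - h *: P m (U (k%:R * h) v).
    by rewrite (Hz_ k) addrK.
  rewrite Fz (_ : _ - _ = (z_ k.+1 - z_ k - h *: x) -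
    h *: (lam *: z_ k - x - P m (U (k%:R * h) v))); last by module R.
  rewrite (le_trans (ler_normB _ _))// normrZ gtr0_norm//.
  have := ler_wpM2l (ltW h0) b2.
  have -> : h * (e / 2 / (t * G)) = e / 4 / (t * G) * h + h * (e / 4 / (t * G)).
    by field; rewrite !gt_eqF.
  lra.
(* Each one-step defect is propagated by the later steps, which together amplify it by at most
   [expR (w k h)]. *)
have acc k : (k <= n.+1)%N -> `|z_ k - iter k (F m h) (z_ 0)| <=
    expR (w * (k%:R * h)) * (k%:R * (h * (e / 2 / (t * G)))).
  elim: k => [_|k IH kn]; first by rewrite subrr normr0 [X in _ * X]mul0r mulr0.
  have {}IH := IH (ltnW kn).
  set c := h * _ in IH *.
  have c0 : 0 <= c.
    by apply/ltW; rewrite mulr_gt0// divr_gt0 ?mulr_gt0//; lra.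
  rewrite iterS (_ : _ - _ = (z_ k.+1 - F m h (z_ k)) +
     F m h (z_ k - iter k (F m h) (z_ 0))); last by rewrite (linfB lFm); module R.
  have b2 : `|F m h (z_ k - iter k (F m h) (z_ 0))| <=
      expR (w * (k.+1%:R * h)) * (k%:R * c).
    rewrite (le_trans (bFm _))// (le_trans (ler_wpM2l (expR_ge0 _) IH))//.
    by rewrite [leLHS]mulrA -expRD -mulrDr -(natr1 k) mulrDl mul1r [h + _]addrC.
  apply: (le_trans (ler_normD_le (step _ kn) b2)).
  rewrite (_ : k.+1%:R * c = k%:R * c + c); last by rewrite -natr1; ring.
  rewrite mulrDr [leLHS]addrC lerD2l.
  rewrite ler_peMl// -[leLHS]expR0 ler_expR mulr_ge0//.
have b1 : `|iter n.+1 (F m h) (P m y) - iter n.+1 (F m h) (z_ 0)| <= e / 4.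
  have ->: iter n.+1 (F m h) (P m y) - iter n.+1 (F m h) (z_ 0) =
     iter n.+1 (F m h) (P m y - z_ 0).
    by rewrite (linfB (@linear_iter_step m h n.+1 (ltW h0))).
  rewrite (le_trans (@iter_step_bound m h n.+1 _ (ltW h0)))// nh -/G distrC mulrC.
  rewrite -ler_pdivlMr//; have := z_y 0%N isT.
  by rewrite mul0r (csg0 hU) le_min => /andP[].
have b2 : `|iter n.+1 (F m h) (z_ 0) - z_ n.+1| <= e / 2.
  rewrite distrC (le_trans (acc _ (leqnn _)))// nh -/G [n.+1%:R * _]mulrA nh.
  rewrite le_eqVlt; apply/orP; left; apply/eqP; field.
  by rewrite !gt_eqF.
have b3 : `|z_ n.+1 - P m (U t y)| <= e / 4.
  by have := z_y _ (leqnn n.+1); rewrite nh le_min => /andP[].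
rewrite (_ : _ - _ = (iter n.+1 (F m h) (P m y) - iter n.+1 (F m h) (z_ 0)) +
  (iter n.+1 (F m h) (z_ 0) - z_ n.+1) + (z_ n.+1 - P m (U t y))); last by module R.
by apply: (le_trans (ler_normD_le (ler_normD_le b1 b2) b3)); lra.
Qed.

(** The iterates, [P m] and [U t] have bounds independent of [n] and [m], so the smooth case extends
    from the dense domain of the squared generator. *)
Theorem chernoff x (t : R) : 0 < t -> forall e : R, 0 < e ->
  exists N : nat, forall n m : nat, (N <= n)%N -> (N <= m)%N ->
    `|iter n (F m (t / n%:R)) (P m x) - P m (U t x)| <= e.
Proof.
move=> t0 e e0; have [M M1 HM] := csg_bound hU t.
set G := expR (w * t); have G0 : 0 < G by exact: expR_gt0.
have e30 : 0 < e / 3 by lra.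
have K0' := K0; have K1 : 0 < K + 1 by lra.
have M0 : 0 < M by lra.
have c0 : 0 < e / 3 / ((K + 1) * (G + M)) by rewrite divr_gt0// mulr_gt0//; lra.
have [y [g [g2 [Hy Hg yx]]]] := gen2_dense hU x c0.
have [N HN] := chernoff_smooth t0 Hy Hg e30.
exists (maxn N 1) => n' m; rewrite !geq_max => /andP[Nn n'0] /andP[Nm _].
case: n' Nn n'0 => // n Nn _.
have b2 := HN _ _ Nn Nm; move: b2; set h := t / _ => b2.
have n0 : 0 < n.+1%:R :> R by rewrite ltr0n.
have h0 : 0 < h by rewrite divr_gt0.
have nh : n.+1%:R * h = t by rewrite mulrC divfK// gt_eqF.
have bnd (L : R) : 0 <= L -> L <= G + M -> L * (K * `|x - y|) <= e / 3.
  move=> L0 LGM; apply: (@le_trans _ _ ((G + M) * ((K + 1) * (e / 3 / ((K + 1) * (G + M)))))).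
    apply: ler_pM => //; first by rewrite mulr_ge0.
    by apply: ler_pM => //; [lra|rewrite distrC].
  by rewrite le_eqVlt; apply/orP; left; apply/eqP; field; rewrite !gt_eqF//; lra.
have b1 : `|iter n.+1 (F m h) (P m x) - iter n.+1 (F m h) (P m y)| <= e / 3.
  have -> : iter n.+1 (F m h) (P m x) - iter n.+1 (F m h) (P m y) =
     iter n.+1 (F m h) (P m (x - y)).
    by rewrite (linfB (lP m)) (linfB (@linear_iter_step m h n.+1 (ltW h0))).
  rewrite (le_trans (@iter_step_bound m h n.+1 _ (ltW h0)))// nh -/G.
  by rewrite (le_trans (ler_wpM2l (ltW G0) (bP m _)))// bnd//; lra.
have b3 : `|P m (U t y) - P m (U t x)| <= e / 3.
  rewrite distrC -(linfB (lP m)) -(linfB (csg_linear hU (ltW t0))).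
  rewrite (le_trans (bP m _))// (le_trans (ler_wpM2l K0 (HM _ (ltW t0) (lexx t) _)))//.
  by rewrite mulrCA bnd//; lra.
rewrite (_ : _ - _ = (iter n.+1 (F m h) (P m x) - iter n.+1 (F m h) (P m y)) +
  (iter n.+1 (F m h) (P m y) - P m (U t y)) + (P m (U t y) - P m (U t x))); last by module R.
by apply: (le_trans (ler_normD_le (ler_normD_le b1 b2) b3)); lra.
Qed.

End Chernoff.

Lemma evm_half (R : realType) (Q : nat -> R -> Prop) :
  evm Q -> evm (fun m h => Q m (h / 2)).
Proof.
move=> [N [d d0 H]]; exists N, d => // m h Nm h0 hd; apply: H => //; lra.
Qed.

(** * Estimates for approximating semigroups, uniform in the space index *)

Section ApproximateGenerators.
Variables (R : realType) (E : completeNormedModType R).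
Variables (Em : nat -> completeNormedModType R) (P : forall m, E -> Em m) (K : R).
Hypotheses (lP : forall m, linear (P m)) (bP : forall m x, `|P m x| <= K * `|x|).
Hypothesis K0 : 0 <= K.

(** Consistency of generators, measured inside [Em m]. The exact derivatives [am m] are kept because
    increments of [W m] are expressed through them. *)
Definition approx_gen (W : forall m, R -> Em m -> Em m) (y a : E) : Prop :=
  exists am : forall m, Em m, (forall m, gen (W m) (P m y) (am m)) /\
    forall e : R, 0 < e -> exists N : nat, forall m, (N <= m)%N -> `|am m - P m a| <= e.

Variables (W : forall m, R -> Em m -> Em m) (w : R).
Arguments W : clear implicits.
Hypotheses (hW : forall m, csemigroup (W m)) (w0 : 0 <= w).
Hypothesis bW : forall m (h : R) x, 0 <= h -> `|W m h x| <= expR (w * h) * `|x|.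

Let bW1 m (h : R) x : 0 <= h -> h <= 1 -> `|W m h x| <= expR w * `|x|.
Proof.
move=> h0 h1; rewrite (le_trans (bW x h0))// ler_wpM2r// ler_expR ler_piMr//.
Qed.

Hypothesis densW : forall x (e : R), 0 < e -> exists y a, approx_gen W y a /\ `|y - x| <= e.

(** For [y] with an approximate generator value, the increment of [W m] is at most [h] times a
    constant independent of [m]. Density of such [y] and the common growth bound give the result for
    every [q]. *)
Lemma approx_csg_cont q (e : R) : 0 < e ->
  evm (fun m h => `|W m h (P m q) - P m q| <= e).
Proof.
move=> e0; have K0' := K0.
set B := expR w; have B0 : 0 < B by exact: expR_gt0.
have K1 : 0 < K + 1 by lra.
have c0 : 0 < e / 2 / ((B + 1) * (K + 1)) by rewrite divr_gt0 ?mulr_gt0//; lra.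
have [y [a [[am [Ham am_a]] yq]]] := densW q c0.
have [N HN] := am_a 1 ltr01.
(* [A] bounds all [am m] with [m] large, since these are within 1 of [P m a]. *)
pose A := K * `|a| + 1.
have A0 : 0 < A by rewrite /A ltr_wpDl// mulr_ge0.
have d0 : 0 < Num.min 1 (e / 2 / ((B + 2) * A)).
  by rewrite lt_min ltr01 divr_gt0 ?mulr_gt0//; lra.
exists N, (Num.min 1 (e / 2 / ((B + 2) * A))) => // m h Nm h0.
rewrite lt_min => /andP[h1 hd].
have lW := csg_linear (hW m) (ltW h0).
have amA : `|am m| <= A.
  have -> : am m = (am m - P m a) + P m a by module R.
  by rewrite /A [leRHS]addrC; apply: ler_normD_le; [exact: HN|exact: bP].
have b1 : `|W m h (P m y) - P m y| <= e / 2.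
  have inc : `|W m h (P m y) - P m y - h *: am m| <= h * ((B + 1) * A).
    apply: (gen_increment (hW m) (ltW h0) (Ham m)) => r r0 rh.
    rewrite (le_trans (ler_normB _ _))// (le_trans (lerD (bW1 _ r0 _) (lexx _)))//.
      by lra.
    rewrite -/B -{2}[`|am m|]mul1r -mulrDl ler_wpM2l//; lra.
  have -> : W m h (P m y) - P m y = (W m h (P m y) - P m y - h *: am m) + h *: am m.
    by module R.
  have hA : `|h *: am m| <= h * A by rewrite normrZ gtr0_norm// ler_pM2l.
  apply: (le_trans (ler_normD_le inc hA)).
  move: hd; rewrite ltr_pdivlMr ?mulr_gt0//; last by lra.
  lra.
have b2 : `|P m (q - y)| <= e / 2 / (B + 1).
  rewrite (le_trans (bP m _))// distrC.
  apply: (@le_trans _ _ ((K + 1) * (e / 2 / ((B + 1) * (K + 1))))).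
    by apply: ler_pM => //; lra.
  rewrite le_eqVlt; apply/orP; left; apply/eqP; field.
  by rewrite !gt_eqF//; lra.
have b3 := @bW1 m h (P m (q - y)) (ltW h0) (ltW h1).
rewrite (_ : _ - _ = W m h (P m (q - y)) - P m (q - y) + (W m h (P m y) - P m y)); last first.
  by rewrite !(linfB (lP m)) (linfB lW); module R.
rewrite (le_trans (ler_normD_le (ler_normB _ _) b1))//.
have : (B + 1) * `|P m (q - y)| <= e / 2 by rewrite mulrC -ler_pdivlMr//; lra.
rewrite -/B in b3; lra.
Qed.

(** [gen_increment] reduces the defect to the oscillation of [W m r (am m)] for [r <= h]. Replacing
    [am m] by [P m a] costs little and makes [approx_csg_cont] applicable. *)
Lemma approx_gen_increment y a : approx_gen W y a -> forall e : R, 0 < e ->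
  evm (fun m h => `|W m h (P m y) - P m y - h *: P m a| <= e * h).
Proof.
move=> [am [Ham am_a]] e e0; have K0' := K0.
set B := expR w; have B0 : 0 < B by exact: expR_gt0.
have e30 : 0 < e / 2 by lra.
have c0 : 0 < e / 2 / (B + 2) by rewrite divr_gt0//; lra.
have [N [d d0 Hd]] := evmI (approx_csg_cont a e30) (evmI (evm_large R (am_a _ c0)) (evm_small ltr01)).
exists N, d => // m h Nm h0 hd.
have [_ [amP h1]] := Hd m h Nm h0 hd.
have inc : `|W m h (P m y) - P m y - h *: am m| <=
    h * (e / 2 + (B + 1) * (e / 2 / (B + 2))).
  apply: (gen_increment (hW m) (ltW h0) (Ham m)) => r r0 rh.
  have lW := csg_linear (hW m) r0.
  have -> : W m r (am m) - am m = (W m r (P m a) - P m a) +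
      (W m r (am m - P m a) - (am m - P m a)) by rewrite (linfB lW); module R.
  apply: ler_normD_le.
    move: r0; rewrite le_eqVlt => /orP[/eqP <-|r0].
      by rewrite (csg0 (hW m)) subrr normr0 ltW.
    by have [] := Hd m r Nm r0 (le_lt_trans rh hd).
  rewrite (le_trans (ler_normB _ _))// (le_trans (lerD (bW1 _ r0 _) (lexx _)))//.
    by lra.
  rewrite -/B -{2}[`|am m - _|]mul1r -mulrDl ler_wpM2l//; lra.
have -> : W m h (P m y) - P m y - h *: P m a =
  (W m h (P m y) - P m y - h *: am m) + h *: (am m - P m a) by module R.
have b2 : `|h *: (am m - P m a)| <= h * (e / 2 / (B + 2)).
  by rewrite normrZ gtr0_norm// ler_pM2l.
apply: (le_trans (ler_normD_le inc b2)).
rewrite le_eqVlt; apply/orP; left; apply/eqP; field.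
by rewrite gt_eqF//; lra.
Qed.

End ApproximateGenerators.

(** * Consistency and convergence of the three splittings *)

Section Splitting.
Variables (R : realType) (E : completeNormedModType R).
Variables (Em : nat -> completeNormedModType R) (P : forall m, E -> Em m) (K : R).
Hypotheses (lP : forall m, linear (P m)) (bP : forall m x, `|P m x| <= K * `|x|).
Hypothesis K0 : 0 <= K.
Variables (T S : forall m, R -> Em m -> Em m) (wT wS : R).
Arguments T : clear implicits.
Arguments S : clear implicits.
Hypotheses (hT : forall m, csemigroup (T m)) (hS : forall m, csemigroup (S m)).
Hypotheses (wT0 : 0 <= wT) (wS0 : 0 <= wS).
Hypothesis bT : forall m (h : R) x, 0 <= h -> `|T m h x| <= expR (wT * h) * `|x|.
Hypothesis bS : forall m (h : R) x, 0 <= h -> `|S m h x| <= expR (wS * h) * `|x|.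
Variable U : R -> E -> E.
Hypothesis hU : csemigroup U.
Hypothesis genU : forall y g, gen U y g -> exists a b,
  [/\ g = a + b, approx_gen P T y a & approx_gen P S y b].

Let densT x (e : R) : 0 < e -> exists y a, approx_gen P T y a /\ `|y - x| <= e.
Proof.
move=> e0; have [y [g [Hy yx]]] := gen_dense hU x e0.
by have [a [b [_ Ha _]]] := genU Hy; exists y, a.
Qed.

Let densS x (e : R) : 0 < e -> exists y a, approx_gen P S y a /\ `|y - x| <= e.
Proof.
move=> e0; have [y [g [Hy yx]]] := gen_dense hU x e0.
by have [a [b [_ _ Hb]]] := genU Hy; exists y, b.
Qed.

Let cT := approx_csg_cont lP bP K0 hT wT0 bT densT.
Let cS := approx_csg_cont lP bP K0 hS wS0 bS densS.
Let iT := approx_gen_increment lP bP K0 hT wT0 bT densT.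
Let iS := approx_gen_increment lP bP K0 hS wS0 bS densS.

Let bT1 m (h : R) x : 0 <= h -> h <= 1 -> `|T m h x| <= expR wT * `|x|.
Proof.
by move=> h0 h1; rewrite (le_trans (bT x h0))// ler_wpM2r// ler_expR ler_piMr.
Qed.

Let bS1 m (h : R) x : 0 <= h -> h <= 1 -> `|S m h x| <= expR wS * `|x|.
Proof.
by move=> h0 h1; rewrite (le_trans (bS x h0))// ler_wpM2r// ler_expR ler_piMr.
Qed.

Let cons_seq y g : gen U y g -> forall e : R, 0 < e ->
  evm (fun m h => `|seq_split (T m) (S m) h (P m y) - P m y - h *: P m g| <= e * h).
Proof.
move=> /genU[a [b [-> Ha Hb]]] e e0.
set B := expR wS; have B0 : 0 < B by exact: expR_gt0.
have c0 : 0 < e / (B + 2) by rewrite divr_gt0//; lra.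
apply: evmS (evmI (evmI (iT Ha c0) (iS Hb c0)) (evmI (cS a c0) (evm_small ltr01))).
move=> m h h0 [[r1 r2] [r3 h1]].
have lS := csg_linear (hS m) (ltW h0); rewrite /seq_split.
(* The increment [h a] produced by [T] is carried along by [S h], at the price of
   [h (S h P a - P a)], which is [o(h)] by continuity at 0. *)
rewrite (_ : _ - _ = S m h (T m h (P m y) - P m y - h *: P m a) +
  h *: (S m h (P m a) - P m a) + (S m h (P m y) - P m y - h *: P m b)); last first.
  by rewrite (linfB lS (_ - _)) (linfB lS (T m h _)) (linfZ lS) (linfD (lP m)); module R.
have b1 := le_trans (bS1 (T m h (P m y) - P m y - h *: P m a) (ltW h0) (ltW h1))
  (ler_wpM2l (expR_ge0 _) r1).
have b2 : `|h *: (S m h (P m a) - P m a)| <= h * (e / (B + 2)).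
  by rewrite normrZ gtr0_norm// ler_pM2l.
apply: (le_trans (ler_normD_le (ler_normD_le b1 b2) r2)); rewrite -/B.
rewrite le_eqVlt; apply/orP; left; apply/eqP; field.
by rewrite gt_eqF//; lra.
Qed.

Let cons_seq_swap y g : gen U y g -> forall e : R, 0 < e ->
  evm (fun m h => `|seq_split (S m) (T m) h (P m y) - P m y - h *: P m g| <= e * h).
Proof.
move=> /genU[a [b [-> Ha Hb]]] e e0.
set B := expR wT; have B0 : 0 < B by exact: expR_gt0.
have c0 : 0 < e / (B + 2) by rewrite divr_gt0//; lra.
apply: evmS (evmI (evmI (iT Ha c0) (iS Hb c0)) (evmI (cT b c0) (evm_small ltr01))).
move=> m h h0 [[r1 r2] [r3 h1]].
have lT := csg_linear (hT m) (ltW h0); rewrite /seq_split.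
rewrite (_ : _ - _ = T m h (S m h (P m y) - P m y - h *: P m b) +
  h *: (T m h (P m b) - P m b) + (T m h (P m y) - P m y - h *: P m a)); last first.
  by rewrite (linfB lT (_ - _)) (linfB lT (S m h _)) (linfZ lT) (linfD (lP m)); module R.
have b1 := le_trans (bT1 (S m h (P m y) - P m y - h *: P m b) (ltW h0) (ltW h1))
  (ler_wpM2l (expR_ge0 _) r2).
have b2 : `|h *: (T m h (P m b) - P m b)| <= h * (e / (B + 2)).
  by rewrite normrZ gtr0_norm// ler_pM2l.
apply: (le_trans (ler_normD_le (ler_normD_le b1 b2) r1)); rewrite -/B.
rewrite le_eqVlt; apply/orP; left; apply/eqP; field.
by rewrite gt_eqF//; lra.
Qed.

Let cons_weighted (Theta : R) y g : 0 < Theta < 1 -> gen U y g ->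
  forall e : R, 0 < e -> evm (fun m h =>
    `|weighted_split Theta (T m) (S m) h (P m y) - P m y - h *: P m g| <= e * h).
Proof.
move=> /andP[th0 th1] Hy e e0.
apply: evmS (evmI (cons_seq Hy e0) (cons_seq_swap Hy e0)) => m h h0 [].
rewrite /seq_split /weighted_split => b1 b2.
rewrite (_ : _ - _ = Theta *: (S m h (T m h (P m y)) - P m y - h *: P m g) +
  (1 - Theta) *: (T m h (S m h (P m y)) - P m y - h *: P m g)); last by module R.
rewrite (le_trans (ler_normD _ _))// !normrZ !gtr0_norm; [|lra|lra].
have t1 : 0 <= 1 - Theta by lra.
have := ler_wpM2l (ltW th0) b1; have := ler_wpM2l t1 b2; lra.
Qed.

Let cons_strang y g : gen U y g -> forall e : R, 0 < e ->
  evm (fun m h => `|strang_split (T m) (S m) h (P m y) - P m y - h *: P m g| <= e * h).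
Proof.
move=> /genU[a [b [-> Ha Hb]]] e e0.
set B := expR wS; have B0 : 0 < B by exact: expR_gt0.
set D := expR wT; have D0 : 0 < D by exact: expR_gt0.
have DB0 : 0 < D * B by rewrite mulr_gt0.
(* The four terms of the decomposition below are bounded by [D * (B + 2)], 1, 1 and 1 times
   [c * h]. *)
have c0 : 0 < e / (D * (B + 2) + 3) by rewrite divr_gt0//; nra.
apply: evmS (evmI (evmI (evmI (evm_half (iT Ha c0)) (iS Hb c0))
   (evmI (cS a c0) (evm_half (cT a c0)))) (evmI (evm_half (cT b c0)) (evm_small ltr01))).
move=> m h h0 [[[r1 r2] [r3 r4]] [r5 h1]].
have k0 : 0 < h / 2 by lra.
move: r1 r4 r5 k0; rewrite /strang_split; set k := h / 2 => r1 r4 r5 k0.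
set c := e / _ in c0 r1 r2 r3 r4 r5.
have hk : h = k + k by rewrite /k; lra.
have k1 : k <= 1 by lra.
have lS := csg_linear (hS m) (ltW h0); have lT := csg_linear (hT m) (ltW k0).
set x1 := T m k (P m y) - P m y - k *: P m a in r1.
set x2 := S m h (P m y) - P m y - h *: P m b in r2.
set x3 := S m h (P m a) - P m a in r3.
have e1 : T m k (P m y) = P m y + k *: P m a + x1 by rewrite /x1; module R.
have e2 : S m h (P m y) = P m y + h *: P m b + x2 by rewrite /x2; module R.
have e3 : S m h (P m a) = P m a + x3 by rewrite /x3; module R.
(* Each half step of [T] contributes [k a], and [k + k = h]; what remains is the error before the
   last half step, carried by [T k], and the errors of that half step. *)
rewrite (_ : _ - _ = T m k (S m h x1 + k *: x3 + x2) + x1 +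
  k *: (T m k (P m a) - P m a) + h *: (T m k (P m b) - P m b)); last first.
  have -> : S m h (T m k (P m y)) =
      P m y + k *: P m a + h *: P m b + (S m h x1 + k *: x3 + x2).
    by rewrite e1 (linfD lS) (linfD lS) (linfZ lS) e2 e3; module R.
  rewrite (linfD lT) (linfD lT (_ + _) (h *: _)) (linfD lT (P m y)) !(linfZ lT) e1.
  by rewrite (linfD (lP m)); module R; lra.
have b1 : `|S m h x1 + k *: x3 + x2| <= (B + 2) * c * h.
  have c1 := le_trans (bS1 x1 (ltW h0) (ltW h1)) (ler_wpM2l (expR_ge0 _) r1).
  have c2 : `|k *: x3| <= k * c by rewrite normrZ gtr0_norm// ler_pM2l.
  apply: (le_trans (ler_normD_le (ler_normD_le c1 c2) r2)); rewrite -/B.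
  have ck : 0 <= c * k := mulr_ge0 (ltW c0) (ltW k0).
  have Bck : 0 <= B * (c * k) := mulr_ge0 (ltW B0) ck.
  rewrite hk; lra.
have b2 := le_trans (bT1 (S m h x1 + k *: x3 + x2) (ltW k0) k1)
  (ler_wpM2l (expR_ge0 _) b1).
have b3 : `|k *: (T m k (P m a) - P m a)| <= h * c.
  by rewrite normrZ gtr0_norm//; apply: ler_pM => //; lra.
have b4 : `|h *: (T m k (P m b) - P m b)| <= h * c.
  by rewrite normrZ gtr0_norm// ler_pM2l.
have {}r1 : `|x1| <= h * c by rewrite (le_trans r1)// mulrC ler_pM2r//; lra.
apply: (le_trans (ler_normD_le (ler_normD_le (ler_normD_le b2 r1) b3) b4)).
rewrite -/D /c le_eqVlt; apply/orP; left; apply/eqP; field.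
by rewrite gt_eqF//; nra.
Qed.

Theorem splitting_cvg (F : forall m, R -> Em m -> Em m) (Theta : R) x (t : R) :
  0 < Theta < 1 ->
  (F = (fun m => seq_split (T m) (S m)) \/
   F = (fun m => strang_split (T m) (S m)) \/
   F = (fun m => weighted_split Theta (T m) (S m))) ->
  0 < t -> forall e : R, 0 < e ->
  exists N : nat, forall n m : nat, (N <= n)%N -> (N <= m)%N ->
    `|iter n (F m (t / n%:R)) (P m x) - P m (U t x)| <= e.
Proof.
move=> thP HF t0 e e0.
(* In each scheme a step spends total time [h] in [T] and [h] in [S], and a convex combination keeps
   the bound; so all three grow at rate [wT + wS]. *)
have w0 : 0 <= wT + wS by rewrite addr_ge0.
have stab_seq m (h : R) (z : Em m) : 0 <= h ->
    `|S m h (T m h z)| <= expR ((wT + wS) * h) * `|z|.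
  move=> h0; rewrite (le_trans (bS _ h0))// mulrDl expRD mulrC mulrAC ler_wpM2r//?expR_ge0//.
  by rewrite bT.
have stab_swap m (h : R) (z : Em m) : 0 <= h ->
    `|T m h (S m h z)| <= expR ((wT + wS) * h) * `|z|.
  move=> h0; rewrite (le_trans (bT _ h0))// mulrDl expRD -mulrA ler_wpM2l ?expR_ge0//.
  by rewrite bS.
case: HF => [|[|]] ->.
- apply: (@chernoff R E Em P K lP bP K0 (fun m => seq_split (T m) (S m))
    (wT + wS) _ _ w0 U hU cons_seq) => //.
    move=> m h h0 a u v; rewrite /seq_split.
    by rewrite (csg_linear (hT m) h0) (csg_linear (hS m) h0).
- apply: (@chernoff R E Em P K lP bP K0 (fun m => strang_split (T m) (S m))
    (wT + wS) _ _ w0 U hU cons_strang) => //.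
    move=> m h h0 a u v; rewrite /strang_split; have h20 : 0 <= h / 2 by lra.
    by rewrite !(csg_linear (hT m) h20, csg_linear (hS m) h0).
  move=> m h z h0; have h20 : 0 <= h / 2 by lra.
  rewrite /strang_split (le_trans (bT _ h20))//.
  rewrite (le_trans (ler_wpM2l (expR_ge0 _) (bS _ h0)))//.
  rewrite (le_trans (ler_wpM2l (expR_ge0 _) (ler_wpM2l (expR_ge0 _) (bT _ h20))))//.
  rewrite !mulrA -!expRD; apply: ler_wpM2r => //.
  by rewrite ler_expR le_eqVlt; apply/orP; left; apply/eqP; field.
- refine (@chernoff R E Em P K lP bP K0 (fun m => weighted_split Theta (T m) (S m))
    (wT + wS) _ _ w0 U hU _ x t t0 e e0).
  + move=> m h h0 a u v; rewrite /weighted_split.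
    rewrite (csg_linear (hT m) h0) (csg_linear (hS m) h0) (csg_linear (hS m) h0).
    by rewrite (csg_linear (hT m) h0); module R.
  + move=> m h z h0; rewrite /weighted_split; have /andP[th0 th1] := thP.
    rewrite (le_trans (ler_normD _ _))// !normrZ !gtr0_norm; [|lra|lra].
    have t1 : 0 <= 1 - Theta by lra.
    have := ler_wpM2l (ltW th0) (stab_seq m h z h0).
    have := ler_wpM2l t1 (stab_swap m h z h0); lra.
  + by move=> y g Hy; exact: cons_weighted.
Qed.

End Splitting.

(** * Quotient of a complete seminormed space *)

(** The axioms are restricted to [sn_dom] because [L1norm] is a total function that behaves as a
    seminorm on integrable functions only. Completeness is stated for geometrically fast sequences,
    the form that the Riesz-Fischer argument provides and that already makes the quotient
    complete. *)
Record seminormed (R : realType) := Seminormed {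
  sn_type : lmodType R;
  sn_dom : set sn_type;
  sn_norm : sn_type -> R;
  sn_dom0 : sn_dom 0;
  sn_domP : forall (a : R) u v, sn_dom u -> sn_dom v -> sn_dom (a *: u + v);
  sn_normD : forall u v, sn_dom u -> sn_dom v ->
    sn_norm (u + v) <= sn_norm u + sn_norm v;
  sn_normZ : forall (a : R) u, sn_dom u -> sn_norm (a *: u) = `|a| * sn_norm u;
  sn_complete : forall u : nat -> sn_type, (forall n, sn_dom (u n)) ->
    (forall n, sn_norm (u n.+1 - u n) <= 2^-1 ^+ n) ->
    exists2 l, sn_dom l &
      forall e : R, 0 < e -> exists N, forall n, (N <= n)%N -> sn_norm (u n - l) <= e }.

(** * The Banach space of classes modulo null vectors *)

Section Quotient.
Variables (R : realType) (S : seminormed R).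
Local Notation V := (sn_type S).
Local Notation dom := (@sn_dom _ S).
Local Notation nrm := (@sn_norm _ S).

Lemma sn_domD u v : dom u -> dom v -> dom (u + v).
Proof. by move=> du dv; have := sn_domP 1 du dv; rewrite scale1r. Qed.

Lemma sn_domZ (a : R) u : dom u -> dom (a *: u).
Proof. by move=> du; have := sn_domP a du (sn_dom0 S); rewrite addr0. Qed.

Lemma sn_domN u : dom u -> dom (- u).
Proof. by rewrite -scaleN1r; exact: sn_domZ. Qed.

Lemma sn_domB u v : dom u -> dom v -> dom (u - v).
Proof. by move=> du dv; apply: sn_domD => //; exact: sn_domN. Qed.

Lemma sn_norm0 : nrm 0 = 0.
Proof. by rewrite -(scale0r 0) sn_normZ ?normr0 ?mul0r//; exact: sn_dom0. Qed.

Lemma sn_normN u : dom u -> nrm (- u) = nrm u.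
Proof. by move=> du; rewrite -scaleN1r sn_normZ// normrN normr1 mul1r. Qed.

Lemma sn_distC u v : dom u -> dom v -> nrm (u - v) = nrm (v - u).
Proof. by move=> du dv; rewrite -sn_normN ?opprB//; exact: sn_domB. Qed.

Lemma sn_norm_ge0 u : dom u -> 0 <= nrm u.
Proof.
move=> du; have := sn_normD du (sn_domN du).
by rewrite subrr sn_norm0 sn_normN//; lra.
Qed.

Lemma sn_dist_trans v u w : dom u -> dom v -> dom w ->
  nrm (u - w) <= nrm (u - v) + nrm (v - w).
Proof.
move=> du dv dw; have -> : u - w = (u - v) + (v - w) by module R.
by apply: sn_normD; exact: sn_domB.
Qed.

Definition sn_class (v : V) : set V := [set u | dom u /\ nrm (u - v) = 0].

(** A class is the set of its representatives, so that agreement up to a null vector becomes the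
    equality required by the algebraic structures. *)
Definition squot := {A : set V | exists2 v, dom v & A = sn_class v}.

HB.instance Definition _ := gen_eqMixin squot.
HB.instance Definition _ := gen_choiceMixin squot.

(* [spi v] is the class of [0] when [v] lies outside the domain *)
Definition spi (v : V) : squot :=
  match pselect (dom v) with
  | left dv => exist _ (sn_class v) (ex_intro2 _ _ v dv erefl)
  | right _ => exist _ (sn_class 0) (ex_intro2 _ _ 0 (sn_dom0 S) erefl)
  end.

Definition srepr (q : squot) : V := s2val (cid2 (proj2_sig q)).

Lemma srepr_dom q : dom (srepr q).
Proof. by rewrite /srepr; case: cid2. Qed.
Hint Resolve srepr_dom : core.

Lemma squot_inj (q q' : squot) : sval q = sval q' -> q = q'.
Proof. by case: q q' => [A HA] [B HB] /= E; exact: eq_exist. Qed.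

Lemma spi_val v : dom v -> sval (spi v) = sn_class v.
Proof. by rewrite /spi; case: pselect. Qed.

Lemma sreprK q : spi (srepr q) = q.
Proof.
by apply: squot_inj; rewrite spi_val// /srepr; case: cid2.
Qed.

Lemma spi_eq u v : dom u -> dom v -> nrm (u - v) = 0 -> spi u = spi v.
Proof.
move=> du dv uv0; apply: squot_inj; rewrite !spi_val//; apply/seteqP.
split=> w [dw w0]; split => //; apply/le_anti; rewrite sn_norm_ge0 ?andbT;
  try exact: sn_domB.
  by rewrite (le_trans (sn_dist_trans dw du dv))// w0 uv0 addr0.
by rewrite (le_trans (sn_dist_trans dw dv du))// w0 sn_distC// uv0 addr0.
Qed.

Lemma spi_inj u v : dom u -> dom v -> spi u = spi v -> nrm (u - v) = 0.
Proof.
move=> du dv /(congr1 (@sval _ _)); rewrite !spi_val// => E.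
have : sn_class u u by split; rewrite ?subrr ?sn_norm0.
by rewrite E => -[].
Qed.

Lemma srepr_spi v : dom v -> nrm (srepr (spi v) - v) = 0.
Proof. by move=> dv; apply: spi_inj => //; rewrite sreprK. Qed.

Lemma spi_ind (C : squot -> Prop) : (forall v, dom v -> C (spi v)) -> forall q, C q.
Proof. by move=> H q; rewrite -(sreprK q); exact: H. Qed.

Definition squot_add q q' := spi (srepr q + srepr q').
Definition squot_scale (a : R) q := spi (a *: srepr q).

Lemma squot_addE u v : dom u -> dom v -> squot_add (spi u) (spi v) = spi (u + v).
Proof.
move=> du dv; apply: spi_eq; try exact: sn_domD.
have d1 : dom (srepr (spi u) - u) by exact: sn_domB.
have d2 : dom (srepr (spi v) - v) by exact: sn_domB.
apply/le_anti; rewrite sn_norm_ge0 ?andbT; last by apply: sn_domB; exact: sn_domD.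
rewrite opprD addrACA (le_trans (sn_normD d1 d2))//.
by rewrite !srepr_spi// addr0.
Qed.

Lemma squot_scaleE a u : dom u -> squot_scale a (spi u) = spi (a *: u).
Proof.
move=> du; apply: spi_eq; try exact: sn_domZ.
by rewrite -scalerBr sn_normZ ?srepr_spi ?mulr0//; exact: sn_domB.
Qed.

Let addA : associative squot_add.
Proof.
elim/spi_ind => u du; elim/spi_ind => v dv; elim/spi_ind => w dw.
by rewrite !squot_addE ?addrA//; exact: sn_domD.
Qed.

Let addC : commutative squot_add.
Proof.
by elim/spi_ind => u du; elim/spi_ind => v dv; rewrite !squot_addE// addrC.
Qed.

Let add0 : left_id (spi 0) squot_add.
Proof.
by elim/spi_ind => u du; rewrite squot_addE ?add0r//; exact: sn_dom0.
Qed.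

Let addN : left_inverse (spi 0) (squot_scale (-1)) squot_add.
Proof.
elim/spi_ind => u du; rewrite squot_scaleE// squot_addE//; last exact: sn_domZ.
by rewrite scaleN1r addNr.
Qed.

HB.instance Definition _ := GRing.isZmodule.Build squot addA addC add0 addN.

Let scaleA (a b : R) q : squot_scale a (squot_scale b q) = squot_scale (a * b) q.
Proof.
elim/spi_ind: q => u du.
by rewrite !squot_scaleE ?scalerA//; exact: sn_domZ.
Qed.

Let scale1 : left_id 1 squot_scale.
Proof. by elim/spi_ind => u du; rewrite squot_scaleE// scale1r. Qed.

Let scaleDr : right_distributive squot_scale +%R.
Proof.
move=> a; elim/spi_ind => u du; elim/spi_ind => v dv.
rewrite /GRing.add /= !(squot_scaleE, squot_addE) ?scalerDr//;
  by [exact: sn_domZ|exact: sn_domD].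
Qed.

Let scaleDl q : {morph squot_scale^~ q : a b / a + b >-> a + b}.
Proof.
move=> a b; elim/spi_ind: q => u du.
rewrite [in RHS]/GRing.add /= !(squot_scaleE, squot_addE) ?scalerDl//;
  exact: sn_domZ.
Qed.

HB.instance Definition _ :=
  GRing.Zmodule_isLmodule.Build R squot scaleA scale1 scaleDr scaleDl.

Lemma spiD u v : dom u -> dom v -> spi (u + v) = spi u + spi v.
Proof. by move=> du dv; rewrite [RHS]squot_addE. Qed.

Lemma spiZ (a : R) u : dom u -> spi (a *: u) = a *: spi u.
Proof. by move=> du; rewrite [RHS]squot_scaleE. Qed.

Lemma spiN u : dom u -> spi (- u) = - spi u.
Proof. by move=> du; rewrite -scaleN1r spiZ// scaleN1r. Qed.

Lemma spiB u v : dom u -> dom v -> spi (u - v) = spi u - spi v.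
Proof. by move=> du dv; rewrite spiD ?spiN//; exact: sn_domN. Qed.

Definition squot_norm (q : squot) : R := nrm (srepr q).

Let squot_normE u : dom u -> squot_norm (spi u) = nrm u.
Proof.
move=> du; have H := srepr_spi du; have H' := srepr_spi du.
rewrite sn_distC// in H'.
have E a b : nrm (a - b) = 0 -> dom a -> dom b -> nrm a <= nrm b.
  move=> ab da db; have := sn_normD (sn_domB da db) db.
  by rewrite subrK ab add0r.
by apply/le_anti; rewrite !E.
Qed.

Let normD q q' : squot_norm (q + q') <= squot_norm q + squot_norm q'.
Proof.
elim/spi_ind: q => u du; elim/spi_ind: q' => v dv.
by rewrite -spiD// !squot_normE ?sn_normD//; exact: sn_domD.
Qed.

Let normZ (a : R) q : squot_norm (a *: q) = `|a| * squot_norm q.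
Proof.
elim/spi_ind: q => u du.
by rewrite -spiZ// !squot_normE ?sn_normZ//; exact: sn_domZ.
Qed.

Let norm0 q : squot_norm q = 0 -> q = 0.
Proof.
elim/spi_ind: q => u du; rewrite squot_normE// => u0.
by apply: spi_eq; rewrite ?subr0//; exact: sn_dom0.
Qed.

HB.instance Definition _ := Lmodule_isNormed.Build R squot normD normZ norm0.

Lemma norm_spi u : dom u -> `|spi u| = nrm u.
Proof. exact: squot_normE. Qed.

Let complete_squot (F : set_system squot) : ProperFilter F -> cauchy F -> cvg F.
Proof.
move=> PF /cauchyP FC.
have p0 n : 0 < 2^-1 ^+ n :> R by rewrite exprn_gt0// invr_gt0.
(* With these radii consecutive centres are at most [2^-n] apart, as [sn_complete] requires. *)
have ex n := FC (2^-1 ^+ n.+2) (p0 _).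
have [x Hx] := choice ex.
have xd n : `|x n.+1 - x n| <= 2^-1 ^+ n.
  have [z []] := filter_ex (filterI (Hx n) (Hx n.+1)).
  rewrite -ball_normE /ball_ /= => h1 h2.
  rewrite (le_trans (ler_distD z _ _))// (distrC z).
  move: h1 h2; rewrite !exprS; have := p0 n; lra.
have xd' n : nrm (srepr (x n.+1) - srepr (x n)) <= 2^-1 ^+ n.
  by rewrite -norm_spi ?spiB ?sreprK//; exact: sn_domB.
have [l dl Hl] := @sn_complete _ S (fun n => srepr (x n)) (fun n => srepr_dom _) xd'.
apply/cvg_ex; exists (spi l); apply/fcvgrPdist_lt => e e0.
have e20 : 0 < e / 2 by lra.
have [N HN] := Hl _ e20.
have [M HM] := @ex_nat_div_lt R 1 (e / 2) ler01 e20.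
pose n := maxn N M.
have xl : `|spi l - x n| <= e / 2.
  have -> : spi l - x n = spi (l - srepr (x n)) by rewrite spiB ?sreprK.
  rewrite norm_spi; last exact: sn_domB.
  by rewrite sn_distC//; apply: HN; rewrite leq_maxl.
have pn : 2^-1 ^+ n.+2 < e / 2.
  apply: (@le_lt_trans _ _ (1 / n.+1%:R)); last by apply: HM; rewrite leq_maxr.
  rewrite div1r exprVn lef_pV2 ?posrE ?exprn_gt0//.
  by rewrite -natrX ler_nat (leq_trans (ltn_expl n (isT : 1 < 2)%N))// leq_exp2l// -addn2 leq_addr.
apply: filterS (Hx n) => z; rewrite -ball_normE /ball_ /= => xz.
by rewrite (le_lt_trans (ler_distD (x n) _ _))//; lra.
Qed.

HB.instance Definition _ := Uniform_isComplete.Build squot complete_squot.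

End Quotient.
Arguments spi {R} S.

(** * Passing operators and semigroups to classes *)

Section Lift.
Variables (R : realType) (S S' : seminormed R).
Variable f : sn_type S -> sn_type S'.

Definition slift (q : squot S) : squot S' := spi S' (f (srepr q)).

Hypothesis f_dom : forall v, sn_dom v -> sn_dom (f v).
Hypothesis f_lin : forall (a : R) u v, sn_dom u -> sn_dom v ->
  sn_norm (f (a *: u + v) - (a *: f u + f v)) = 0.
Variable M : R.
Hypothesis f_bound : forall v, sn_dom v -> sn_norm (f v) <= M * sn_norm v.

(** By [f_bound] a null vector has a null image, so the class of the image does not depend on the
    representative. *)
Lemma slift_spi v : sn_dom v -> slift (spi S v) = spi S' (f v).
Proof.
move=> dv; have dr := srepr_dom (spi S v).
have dd := sn_domB dr dv.
have := f_lin 1 dd dv; rewrite !scale1r subrK => H.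
have fv0 : sn_norm (f (srepr (spi S v) - v)) = 0.
  apply/le_anti; rewrite sn_norm_ge0 ?andbT; last exact: f_dom.
  by rewrite (le_trans (f_bound dd))// srepr_spi// mulr0.
have ds : sn_dom (f (srepr (spi S v) - v) + f v) by apply: sn_domD; exact: f_dom.
rewrite /slift (spi_eq (f_dom dr) ds H) spiD; try exact: f_dom.
suff -> : spi S' (f (srepr (spi S v) - v)) = 0 by rewrite add0r.
by apply: spi_eq; rewrite ?subr0//; [exact: f_dom|exact: sn_dom0].
Qed.

Lemma slift_linear : linear slift.
Proof.
move=> a; elim/spi_ind => u du; elim/spi_ind => v dv.
rewrite -spiZ// -spiD//; last exact: sn_domZ.
rewrite !slift_spi//; last exact: sn_domP.
rewrite -spiZ; last exact: f_dom.
rewrite -spiD; [|by apply: sn_domZ; exact: f_dom|exact: f_dom].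
apply: spi_eq; [by apply: f_dom; exact: sn_domP| |exact: f_lin].
by apply: sn_domP; exact: f_dom.
Qed.

Lemma slift_bound q : `|slift q| <= M * `|q|.
Proof.
by elim/spi_ind: q => v dv; rewrite slift_spi// !norm_spi ?f_bound//; exact: f_dom.
Qed.

End Lift.

Section LiftSemigroup.
Variables (R : realType) (S : seminormed R) (U : R -> sn_type S -> sn_type S).
Hypothesis hU : C0_semigroup (@sn_dom R S) (@sn_norm R S) U.

Lemma C0_dom (t : R) v : 0 <= t -> sn_dom v -> sn_dom (U t v).
Proof. by move=> t0 dv; have [/(_ _ t0)[H _] _] := hU; exact: H. Qed.

Lemma C0_lift (t : R) v : 0 <= t -> sn_dom v ->
  slift (U t) (spi S v) = spi S (U t v).
Proof.
move=> t0 dv; have [/(_ _ t0)[H1 [H2 [M H3]]] _] := hU.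
exact: (slift_spi H1 H2 H3).
Qed.

Lemma csemigroup_lift : csemigroup (fun t => slift (U t)).
Proof.
have [H [H0 [HD HC]]] := hU; split.
- by move=> t /H[H1 [H2 [M H3]]]; exact: (slift_linear H1 H2 H3).
- by move=> t /H[H1 [H2 [M H3]]]; exists M; exact: (slift_bound H1 H2 H3).
- elim/spi_ind => v dv; rewrite C0_lift//; apply: spi_eq => //; last exact: H0.
  exact: C0_dom.
- move=> t s; elim/spi_ind => v dv t0 s0; have ts0 : 0 <= t + s by rewrite addr_ge0.
  have ds := C0_dom s0 dv; rewrite !C0_lift//; apply: spi_eq; [exact: C0_dom| |exact: HD].
  exact: C0_dom.
- elim/spi_ind => v dv e e0; have [d [d0 Hd]] := HC _ dv _ e0.
  exists d => // h h0 hd; have dU := C0_dom (ltW h0) dv.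
  rewrite C0_lift ?(ltW h0)// -spiB// norm_spi ?(ltW (Hd _ h0 hd))//.
  exact: sn_domB.
Qed.

Lemma gen_lift v w : sn_dom v -> sn_dom w ->
  tends0r (@sn_norm R S) (fun h => h^-1 *: (U h v - v)) w <->
  gen (fun t => slift (U t)) (spi S v) (spi S w).
Proof.
move=> dv dw.
have E (h : R) : 0 < h -> `|slift (U h) (spi S v) - spi S v - h *: spi S w| =
    h * sn_norm (h^-1 *: (U h v - v) - w).
  move=> h0; have dU := C0_dom (ltW h0) dv.
  have d1 : sn_dom (h^-1 *: (U h v - v) - w).
    by apply: sn_domB => //; apply: sn_domZ; exact: sn_domB.
  rewrite C0_lift ?(ltW h0)// -spiB// -spiZ// -spiB; [|exact: sn_domB|exact: sn_domZ].
  rewrite norm_spi; last by apply: sn_domB; [exact: sn_domB|exact: sn_domZ].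
  rewrite -[X in X * _](gtr0_norm h0) -sn_normZ// scalerBr scalerA divff ?gt_eqF//.
  by rewrite scale1r.
split=> H e e0.
  have [d [d0 Hd]] := H _ e0; exists d => // h h0 hd.
  by rewrite E// mulrC ler_pM2r// ltW// Hd.
have e20 : 0 < e / 2 by lra.
have [d d0 Hd] := H _ e20; exists d; split => // h h0 hd.
have := Hd _ h0 hd; rewrite E// mulrC ler_pM2r// => /le_lt_trans; apply; lra.
Qed.

End LiftSemigroup.

(** * The Bochner space L^1([-1,0]) *)

Section LowerIntegral.
Import HBNNSimple.

(* The library integral of a nonnegative function is a lower integral, so it is
   monotone without any measurability assumption. *)
Lemma ae_le_lower_integral (d : measure_display) (T : measurableType d) (R : realType)
    (mu : {measure set T -> \bar R}) (D : set T) (f g : T -> \bar R) :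
  (forall x, D x -> (0 <= f x)%E) -> (forall x, D x -> (0 <= g x)%E) ->
  {ae mu, forall x, D x -> (f x <= g x)%E} ->
  (\int[mu]_(x in D) f x <= \int[mu]_(x in D) g x)%E.
Proof.
move=> f0 g0 [N [mN N0 fgN]]; rewrite !ge0_integralE//=.
apply: ge_ereal_sup => _ [h /= hf <-].
have mNC : measurable (~` N) by exact: measurableC.
pose k := proj_nnsfun h mNC.
have kE x : k x = h x * \1_(~` N) x by [].
have -> : sintegral mu h = sintegral mu k.
  transitivity (\int[mu]_(x in setT) (h x)%:E)%E.
    by rewrite integral_nnsfun// patch_setT.
  transitivity (\int[mu]_(x in setT) (k x)%:E)%E; last first.
    by rewrite integral_nnsfun// patch_setT.
  apply: ge0_ae_eq_integral => //.
  - exact/measurable_EFinP.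
  - exact/measurable_EFinP.
  - by move=> x _; rewrite lee_fin.
  - by move=> x _; rewrite lee_fin.
  - exists N; split => // x /= hk; apply: contrapT => Nx; apply: hk => _.
    by congr EFin; rewrite [RHS](kE x) indicE mem_set// mulr1.
apply: ereal_sup_ubound; exists k => // x; rewrite kE indicE.
have gD0 : (0 <= (g \_ D) x)%E by rewrite /patch; case: ifPn => // /set_mem /g0.
have [Nx|Nx] := pselect (N x); first by rewrite memNset ?mulr0//= => /(_ Nx).
rewrite mem_set// mulr1 (le_trans (hf x))//.
rewrite /patch; case: ifPn => // /set_mem Dx.
by apply: contrapT => fg; apply: Nx; apply: fgN => /= /(_ Dx).
Qed.

End LowerIntegral.

(** * Simple functions and their integrals *)

Section SimpleFunctions.
Variables (R : realType) (Y : normedModType R).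
Local Notation mu := (@lebesgue_measure R).

Lemma measurable_Iint : measurable (@Iint R).
Proof. exact: measurable_itv. Qed.

Lemma mu_Iint : mu (@Iint R) = 1%E.
Proof.
rewrite /Iint lebesgue_measure_itv/= lte_fin ltrN10.
by rewrite -EFinB opprK add0r.
Qed.

Definition nint (D : set R) (f : R -> Y) : \bar R :=
  (\int[mu]_(t in D) (`|f t|)%:E)%E.

Definition sr_add (s s' : srep Y) : srep Y :=
  @SRep R Y (sr_n s + sr_n s')
    (fun i => match fintype.split i with inl j => sr_A j | inr j => sr_A j end)
    (fun i => match fintype.split i with inl j => sr_x j | inr j => sr_x j end)
    (fun i => match fintype.split i as v return
       measurable (match v with inl j => sr_A j | inr j => sr_A j end) with
     | inl j => sr_meas j | inr j => sr_meas j end).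

Definition sr_cst (c : Y) : srep Y :=
  @SRep R Y 1 (fun=> setT) (fun=> c) (fun=> measurableT).

Lemma sr_evalD s s' : sr_eval (sr_add s s') = sr_eval s + sr_eval s'.
Proof.
apply/funext => t; rewrite /sr_eval big_split_ord/=; congr (_ + _);
  apply: eq_bigr => i _ /=.
  by rewrite -[lshift _ _]/(unsplit (inl _)) unsplitK.
by rewrite -[rshift _ _]/(unsplit (inr _)) unsplitK.
Qed.

Lemma sr_intD s s' D : sr_int (sr_add s s') D = sr_int s D + sr_int s' D.
Proof.
rewrite /sr_int big_split_ord/=; congr (_ + _); apply: eq_bigr => i _ /=.
  by rewrite -[lshift _ _]/(unsplit (inl _)) unsplitK.
by rewrite -[rshift _ _]/(unsplit (inr _)) unsplitK.
Qed.

Lemma sr_eval_cst c : sr_eval (sr_cst c) = cst c.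
Proof.
by apply/funext => t; rewrite /sr_eval big_ord1 /= indicE in_setT scale1r.
Qed.

Lemma sr_int_cst c D : sr_int (sr_cst c) D = fine (mu D) *: c.
Proof. by rewrite /sr_int big_ord1 /= setTI. Qed.

Section Atoms.
Variable s : srep Y.
Local Notation n := (sr_n s).

(** The sets [sr_A] may overlap. Classifying points by the indices of the sets containing them
    produces a finite disjoint partition on whose pieces the simple function is constant. *)
Definition sr_sig (t : R) : {set 'I_n} := [set i | t \in @sr_A R Y s i].

Definition sr_atom (B : {set 'I_n}) : set R := [set t | sr_sig t = B].

Lemma measurable_atom B : measurable (sr_atom B).
Proof.
have -> : sr_atom B = \bigcap_(i in [set: 'I_n])
    (if i \in B then @sr_A R Y s i else ~` @sr_A R Y s i).
  apply/seteqP; split => t /=.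
    rewrite /sr_atom /= => <- i _; rewrite /sr_sig finset.inE.
    by case: ifPn; [move/set_mem|move/negP; rewrite inE].
  move=> H; apply/setP => i; rewrite /sr_sig finset.inE.
  have := H i Logic.I; case: ifPn => iB.
    by move/mem_set.
  by move=> Ai; apply/negbTE/negP => /set_mem.
apply: fin_bigcap_measurable => //= i _.
by case: ifPn => _; [|apply: measurableC]; exact: sr_meas.
Qed.

Lemma sr_sig_expand (g : {set 'I_n} -> R) t :
  g (sr_sig t) = \sum_(B : {set 'I_n}) g B * \1_(sr_atom B) t.
Proof.
rewrite (bigD1 (sr_sig t))//= indicE mem_set// mulr1 big1 ?addr0// => B BN.
by rewrite indicE memNset ?mulr0// /sr_atom /= => E; rewrite E eqxx in BN.
Qed.

Lemma measurable_sig (g : {set 'I_n} -> R) D : measurable_fun D (g \o sr_sig).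
Proof.
have -> : g \o sr_sig = fun t => \sum_(B : {set 'I_n}) g B * \1_(sr_atom B) t.
  by apply/funext => t /=; exact: sr_sig_expand.
apply: measurable_sum => B; apply: measurable_funM; first exact: measurable_cst.
by apply: measurable_indic; exact: measurable_atom.
Qed.

Lemma integral_sig (g : {set 'I_n} -> R) D : measurable D -> (forall B, 0 <= g B) ->
  (\int[mu]_(t in D) (g (sr_sig t))%:E =
   \sum_(B : {set 'I_n}) (g B)%:E * mu (sr_atom B `&` D))%E.
Proof.
move=> mD g0.
under eq_integral do rewrite sr_sig_expand -sumEFin.
rewrite ge0_integral_sum//; last 2 first.
- move=> B; apply/measurable_EFinP; apply: measurable_funM; first exact: measurable_cst.
  by apply: measurable_indic; exact: measurable_atom.
- by move=> B t _; rewrite lee_fin mulr_ge0.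
apply: eq_bigr => B _; have mB := measurable_atom B.
under eq_integral do rewrite EFinM.
rewrite ge0_integralZl_EFin//.
- by rewrite integral_indic.
- by apply/measurable_EFinP; apply: measurable_indic.
Qed.

Lemma sr_eval_sig t : sr_eval s t = \sum_(i in sr_sig t) sr_x i.
Proof.
rewrite /sr_eval [RHS]big_mkcond/=; apply: eq_bigr => i _.
by rewrite /sr_sig finset.inE indicE; case: ifP; rewrite ?scale1r ?scale0r.
Qed.

Lemma measurable_norm_sr D : measurable_fun D (fun t => `|sr_eval s t|).
Proof.
have -> : (fun t => `|sr_eval s t|) = (fun B => `|\sum_(i in B) sr_x i|) \o sr_sig.
  by apply/funext => t /=; rewrite sr_eval_sig.
exact: (@measurable_sig (fun B => `|\sum_(i in B) sr_x i|)).
Qed.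

(** The triangle inequality over overlapping sets would be too weak; over the disjoint atoms it
    yields exactly the integral of the norm. *)
Lemma norm_sr_int_le D : measurable D -> (mu D < +oo)%E ->
  ((`|sr_int s D|)%:E <= nint D (sr_eval s))%E.
Proof.
move=> mD Dfin.
have mfin (A : set R) : measurable A -> mu (A `&` D) \is a fin_num.
  move=> mA; rewrite ge0_fin_numE//; apply: le_lt_trans Dfin.
  by apply: le_measure; rewrite ?inE//; exact: measurableI.
pose m B := fine (mu (sr_atom B `&` D)).
have mE (g : {set 'I_n} -> R) :
    (\sum_B (g B)%:E * mu (sr_atom B `&` D) = (\sum_B g B * m B)%:E)%E.
  rewrite -sumEFin; apply: eq_bigr => B _; rewrite EFinM /m fineK//.
  by apply: mfin; exact: measurable_atom.
have mA i : fine (mu (@sr_A R Y s i `&` D)) =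
    \sum_(B : {set 'I_n}) (if i \in B then 1 else 0) * m B.
  have Am := @sr_meas R Y s i.
  have := @integral_sig (fun B => if i \in B then 1 else 0) D mD.
  have -> : (\int[mu]_(t in D) (if i \in sr_sig t then 1 else 0)%:E =
     mu (@sr_A R Y s i `&` D))%E.
    rewrite -integral_indic//; apply: eq_integral => t _; congr EFin.
    by rewrite /sr_sig finset.inE indicE; case: ifP.
  move=> ->; last by move=> B; case: ifP.
  by rewrite mE.
rewrite /nint; under eq_integral do rewrite sr_eval_sig.
rewrite (@integral_sig (fun B => `|\sum_(i in B) sr_x i|))//.
rewrite mE lee_fin.
have -> : sr_int s D = \sum_(B : {set 'I_n}) m B *: (\sum_(i in B) sr_x i).
  rewrite /sr_int; under eq_bigr do rewrite mA scaler_suml.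
  rewrite exchange_big/=; apply: eq_bigr => B _.
  rewrite scaler_sumr [RHS]big_mkcond/=; apply: eq_bigr => i _.
  by case: ifP; rewrite ?mul1r// mul0r scale0r.
rewrite (le_trans (ler_norm_sum _ _ _))//; apply: ler_sum => B _.
by rewrite normrZ mulrC ger0_norm// fine_ge0.
Qed.

End Atoms.

End SimpleFunctions.

Lemma ecvg0P (R : realType) (u : nat -> \bar R) : (forall k, (0 <= u k)%E) ->
  (u @ \oo --> 0%E) <->
  forall e : R, 0 < e -> exists N, forall k, (N <= k)%N -> (u k <= e%:E)%E.
Proof.
move=> u0; split.
  move/fine_cvgP => [[N1 _ fin] /cvgrPdist_le H] e e0.
  have [N2 _ HN] := H _ e0; exists (maxn N1 N2) => k; rewrite geq_max => /andP[k1 k2].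
  have := HN k k2; rewrite /= sub0r normrN ger0_norm ?fine_ge0// => Hk.
  by rewrite -(fineK (fin _ k1)) lee_fin.
move=> H; apply/fine_cvgP; split.
  have [N HN] := H 1 ltr01; exists N => // k Nk /=.
  by rewrite ge0_fin_numE// (le_lt_trans (HN _ Nk))// ltry.
apply/cvgrPdist_le => e e0; have [N HN] := H _ e0; exists N => // k Nk /=.
rewrite sub0r normrN ger0_norm ?fine_ge0//.
have fin : u k \is a fin_num by rewrite ge0_fin_numE// (le_lt_trans (HN _ Nk))// ltry.
by rewrite -lee_fin fineK// HN.
Qed.

Lemma aeS (R : realType) (P Q : R -> Prop) : (forall t, P t -> Q t) ->
  {ae @lebesgue_measure R, forall t, P t} -> {ae @lebesgue_measure R, forall t, Q t}.
Proof.
by move=> PQ; apply: (@filterS _ _ (ae_filter_ringOfSetsType (@lebesgue_measure R))).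
Qed.

Lemma aeS2 (R : realType) (P P' Q : R -> Prop) : (forall t, P t -> P' t -> Q t) ->
  {ae @lebesgue_measure R, forall t, P t} -> {ae @lebesgue_measure R, forall t, P' t} ->
  {ae @lebesgue_measure R, forall t, Q t}.
Proof.
by move=> PQ; apply: (@filterS2 _ _ (ae_filter_ringOfSetsType (@lebesgue_measure R))).
Qed.

(** * Strongly measurable functions *)

Section BochnerMeasurable.
Variables (R : realType) (Y : normedModType R).
Local Notation mu := (@lebesgue_measure R).
Implicit Types f g : R -> Y.

Definition bmeas f : Prop := exists s : nat -> srep Y,
  {ae mu, forall t, Iint t -> (fun k => sr_eval (s k) t) @ \oo --> f t}.

Lemma bmeas_sr s : bmeas (sr_eval s).
Proof. by exists (fun=> s); apply: aeW => t _; exact: cvg_cst. Qed.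

Lemma bmeasD f g : bmeas f -> bmeas g -> bmeas (f + g).
Proof.
move=> [s Hs] [s' Hs']; exists (fun k => sr_add (s k) (s' k)).
apply: aeS2 Hs Hs' => t ft gt It.
rewrite (_ : (fun k => _) = fun k => sr_eval (s k) t + sr_eval (s' k) t).
  by apply: cvgD; [exact: ft|exact: gt].
by apply/funext => k; rewrite sr_evalD.
Qed.

Lemma bmeasN f : bmeas f -> bmeas (- f).
Proof.
move=> [s Hs]; exists (fun k => @SRep R Y (sr_n (s k)) (@sr_A R Y (s k))
  (fun i => - sr_x i) (@sr_meas R Y (s k))).
apply: aeS Hs => t Ht It.
rewrite (_ : (fun k => _) = - (fun k => sr_eval (s k) t)).
  by apply: cvgN; exact: Ht.
apply/funext => j; rewrite /sr_eval fctE -sumrN.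
by apply: eq_bigr => i _; rewrite scalerN.
Qed.

Lemma bmeasB f g : bmeas f -> bmeas g -> bmeas (f - g).
Proof. by move=> bf bg; apply: bmeasD => //; exact: bmeasN. Qed.

(** [|f|] is a limit of measurable functions only almost everywhere. Cutting it off on the
    exceptional set gives a measurable [phi], to which additivity of the integral applies. *)
Lemma bmeas_norm f : bmeas f -> exists phi : R -> R,
  [/\ measurable_fun setT phi, forall t, 0 <= phi t &
      {ae mu, forall t, Iint t -> `|f t| = phi t}].
Proof.
move=> [s [N [mN N0 HN]]].
have mD : measurable (@Iint R `\` N) by apply: measurableD => //; exact: measurable_Iint.
exists (fun t => `|f t| * \1_(@Iint R `\` N) t); split.
- apply: (measurable_fun_cvg (h := fun k t => `|sr_eval (s k) t| * \1_(@Iint R `\` N) t)).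
    move=> k; apply: measurable_funM; first exact: measurable_norm_sr.
    exact: measurable_indic.
  move=> t _; rewrite indicE.
  have [It|It] := boolP (t \in @Iint R `\` N); last first.
    under eq_fun do rewrite mulr0.
    by rewrite mulr0; exact: cvg_cst.
  under eq_fun do rewrite mulr1.
  rewrite mulr1; apply: cvg_norm; move/set_mem : It => [It Nt].
  apply: contrapT => Hn; apply: Nt; apply: HN => /= H; apply: Hn.
  exact: H.
- by move=> t; rewrite mulr_ge0.
- exists N; split => // t /= Hn; apply: contrapT => Nt; apply: Hn => It.
  by rewrite indicE mem_set ?mulr1.
Qed.

Section Domain.
Variable D : set R.
Hypotheses (mD : measurable D) (DI : D `<=` @Iint R).

(** [|f|] itself need not be measurable; monotonicity of the lower integral, used in both
    directions, transfers its integral to [phi]. *)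
Lemma nint_phi f (phi : R -> R) : (forall t, 0 <= phi t) ->
  {ae mu, forall t, Iint t -> `|f t| = phi t} ->
  nint D f = (\int[mu]_(t in D) (phi t)%:E)%E.
Proof.
move=> phi0 H; apply/eqP; rewrite eq_le /nint; apply/andP; split.
  apply: ae_le_lower_integral => //; try by move=> t _; rewrite lee_fin.
  by apply: aeS H => t Ht /DI It; rewrite Ht.
apply: ae_le_lower_integral => //; try by move=> t _; rewrite lee_fin.
by apply: aeS H => t Ht /DI It; rewrite Ht.
Qed.

Lemma nint_ge0 f : (0 <= nint D f)%E.
Proof. by apply: integral_ge0 => t _; rewrite lee_fin. Qed.

Lemma nintD f g : bmeas f -> bmeas g -> (nint D (f + g)%R <= nint D f + nint D g)%E.
Proof.
move=> /bmeas_norm[p [mp p0 Hp]] /bmeas_norm[q [mq q0 Hq]].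
rewrite (nint_phi p0 Hp) (nint_phi q0 Hq) -ge0_integralD//; first last.
- by apply/measurable_EFinP; exact: measurable_funTS.
- by move=> t _; rewrite lee_fin.
- by apply/measurable_EFinP; exact: measurable_funTS.
- by move=> t _; rewrite lee_fin.
apply: ae_le_lower_integral.
- by move=> t _; rewrite lee_fin.
- by move=> t _; rewrite -EFinD lee_fin addr_ge0.
- apply: aeS2 Hp Hq => t Ht Ht' /DI It; rewrite -EFinD lee_fin -Ht// -Ht'//.
  exact: ler_normD.
Qed.

Lemma nint_bound f (c : R) : {ae mu, forall t, D t -> `|f t| <= c} ->
  0 <= c -> (nint D f <= c%:E * mu D)%E.
Proof.
move=> fc c0; rewrite -integral_cst//; apply: ae_le_lower_integral.
- by move=> t _; rewrite lee_fin.
- by move=> t _; rewrite lee_fin.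
- by apply: aeS fc => t Ht Dt; rewrite lee_fin Ht.
Qed.

End Domain.

Lemma nint_setU (D D' : set R) f : measurable D -> measurable D' ->
  D `<=` @Iint R -> D' `<=` @Iint R -> [disjoint D & D'] -> bmeas f ->
  nint (D `|` D') f = (nint D f + nint D' f)%E.
Proof.
move=> mD mD' DI D'I dd /bmeas_norm[p [mp p0 Hp]].
rewrite !(nint_phi _ p0 Hp)//; last by move=> t [/DI|/D'I].
rewrite ge0_integral_setU//; first by apply/measurable_EFinP; exact: measurable_funTS.
by move=> t _; rewrite lee_fin.
Qed.

Lemma nint_subset (D D' : set R) f : measurable D -> measurable D' ->
  D `<=` D' -> D' `<=` @Iint R -> bmeas f -> (nint D f <= nint D' f)%E.
Proof.
move=> mD mD' DD' D'I /bmeas_norm[p [mp p0 Hp]].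
rewrite !(nint_phi _ p0 Hp)//; last exact: subset_trans D'I.
apply: ge0_subset_integral => //; first by apply/measurable_EFinP; exact: measurable_funTS.
by move=> t _; rewrite lee_fin.
Qed.

Lemma mu_sub_fin (D : set R) : measurable D -> D `<=` @Iint R -> (mu D < +oo)%E.
Proof.
move=> mD DI; apply: (@le_lt_trans _ _ (mu (@Iint R))); last by rewrite mu_Iint ltry.
by apply: le_measure; rewrite ?inE//; exact: measurable_Iint.
Qed.

Lemma sr_eval_bound (s : srep Y) t : `|sr_eval s t| <= \sum_(i < sr_n s) `|sr_x i|.
Proof.
rewrite (le_trans (ler_norm_sum _ _ _))//; apply: ler_sum => i _.
by rewrite normrZ indicE; case: (_ \in _); rewrite ?normr1 ?mul1r ?normr0 ?mul0r.
Qed.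

Lemma bmeas_is_L1 f : is_L1 f -> bmeas f.
Proof. by move=> [s [Hs _]]; exists s. Qed.

Lemma L1dist_ge0 f g : (0 <= L1dist f g)%E.
Proof. by apply: integral_ge0 => t _; rewrite lee_fin. Qed.

Lemma L1distE f g : L1dist f g = nint (@Iint R) (f - g).
Proof. by []. Qed.

End BochnerMeasurable.

(** * Bounded operators acting pointwise *)

Section BoundedMaps.
Variables (R : realType) (Y Z : normedModType R) (P : Y -> Z) (K : R).
Hypotheses (lP : linear P) (bP : forall x, `|P x| <= K * `|x|).
Local Notation mu := (@lebesgue_measure R).

Definition sr_map (s : srep Y) : srep Z :=
  @SRep R Z (sr_n s) (@sr_A R Y s) (fun i => P (sr_x i)) (@sr_meas R Y s).

Let pP : {linear Y -> Z} := HB.pack P (GRing.isLinear.Build _ _ _ _ _ lP).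

Lemma sr_eval_map s : sr_eval (sr_map s) = P \o sr_eval s.
Proof.
apply/funext => t /=; rewrite /sr_eval; have := linear_sum pP => /= ->.
by apply: eq_bigr => i _; rewrite (linfZ lP).
Qed.

Lemma sr_int_map s D : sr_int (sr_map s) D = P (sr_int s D).
Proof.
rewrite /sr_int; have := linear_sum pP => /= ->.
by apply: eq_bigr => i _; rewrite (linfZ lP).
Qed.

Lemma bounded_cvg (u : nat -> Y) l : u @ \oo --> l -> (P \o u) @ \oo --> P l.
Proof.
move=> /cvgrPdist_le H; apply/cvgrPdist_le => e e0.
have K1 : 0 < `|K| + 1 by have := normr_ge0 K; lra.
have [N _ HN] := H _ (divr_gt0 e0 K1); exists N => // n Nn /=.
rewrite -(linfB lP) (le_trans (bP _))//.
apply: (@le_trans _ _ ((`|K| + 1) * `|l - u n|)).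
  by rewrite ler_wpM2r//; have := ler_norm K; lra.
by rewrite mulrC -ler_pdivlMr//; exact: HN.
Qed.

Lemma nint_map_le (D : set R) (f : R -> Y) : measurable D -> D `<=` @Iint R ->
  bmeas f -> 0 <= K ->
  (nint D (P \o f) <= K%:E * nint D f)%E.
Proof.
move=> mD DI /bmeas_norm[p [mp p0 Hp]] K0.
rewrite (nint_phi DI p0 Hp) -ge0_integralZl_EFin//; first last.
- by apply/measurable_EFinP; exact: measurable_funTS.
- by move=> t _; rewrite lee_fin.
apply: ae_le_lower_integral.
- by move=> t _; rewrite lee_fin.
- by move=> t _; rewrite -EFinM lee_fin mulr_ge0.
- by apply: aeS Hp => t Ht /DI It; rewrite -EFinM lee_fin -Ht//; exact: bP.
Qed.

Lemma approx_seq_map (s : nat -> srep Y) f : 0 <= K ->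
  approx_seq s f -> approx_seq (fun k => sr_map (s k)) (P \o f).
Proof.
move=> K0 [Hs Hd]; split.
  apply: aeS Hs => t Ht It.
  rewrite (_ : (fun k => _) = P \o (fun k => sr_eval (s k) t)).
    by apply: bounded_cvg; exact: Ht.
  by apply/funext => k; rewrite sr_eval_map.
have fm : bmeas f by exists s.
move: Hd => /(ecvg0P (fun k => L1dist_ge0 _ _)) Hd.
apply/ecvg0P => [k|e e0]; first exact: L1dist_ge0.
have K1 : 0 < K + 1 by lra.
have [N HN] := Hd _ (divr_gt0 e0 K1); exists N => k Nk; rewrite L1distE.
have -> : sr_eval (sr_map (s k)) - (P \o f) = P \o (sr_eval (s k) - f).
  by apply/funext => t; rewrite sr_eval_map /= !fctE (linfB lP).
have bm : bmeas (sr_eval (s k) - f) by apply: bmeasB => //; exact: bmeas_sr.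
rewrite (le_trans (nint_map_le (@measurable_Iint R) _ bm K0))//.
apply: (@le_trans _ _ (K%:E * (e / (K + 1))%:E)%E).
  by apply: lee_pmul => //; [exact: nint_ge0|rewrite -L1distE; exact: HN].
by rewrite -EFinM lee_fin mulrCA ler_piMr ?(ltW e0)// ler_pdivrMr//; lra.
Qed.

End BoundedMaps.

(** * Integrable functions and integrals of norms over subsets *)

Section L1Space.
Variables (R : realType) (Y : normedModType R).
Local Notation mu := (@lebesgue_measure R).
Local Notation I := (@Iint R).
Implicit Types f g : R -> Y.

Lemma linear_scale (a : R) : linear (fun x : Y => a *: x).
Proof. by move=> b x y /=; module R. Qed.

Lemma norm_scale_le (a : R) (x : Y) : `|a *: x| <= `|a| * `|x|.
Proof. by rewrite normrZ. Qed.

Lemma is_L1Z (a : R) f : is_L1 f -> is_L1 (a *: f).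
Proof.
move=> [s Hs]; exists (fun k => sr_map (fun x => a *: x) (s k)).
exact: (approx_seq_map (@linear_scale a) (@norm_scale_le a) (normr_ge0 a) Hs).
Qed.

Lemma is_L1D f g : is_L1 f -> is_L1 g -> is_L1 (f + g).
Proof.
move=> [s [Hs Hd]] [s' [Hs' Hd']]; exists (fun k => sr_add (s k) (s' k)); split.
  apply: aeS2 Hs Hs' => t ft gt It.
  rewrite (_ : (fun k => _) = fun k => sr_eval (s k) t + sr_eval (s' k) t).
    by apply: cvgD; [exact: ft|exact: gt].
  by apply/funext => k; rewrite sr_evalD.
have fm : bmeas f by exists s.
have gm : bmeas g by exists s'.
move: Hd Hd' => /(ecvg0P (fun k => L1dist_ge0 _ _)) Hd /(ecvg0P (fun k => L1dist_ge0 _ _)) Hd'.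
apply/ecvg0P => [k|e e0]; first exact: L1dist_ge0.
have e20 : 0 < e / 2 by lra.
have [N HN] := Hd _ e20; have [N' HN'] := Hd' _ e20.
exists (maxn N N') => k; rewrite geq_max => /andP[Nk N'k].
rewrite L1distE sr_evalD opprD addrACA.
have -> : e = e / 2 + e / 2 by lra.
apply: (@le_trans _ _ (nint I (sr_eval (s k) - f)%R + nint I (sr_eval (s' k) - g)%R)%E).
  by apply: nintD => //; [exact: measurable_Iint|exact: bmeasB (bmeas_sr _) _..].
by rewrite EFinD; apply: leeD; rewrite -L1distE; [exact: HN|exact: HN'].
Qed.

Lemma is_L1N f : is_L1 f -> is_L1 (- f).
Proof. by rewrite -scaleN1r; exact: is_L1Z. Qed.

Lemma is_L1B f g : is_L1 f -> is_L1 g -> is_L1 (f - g).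
Proof. by move=> Lf Lg; apply: is_L1D => //; exact: is_L1N. Qed.

Lemma is_L1_sr s : is_L1 (sr_eval s : R -> Y).
Proof.
exists (fun=> s); split; first by apply: aeW => t _; exact: cvg_cst.
rewrite (_ : (fun k => _) = cst 0%E); first exact: cvg_cst.
apply/funext => k; rewrite L1distE subrr; apply: integral0_eq => t _.
by rewrite normr0.
Qed.

Lemma is_L1_cst (c : Y) : is_L1 (cst c : R -> Y).
Proof. by rewrite -sr_eval_cst; exact: is_L1_sr. Qed.

Lemma is_L1_approx f (e : R) : is_L1 f -> 0 < e -> exists s : srep Y,
  (nint I (sr_eval s - f)%R <= e%:E)%E.
Proof.
move=> [s [_ /(ecvg0P (fun k => L1dist_ge0 _ _)) Hd]] /Hd[N HN].
by exists (s N); rewrite -L1distE; exact: HN.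
Qed.

Lemma is_L1_fin f (D : set R) : measurable D -> D `<=` I -> is_L1 f ->
  nint D f \is a fin_num.
Proof.
move=> mD DI Lf; have bf := bmeas_is_L1 Lf.
have mI := @measurable_Iint R.
rewrite ge0_fin_numE ?nint_ge0//.
apply: (le_lt_trans (nint_subset mD mI DI (@subset_refl _ I) bf)).
have [s Hs] := is_L1_approx Lf ltr01.
have -> : f = sr_eval s + - (sr_eval s - f) by rewrite opprB addrC subrK.
have bs := bmeas_sr s.
apply: (le_lt_trans (nintD mI (@subset_refl _ I) bs (bmeasN (bmeasB bs bf)))).
apply: lte_add_pinfty.
  pose c := \sum_(i < sr_n s) `|@sr_x R Y s i|.
  have c0 : 0 <= c by exact: sumr_ge0.
  have sb : {ae mu, forall t, I t -> `|sr_eval s t| <= c}.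
    by apply: aeW => t _; exact: sr_eval_bound.
  apply: (le_lt_trans (nint_bound mI sb c0)).
  by rewrite mu_Iint mule1 ltry.
rewrite (_ : nint I _ = nint I (sr_eval s - f)).
  by rewrite (le_lt_trans Hs)// ltry.
by apply: eq_integral => t _; rewrite !fctE normrN.
Qed.

Definition rint (D : set R) f : R := fine (nint D f).

Lemma rint_ge0 D f : 0 <= rint D f.
Proof. by apply: fine_ge0; exact: nint_ge0. Qed.

Section Domain.
Variable D : set R.
Hypotheses (mD : measurable D) (DI : D `<=` I).

Lemma rintD f g : is_L1 f -> is_L1 g -> rint D (f + g) <= rint D f + rint D g.
Proof.
move=> Lf Lg; rewrite -lee_fin EFinD !fineK ?is_L1_fin//; last exact: is_L1D.
by apply: nintD => //; exact: bmeas_is_L1.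
Qed.

Lemma rintN f : rint D (- f) = rint D f.
Proof. by congr fine; apply: eq_integral => t _; rewrite !fctE normrN. Qed.

Lemma rintB f g : is_L1 f -> is_L1 g -> rint D (f - g) <= rint D f + rint D g.
Proof. by move=> Lf Lg; rewrite -(rintN g) rintD//; exact: is_L1N. Qed.

Lemma rint_distD g f h : is_L1 f -> is_L1 g -> is_L1 h ->
  rint D (f - h) <= rint D (f - g) + rint D (g - h).
Proof.
move=> Lf Lg Lh; have -> : f - h = (f - g) + (g - h) by rewrite addrA subrK.
by apply: rintD; exact: is_L1B.
Qed.

Lemma rint_distC f g : rint D (f - g) = rint D (g - f).
Proof. by rewrite -rintN opprB. Qed.

Lemma rint_bound f (c : R) : is_L1 f -> 0 <= c ->
  {ae mu, forall t, D t -> `|f t| <= c} ->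
  rint D f <= c * fine (mu D).
Proof.
move=> Lf c0 H; rewrite -lee_fin EFinM !fineK ?is_L1_fin//; first exact: nint_bound.
by rewrite ge0_fin_numE// mu_sub_fin.
Qed.

End Domain.

Lemma rint_setU (D D' : set R) f : measurable D -> measurable D' ->
  D `<=` I -> D' `<=` I -> [disjoint D & D'] -> is_L1 f ->
  rint (D `|` D') f = rint D f + rint D' f.
Proof.
move=> mD mD' DI D'I dd Lf; rewrite /rint nint_setU//; last exact: bmeas_is_L1.
by rewrite fineD ?is_L1_fin.
Qed.

Lemma rint_subset (D D' : set R) f : measurable D -> measurable D' ->
  D `<=` D' -> D' `<=` I -> is_L1 f -> rint D f <= rint D' f.
Proof.
move=> mD mD' DD' D'I Lf; have DI := subset_trans DD' D'I.
rewrite -lee_fin !fineK ?is_L1_fin//.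
by apply: nint_subset => //; exact: bmeas_is_L1.
Qed.

End L1Space.

Section L1Maps.
Variables (R : realType) (Y Z : normedModType R) (P : Y -> Z) (K : R).
Hypotheses (lP : linear P) (bP : forall x, `|P x| <= K * `|x|) (K0 : 0 <= K).

Lemma is_L1_map f : is_L1 f -> is_L1 (P \o f).
Proof.
move=> [s Hs]; exists (fun k => sr_map P (s k)).
exact: (approx_seq_map lP bP K0 Hs).
Qed.

Lemma rint_map (D : set R) f : measurable D -> D `<=` @Iint R -> is_L1 f ->
  rint D (P \o f) <= K * rint D f.
Proof.
move=> mD DI Lf; rewrite -lee_fin EFinM !fineK ?is_L1_fin//; last exact: is_L1_map.
by apply: nint_map_le => //; exact: bmeas_is_L1.
Qed.

Lemma bochner_int_map f D v : bochner_int f D v -> bochner_int (P \o f) D (P v).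
Proof.
move=> [s [Hs Hv]]; exists (fun k => sr_map P (s k)); split.
  exact: (approx_seq_map lP bP K0 Hs).
rewrite (_ : (fun k => _) = P \o (fun k => sr_int (s k) D)).
  exact: (bounded_cvg lP bP Hv).
by apply/funext => k; rewrite sr_int_map.
Qed.

(** Bounded operators pass through Bochner integrals. Hence [P_m] commutes exactly with the
    derivative, and only the first component of [A_m] has to be approximated. *)
Lemma W11_deriv_map eta g eta0 : W11_deriv eta g eta0 ->
  W11_deriv (P \o eta) (P \o g) (P eta0).
Proof.
move=> [Le [Lg [etac [He [Hint H0]]]]]; split; first exact: is_L1_map.
split; first exact: is_L1_map.
exists (P \o etac); split; last split; last by rewrite /= H0.
  by apply: aeS He => t Ht It /=; rewrite Ht.
by move=> s Is /=; rewrite -(linfB lP); apply: bochner_int_map; exact: Hint.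
Qed.

End L1Maps.

(** The reverse inequality is the operator bound for [a^-1] applied to [a *: f]. *)
Lemma L1normZ (R : realType) (Y : normedModType R) (a : R) (f : R -> Y) :
  is_L1 f -> L1norm (a *: f) = `|a| * L1norm f.
Proof.
have mI := @measurable_Iint R; have II := @subset_refl _ (@Iint R).
have le (b : R) (g : R -> Y) : is_L1 g -> L1norm (b *: g) <= `|b| * L1norm g.
  exact: (@rint_map R Y Y _ _ (@linear_scale R Y b) (@norm_scale_le R Y b)
    (normr_ge0 b) _ _ mI II).
move=> Lf; apply/le_anti; rewrite le//=.
have [->|a0] := eqVneq a 0; first by rewrite normr0 mul0r; exact: rint_ge0.
rewrite -ler_pdivlMl ?normr_gt0// -normfV.
have := le a^-1 _ (is_L1Z a Lf).
by rewrite scalerA mulVf// scale1r.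
Qed.

(** * Completeness of L1 *)

Section Completeness.
Variables (R : realType) (Y : completeNormedModType R).
Local Notation mu := (@lebesgue_measure R).
Local Notation I := (@Iint R).

Lemma nneseries_geometric_le (u : nat -> \bar R) (c : R) (k : nat) : 0 <= c ->
  (forall n, (0 <= u n)%E) -> (forall n, (u n <= (c * 2^-1 ^+ n)%:E)%E) ->
  (\sum_(k <= n <oo) u n <= (2 * c * 2^-1 ^+ k)%:E)%E.
Proof.
move=> c0 u0 uc; apply: lime_le; first by apply: is_cvg_nneseries => n _ _; exact: u0.
apply: nearW => n.
have [nk|kn] := leqP n k.
  by rewrite big_geq// lee_fin !mulr_ge0.
rewrite (le_trans (lee_sum _ (fun i _ => uc i)))// sumEFin lee_fin.
have -> : \sum_(k <= i < n) c * 2^-1 ^+ i = 2 * c * (2^-1 ^+ k - 2^-1 ^+ n).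
  elim: n kn => // n IH; rewrite ltnS leq_eqVlt => /orP[/eqP <-|kn].
    by rewrite big_nat1 exprS; lra.
  by rewrite big_nat_recr ?(ltnW kn)//= IH// exprS; lra.
by rewrite ler_wpM2l ?mulr_ge0// gerBl.
Qed.

(** The Riesz-Fischer argument: the sum of the norms of the increments has a finite integral, so it
    is finite almost everywhere, where absolute convergence in [Y] gives the limit. Its tails
    dominate the distance to that limit. *)
Lemma fast_simple_cvg (s : nat -> srep Y) (c : R) : 0 <= c ->
  (forall n, (nint I (sr_eval (s n.+1) - sr_eval (s n))%R <= (c * 2^-1 ^+ n)%:E)%E) ->
  exists f, approx_seq s f.
Proof.
move=> c0 Hs; have mI := @measurable_Iint R.
pose g n t : \bar R := (`|sr_eval (s n.+1) t - sr_eval (s n) t|)%:E.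
have g0 n t : (0 <= g n t)%E by rewrite lee_fin.
have mg n : measurable_fun I (g n).
  pose d := sr_add (s n.+1) (sr_map (fun x => (-1) *: x) (s n)).
  have dE : sr_eval d = sr_eval (s n.+1) - sr_eval (s n).
    rewrite sr_evalD (sr_eval_map (@linear_scale R Y (-1))); congr (_ + _).
    by apply/funext => t /=; rewrite scaleN1r.
  apply/measurable_EFinP; rewrite (_ : (fun t => _) = fun t => `|sr_eval d t|).
    exact: measurable_norm_sr.
  by apply/funext => t; rewrite dE.
have intG k : (\int[mu]_(t in I) (\sum_(k <= n <oo) g n t) <= (2 * c * 2^-1 ^+ k)%:E)%E.
  have -> : (\int[mu]_(t in I) (\sum_(k <= n <oo) g n t) =
      \sum_(k <= n <oo) \int[mu]_(t in I) g n t)%E.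
    under eq_integral do rewrite -nneseries_addn//.
    rewrite integral_nneseries//; last by move=> n; exact: mg.
    by rewrite -(@nneseries_addn _ (fun n => \int[mu]_(t in I) g n t)%E)// => i; exact: integral_ge0.
  apply: (@nneseries_geometric_le (fun n => \int[mu]_(t in I) g n t)%E c k c0).
    by move=> n; exact: integral_ge0.
  exact: Hs.
pose G t := (\sum_(0 <= n <oo) g n t)%E.
have mG : measurable_fun I G by apply: ge0_emeasurable_sum.
have G0 t : (0 <= G t)%E by exact: nneseries_ge0.
have Gfin : {ae mu, forall t, I t -> G t \is a fin_num}.
  apply: integrable_ae => //; apply/integrableP; split => //.
  under eq_integral do rewrite gee0_abs//.
  by rewrite (le_lt_trans (intG 0%N))// ltry.
have conv t : G t \is a fin_num -> cvgn (fun k => sr_eval (s k) t).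
  move=> Gt.
  have : cvgn (series (fun n => sr_eval (s n.+1) t - sr_eval (s n) t)).
    apply: normed_cvg.
    pose w := series (fun n => `|sr_eval (s n.+1) t - sr_eval (s n) t|).
    suff : cvgn w by [].
    apply: nondecreasing_is_cvgn.
      by apply/nondecreasing_seqP => n; rewrite /w seriesSr lerDl.
    exists (fine (G t)) => _ [n _ <-]; rewrite -lee_fin fineK//.
    by rewrite /series /= -sumEFin; apply: nneseries_lim_ge => i _ _; exact: g0.
  move=> cs; rewrite (_ : (fun k => _) = (fun n => sr_eval (s 0%N) t +
     series (fun n => sr_eval (s n.+1) t - sr_eval (s n) t) n)).
    by apply: is_cvgD => //; exact: is_cvg_cst.
  apply/funext => n; rewrite /series /= telescope_sumr//.
  by rewrite addrC subrK.
exists (fun t => limn (fun k => sr_eval (s k) t)); split.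
  by apply: aeS Gfin => t Gt It; exact: conv (Gt It).
apply/ecvg0P => [k|e e0]; first exact: L1dist_ge0.
have [N HN] := @ex_nat_div_lt R (2 * c) e ltac:(lra) e0.
exists N => k Nk; rewrite /L1dist.
apply: (@le_trans _ _ (2 * c * 2^-1 ^+ k)%:E); last first.
  rewrite lee_fin ltW//; apply: le_lt_trans (HN _ Nk).
  rewrite ler_wpM2l ?mulr_ge0// exprVn lef_pV2 ?posrE ?exprn_gt0//.
  by rewrite -natrX ler_nat ltn_expl.
apply: le_trans (intG k); apply: ae_le_lower_integral.
- by move=> t _; rewrite lee_fin.
- by move=> t _; exact: nneseries_ge0.
apply: aeS Gfin => t Gt It; have cv := conv _ (Gt It).
have part n : (k <= n)%N ->
    ((`|sr_eval (s k) t - sr_eval (s n) t|)%:E <= \sum_(k <= n <oo) g n t)%E.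
  move=> kn; apply: le_trans (nneseries_lim_ge n (fun i _ _ => g0 i t)).
  rewrite sumEFin lee_fin distrC -(telescope_sumr (fun i => sr_eval (s i) t) kn); exact: ler_norm_sum.
have [fin|] := boolP ((\sum_(k <= n <oo) g n t)%E \is a fin_num); last first.
  rewrite ge0_fin_numE; last exact: nneseries_ge0.
  by rewrite -leNgt leye_eq => /eqP ->; rewrite leey.
rewrite -(fineK fin) lee_fin; apply/ler_addgt0Pr => d d0.
move/cvgrPdist_le : cv => /(_ _ d0)[M _ HM].
have Mk : (M <= maxn M k)%N by rewrite leq_maxl.
have := HM _ Mk; have := part (maxn M k) (leq_maxr _ _).
rewrite -(fineK fin) lee_fin => h1 h2.
rewrite (le_trans (ler_distD (sr_eval (s (maxn M k)) t) _ _))// lerD//.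
by rewrite distrC.
Qed.

Lemma L1_complete (u : nat -> R -> Y) : (forall n, is_L1 (u n)) ->
  (forall n, L1norm (u n.+1 - u n) <= 2^-1 ^+ n) ->
  exists2 l, is_L1 l &
    forall e : R, 0 < e -> exists N, forall n, (N <= n)%N -> L1norm (u n - l) <= e.
Proof.
move=> Lu Hu; have mI := @measurable_Iint R; have II := @subset_refl _ I.
have p0 n : 0 < 2^-1 ^+ n :> R by rewrite exprn_gt0// invr_gt0.
have [s Hs] := choice (fun n => is_L1_approx (Lu n) (p0 n)).
have Ls n := @is_L1_sr R Y (s n).
have {}Hs n : rint I (sr_eval (s n) - u n) <= 2^-1 ^+ n.
  by rewrite -lee_fin fineK ?Hs// is_L1_fin//; exact: is_L1B.
have [l Hl] : exists l, approx_seq s l.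
  (* The two approximation errors and the increment of [u] add up to at most [5/2] times [2^-n]. *)
  apply: (@fast_simple_cvg s 3) => // n.
  have Lss : is_L1 (sr_eval (s n.+1) - sr_eval (s n)) by exact: is_L1B.
  rewrite -(fineK (is_L1_fin mI II Lss)) lee_fin.
  have h1 := rint_distD mI II (Ls n.+1) (Lu n.+1) (Ls n).
  have h2 := rint_distD mI II (Lu n.+1) (Lu n) (Ls n).
  have h3 := Hs n; have h4 := Hs n.+1; have h5 := Hu n.
  rewrite -/(rint I _) (rint_distC I (u n)) in h2 *.
  move: h4; rewrite exprS; have := p0 n; rewrite /L1norm -/(nint _ _) -/(rint _ _) in h5; lra.
have Ll : is_L1 l by exists s.
exists l => // e e0; have e20 : 0 < e / 2 by lra.
move: (Hl) => [_ /(ecvg0P (fun k => L1dist_ge0 _ _)) /(_ _ e20)[N HN]].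
have [M HM] := @ex_nat_div_lt R 1 (e / 2) ler01 e20.
exists (maxn N M) => n; rewrite geq_max => /andP[Nn Mn].
have h1 := rint_distD mI II (Lu n) (Ls n) Ll; rewrite (rint_distC I (u n) (sr_eval (s n))) in h1.
have h2 : rint I (sr_eval (s n) - l) <= e / 2.
  by rewrite -lee_fin fineK ?is_L1_fin//; [rewrite -L1distE HN|exact: is_L1B].
have h3 : 2^-1 ^+ n < e / 2.
  apply: le_lt_trans (HM _ Mn); rewrite div1r exprVn lef_pV2 ?posrE ?exprn_gt0//.
  by rewrite -natrX ler_nat ltn_expl.
have := Hs n; rewrite -[L1norm _]/(rint I _); lra.
Qed.

End Completeness.

(** * Absolutely continuous functions and the derivative operator *)

Section Dissipativity.
Variables (R : realType) (Y : normedModType R).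
Local Notation mu := (@lebesgue_measure R).
Local Notation I := (@Iint R).

Lemma cc_sub_Iint (a : R) : a <= 0 -> `[(-1), a] `<=` I.
Proof. by move=> a0 t; rewrite /Iint /= !in_itv/= => /andP[-> /le_trans ->]. Qed.

Lemma oc_sub_Iint (a b : R) : -1 <= a -> b <= 0 -> `]a, b] `<=` I.
Proof.
move=> a0 b0 t; rewrite /Iint /= !in_itv/= => /andP[h1 h2].
by rewrite (le_trans a0 (ltW h1)) (le_trans h2 b0).
Qed.

Lemma cc_split (a b : R) : -1 <= a -> a <= b ->
  `[(-1), b]%classic = `[(-1), a] `|` `]a, b].
Proof.
move=> a1 ab; apply/seteqP; split => t /=; rewrite !in_itv/=.
  by move=> /andP[h1 h2]; have [ta|ta] := leP t a; [left|right]; rewrite ?h1.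
move=> [/andP[h1 h2]|/andP[h1 h2]]; first by rewrite h1 (le_trans h2 ab).
by rewrite h2 (le_trans a1 (ltW h1)).
Qed.

Lemma cc_oc_disjoint (a b : R) : [disjoint `[(-1), a]%classic & `]a, b]%classic].
Proof.
apply/eqP/seteqP; split => t //=; rewrite !in_itv/=.
by move=> [/andP[_ ta] /andP[at_ _]]; have := le_lt_trans ta at_; rewrite ltxx.
Qed.

Lemma fine_mu_oc (a b : R) : a <= b -> fine (mu `]a, b]%classic) = b - a.
Proof.
move=> ab; rewrite lebesgue_measure_itv/= lte_fin; case: ifPn => [//|].
by rewrite -leNgt => ba; rewrite (@le_anti _ _ a b) ?ab// subrr.
Qed.

Lemma sr_int_setU (s : srep Y) D D' : measurable D -> measurable D' ->
  D `<=` I -> D' `<=` I -> [disjoint D & D'] ->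
  sr_int s (D `|` D') = sr_int s D + sr_int s D'.
Proof.
move=> mD mD' DI D'I dd; rewrite /sr_int -big_split/=; apply: eq_bigr => i _.
have mA := @sr_meas R Y s i.
have fin (B : set R) : measurable B -> B `<=` I -> mu (@sr_A R Y s i `&` B) \is a fin_num.
  move=> mB BI; rewrite ge0_fin_numE// mu_sub_fin//; first exact: measurableI.
  by move=> t [_ /BI].
rewrite -scalerDl -fineD ?fin// setIUr measureU//; try exact: measurableI.
by move/eqP : dd => dd; rewrite setIACA dd setI0.
Qed.

Definition sr_sub (s s' : srep Y) := sr_add s (sr_map (fun x => (-1) *: x) s').

Lemma sr_evalB s s' : sr_eval (sr_sub s s') = sr_eval s - sr_eval s'.
Proof.
rewrite sr_evalD (sr_eval_map (@linear_scale R Y (-1))); congr (_ + _).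
by apply/funext => t /=; rewrite scaleN1r.
Qed.

Lemma sr_intB s s' D : sr_int (sr_sub s s') D = sr_int s D - sr_int s' D.
Proof.
by rewrite sr_intD (sr_int_map (@linear_scale R Y (-1))) scaleN1r.
Qed.

Lemma norm_sr_int_rint (s : srep Y) D : measurable D -> D `<=` I ->
  `|sr_int s D| <= rint D (sr_eval s).
Proof.
move=> mD DI; rewrite -lee_fin fineK ?is_L1_fin//; last exact: is_L1_sr.
by apply: norm_sr_int_le => //; exact: mu_sub_fin.
Qed.

(** The left side is the norm of the integral of [c - g] over []a, b]]. The values [va] and [vb]
    come with their own approximating sequences, which are compared on [[-1, a]] through [g]. *)
Lemma bochner_increment (g : R -> Y) (a b : R) va vb (c : Y) :
  -1 <= a -> a <= b -> b <= 0 ->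
  bochner_int g `[(-1), a] va -> bochner_int g `[(-1), b] vb ->
  `|(b - a) *: c - (vb - va)| <= rint `]a, b] (cst c - g).
Proof.
move=> a1 ab b0 [s' [Hs' Hva]] [s [Hs Hvb]].
have Lg : is_L1 g by exists s.
have mI := @measurable_Iint R; have II := @subset_refl _ I.
have ma : measurable (`[(-1), a]%classic : set R) by exact: measurable_itv.
have mab : measurable (`]a, b]%classic : set R) by exact: measurable_itv.
have aI := cc_sub_Iint (le_trans ab b0); have abI := oc_sub_Iint a1 b0.
apply/ler_addgt0Pr => e e0; have e80 : 0 < e / 8 by lra.
move: (Hs) => [_ /(ecvg0P (fun k => L1dist_ge0 _ _)) /(_ _ e80)[N1 HN1]].
move: (Hs') => [_ /(ecvg0P (fun k => L1dist_ge0 _ _)) /(_ _ e80)[N2 HN2]].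
move/cvgrPdist_le : Hva => /(_ _ e80)[N3 _ HN3].
move/cvgrPdist_le : Hvb => /(_ _ e80)[N4 _ HN4].
pose k := maxn (maxn N1 N2) (maxn N3 N4).
have k1 : (N1 <= k)%N by rewrite /k !leq_max leqnn.
have k2 : (N2 <= k)%N by rewrite /k !leq_max leqnn orbT.
have k3 : (N3 <= k)%N by rewrite /k !leq_max leqnn !orbT.
have k4 : (N4 <= k)%N by rewrite /k !leq_max leqnn !orbT.
have {HN3} h3 := HN3 k k3; have {HN4} h4 := HN4 k k4.
have Ls := @is_L1_sr R Y (s k); have Ls' := @is_L1_sr R Y (s' k).
have Lc := @is_L1_cst R Y c.
have h1 : rint I (sr_eval (s k) - g) <= e / 8.
  by rewrite -lee_fin fineK ?is_L1_fin//; [rewrite -L1distE HN1|exact: is_L1B].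
have h2 : rint I (sr_eval (s' k) - g) <= e / 8.
  by rewrite -lee_fin fineK ?is_L1_fin//; [rewrite -L1distE HN2|exact: is_L1B].
have b1 : `|(b - a) *: c - sr_int (s k) `]a, b]| <= rint `]a, b] (cst c - g) + e / 8.
  have := norm_sr_int_rint (sr_sub (sr_cst c) (s k)) mab abI.
  rewrite sr_intB sr_int_cst fine_mu_oc// sr_evalB sr_eval_cst => /le_trans; apply.
  rewrite (le_trans (rint_distD mab abI Lc Lg Ls))// lerD2l rint_distC.
  by apply: le_trans h1; apply: rint_subset => //; exact: is_L1B.
have b2 : `|sr_int (s' k) `[(-1), a] - sr_int (s k) `[(-1), a]| <= e / 4.
  have := norm_sr_int_rint (sr_sub (s' k) (s k)) ma aI.
  rewrite sr_intB sr_evalB => /le_trans; apply.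
  rewrite (le_trans (rint_subset ma mI aI II _))//; first exact: is_L1B.
  rewrite (le_trans (rint_distD mI II Ls' Lg Ls))// (rint_distC _ g).
  lra.
have sE : sr_int (s k) `[(-1), b] = sr_int (s k) `[(-1), a] + sr_int (s k) `]a, b].
  by rewrite (cc_split a1 ab) sr_int_setU//; exact: cc_oc_disjoint.
rewrite /= sE in h4.
rewrite (_ : _ - _ = ((b - a) *: c - sr_int (s k) `]a, b]) +
  (sr_int (s' k) `[(-1), a] - sr_int (s k) `[(-1), a]) +
  (va - sr_int (s' k) `[(-1), a]) -
  (vb - (sr_int (s k) `[(-1), a] + sr_int (s k) `]a, b]))); last by module R.
rewrite (le_trans (ler_normB _ _))//.
rewrite (le_trans (lerD (ler_normD_le (ler_normD_le b1 b2) h3) h4))//; lra.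
Qed.

(* Multiplying by [h] the increments of [etac] and telescoping over a fine
   partition gives [h |etac(-1)| + int |eta| <= h |etac 0| + int |eta - h g| + o(1)]. *)
Lemma W11_dissipative (eta g : R -> Y) (eta0 : Y) (h : R) : 0 < h ->
  W11_deriv eta g eta0 -> L1norm eta <= L1norm (eta - h *: g) + h * `|eta0|.
Proof.
move=> h0 [Le [Lg [etac [Hae [Hint etac0]]]]].
have mI := @measurable_Iint R; have II := @subset_refl _ I.
have Lhg : is_L1 (h *: g) by exact: is_L1Z.
have inI (a : R) : -1 <= a -> a <= 0 -> I a by move=> a1 a0; rewrite /Iint /= in_itv/= a1.
have incr (a b : R) (c : Y) : -1 <= a -> a <= b -> b <= 0 ->
    `|(b - a) *: c - h *: (etac b - etac a)| <= rint `]a, b] (cst c - h *: g).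
  move=> a1 ab b0.
  have Ba := bochner_int_map (@linear_scale R Y h) (@norm_scale_le R Y h) (normr_ge0 h)
    (Hint a (inI _ a1 (le_trans ab b0))).
  have Bb := bochner_int_map (@linear_scale R Y h) (@norm_scale_le R Y h) (normr_ge0 h)
    (Hint b (inI _ (le_trans a1 ab) b0)).
  have := bochner_increment c a1 ab b0 Ba Bb.
  rewrite (_ : h *: (etac b - etac (-1)) - h *: (etac a - etac (-1)) =
    h *: (etac b - etac a)) //; by module R.
(* Uniform continuity of [etac] is [incr] with [c = 0]: up to a small error in L1, [h *: g] is a
   bounded simple function, whose integral over a short interval is small. *)
have unif (e : R) : 0 < e -> exists2 d : R, 0 < d & forall a b : R, -1 <= a -> a <= b ->
    b <= 0 -> b - a < d -> `|etac b - etac a| <= e.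
  move=> e0; have e20 : 0 < h * e / 2 by rewrite divr_gt0// mulr_gt0.
  have [s Hs] := is_L1_approx Lhg e20.
  have Ls := @is_L1_sr R Y s.
  pose C := \sum_(i < sr_n s) `|@sr_x R Y s i|.
  have C0 : 0 <= C by exact: sumr_ge0.
  have C1 : 0 < C + 1 by lra.
  exists (h * e / 2 / (C + 1)); first by rewrite divr_gt0.
  move=> a b a1 ab b0 bad.
  have mab : measurable (`]a, b]%classic : set R) by exact: measurable_itv.
  have abI := oc_sub_Iint a1 b0.
  have := incr a b 0 a1 ab b0; rewrite scaler0 !sub0r normrN normrZ gtr0_norm// rintN => H.
  rewrite -(ler_pM2l h0) (le_trans H)//.
  have -> : h *: g = sr_eval s - (sr_eval s - h *: g) by rewrite opprB addrC subrK.
  have Lsg : is_L1 (sr_eval s - h *: g) by exact: is_L1B.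
  rewrite (le_trans (rintB mab abI Ls Lsg))//.
  have h1 : rint `]a, b] (sr_eval s) <= C * (b - a).
    rewrite -fine_mu_oc//; apply: rint_bound => //.
    by apply: aeW => t _; exact: sr_eval_bound.
  have h2 : rint `]a, b] (sr_eval s - h *: g) <= h * e / 2.
    rewrite (le_trans (rint_subset mab mI abI II Lsg))//.
    by rewrite -lee_fin fineK ?is_L1_fin.
  move: bad; rewrite ltr_pdivlMr// mulrDr mulr1 => bad.
  have ba0 : 0 <= b - a by rewrite subr_ge0.
  lra.
apply/ler_addgt0Pr => e e0; have e20 : 0 < e / 2 by lra.
have [d d0 Hd] := unif _ e20.
have [N HN] := @ex_nat_div_lt R 1 d ler01 d0.
have := HN _ (leqnn N); rewrite div1r; set n := N.+1; set del := n%:R^-1 => deld.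
have n0 : 0 < n%:R :> R by rewrite ltr0n.
have del0 : 0 < del by rewrite invr_gt0.
have ndel : n%:R * del = 1 by rewrite divff// gt_eqF.
pose k := eta - h *: g; have Lk : is_L1 k by exact: is_L1B.
pose x j : R := -1 + j%:R * del.
have x1 j : -1 <= x j by rewrite /x lerDl mulr_ge0// ltW.
have x0 j : (j <= n)%N -> x j <= 0.
  move=> jn; have : j%:R * del <= n%:R * del by rewrite ler_pM2r// ler_nat.
  by rewrite ndel /x; lra.
have xS j : x j.+1 = x j + del by rewrite /x -natr1; ring.
(* On each piece [eta] is replaced twice by the constant [etac a], at the cost of [e / 2 * del] each
   time; hence the term [e * (j * del)]. *)
have claim j : (j <= n)%N -> h * `|etac (-1)| + rint `[(-1), (x j)] eta <=
    h * `|etac (x j)| + e * (j%:R * del) + rint `[(-1), (x j)] k.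
  elim: j => [_|j IH jn].
    have xE : x 0%N = -1 by rewrite /x mul0r addr0.
    rewrite xE !mul0r mulr0 addr0 lerD2l.
    apply: (@le_trans _ _ 0); last exact: rint_ge0.
    have mm : measurable (`[(-1), (-1)]%classic : set R) by exact: measurable_itv.
    rewrite (le_trans (@rint_bound R Y _ mm _ eta 0 Le _ _))// ?mul0r//.
      by apply: cc_sub_Iint; lra.
    exists `[(-1), (-1)]%classic; split => //.
      by rewrite lebesgue_measure_itv/= ltxx.
    by move=> t /= Hn; apply: contrapT => nt; apply: Hn => /nt.
  have {}IH := IH (ltnW jn).
  set a := x j in IH *; set b := x j.+1.
  have ab : a <= b by rewrite /b xS lerDl ltW.
  have a1 : -1 <= a by exact: x1.
  have b0 : b <= 0 by exact: x0.
  have ba : b - a = del by rewrite /b xS addrC addKr.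
  have ma : measurable (`[(-1), a]%classic : set R) by exact: measurable_itv.
  have mab : measurable (`]a, b]%classic : set R) by exact: measurable_itv.
  have aI := cc_sub_Iint (le_trans ab b0); have abI := oc_sub_Iint a1 b0.
  have dis := @cc_oc_disjoint a b.
  rewrite (cc_split a1 ab) !rint_setU// -(natr1 j).
  have near_a t : `]a, b]%classic t -> `|etac t - etac a| <= e / 2.
    rewrite /= in_itv/= => /andP[at_ tb]; apply: Hd => //; first exact: ltW.
      exact: le_trans b0.
    apply: le_lt_trans deld; rewrite -ba lerD2r//.
  have Lc := @is_L1_cst R Y (etac a).
  have muab := fine_mu_oc ab.
  have b1 : rint `]a, b] (cst (etac a) - eta) <= e / 2 * del.
    rewrite -ba -muab; apply: rint_bound => //; first exact: is_L1B.
      exact: ltW.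
    apply: aeS Hae => t Ht Dt; rewrite !fctE -Ht; last exact: abI.
    by rewrite distrC near_a.
  have b2 : rint `]a, b] eta <= (`|etac a| + e / 2) * del.
    rewrite -ba -muab; apply: rint_bound => //; first by rewrite addr_ge0// ltW.
    apply: aeS Hae => t Ht Dt; rewrite -Ht; last exact: abI.
    have -> : etac t = etac a + (etac t - etac a) by rewrite addrC subrK.
    by apply: ler_normD_le => //; exact: near_a.
  have b3 := incr a b (etac a) a1 ab b0.
  have b4 := rint_distD mab abI Lc Le Lhg.
  (* [(b - a) *: etac a - h *: (etac b - etac a)] is the discrete form of the integral of
     [eta - h eta'] over []a, b]]. *)
  have b5 : (del + h) * `|etac a| <= h * `|etac b| +
      `|(b - a) *: etac a - h *: (etac b - etac a)|.
    have dh0 : 0 <= del + h by rewrite addr_ge0// ltW.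
    rewrite -[X in X * `|etac a|]ger0_norm// -normrZ -[X in X * `|etac b|](gtr0_norm h0) -normrZ.
    rewrite (_ : (del + h) *: etac a = h *: etac b + ((b - a) *: etac a -
      h *: (etac b - etac a))); last by rewrite ba; module R.
    exact: ler_normD.
  rewrite -/k in b4; rewrite mulrDl mul1r mulrDr.
  lra.
have := claim _ (leqnn n); rewrite ndel mulr1.
have xn : x n = 0 by rewrite /x ndel addNr.
rewrite xn etac0 => H.
have he : 0 <= h * `|etac (-1)| by rewrite mulr_ge0// ltW.
rewrite -[L1norm eta]/(rint `[(-1), 0] eta) -[L1norm _]/(rint `[(-1), 0] k).
lra.
Qed.

End Dissipativity.

(** * The delay equation *)

(** The second half of [generates] provides some [w'] without relating it to [a]; uniqueness of the
    derivative identifies the classes. *)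
Lemma gen_generates (R : realType) (S : seminormed R) (U : R -> sn_type S -> sn_type S)
    (Gr : sn_type S -> sn_type S -> Prop) (y a : squot S) :
  C0_semigroup (@sn_dom R S) (@sn_norm R S) U ->
  generates (@sn_dom R S) (@sn_norm R S) Gr U ->
  gen (fun t => slift (U t)) y a ->
  exists v w, [/\ sn_dom v, sn_dom w, y = spi S v, a = spi S w & Gr v w].
Proof.
move=> hU [G1 G2]; elim/spi_ind: y => v dv; elim/spi_ind: a => w dw H.
have /(G2 _ _ dv dw)[w' Gw'] := (gen_lift hU dv dw).2 H.
have [_ [dw' Tw']] := G1 _ _ Gw'; exists v, w'; split => //.
exact: gen_unique H ((gen_lift hU dv dw').1 Tw').
Qed.

(** * The product space and its dissipative operators *)

Section ProductSpace.
Variables (R : realType) (Y : completeNormedModType R).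
Local Notation V := (Y * (R -> Y))%type.
Local Notation I := (@Iint R).

Let mI := @measurable_Iint R.
Let II := @subset_refl _ I.

Lemma L1norm0 : L1norm (0 : R -> Y) = 0.
Proof. by rewrite -(scale0r 0) L1normZ ?normr0 ?mul0r//; exact: (@is_L1_cst R Y 0). Qed.

Lemma L1norm_ge0 (f : R -> Y) : 0 <= L1norm f.
Proof. exact: rint_ge0. Qed.

Lemma Enorm_le (p : V) (c : R) : `|p.1| <= c -> L1norm p.2 <= c -> Enorm p <= c.
Proof. by move=> h1 h2; rewrite /Enorm ge_max h1 h2. Qed.

Lemma Enorm_fst (p : V) : `|p.1| <= Enorm p.
Proof. by rewrite /Enorm le_max lexx. Qed.

Lemma Enorm_snd (p : V) : L1norm p.2 <= Enorm p.
Proof. by rewrite /Enorm le_max lexx orbT. Qed.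

Let Edom0 : (@Edom R Y) 0.
Proof. exact: (@is_L1_cst R Y 0). Qed.

Let EdomP (a : R) (u v : V) : Edom u -> Edom v -> Edom (a *: u + v).
Proof. by move=> du dv; apply: is_L1D => //; exact: is_L1Z. Qed.

Let EnormD (u v : V) : Edom u -> Edom v -> Enorm (u + v) <= Enorm u + Enorm v.
Proof.
move=> du dv; apply: Enorm_le.
  by rewrite (le_trans (ler_normD _ _))// lerD// Enorm_fst.
rewrite (le_trans (rintD mI II du dv))// lerD//; exact: Enorm_snd.
Qed.

Let EnormZ (a : R) (u : V) : Edom u -> Enorm (a *: u) = `|a| * Enorm u.
Proof. by move=> du; rewrite /Enorm /= normrZ L1normZ// maxr_pMr. Qed.

Let Ecomplete (u : nat -> V) : (forall n, Edom (u n)) ->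
  (forall n, Enorm (u n.+1 - u n) <= 2^-1 ^+ n) ->
  exists2 l, Edom l &
    forall e : R, 0 < e -> exists N, forall n, (N <= n)%N -> Enorm (u n - l) <= e.
Proof.
move=> du Hu.
have [f Lf Hf] := L1_complete du (fun n => le_trans (Enorm_snd _) (Hu n)).
have Hx n : `|(u n.+1).1 - (u n).1| <= 2^-1 ^+ n := le_trans (Enorm_fst _) (Hu n).
have [x Hxl] : exists x, forall e : R, 0 < e ->
    exists N, forall n, (N <= n)%N -> `|(u n).1 - x| <= e.
  apply: cauchy_seq_limit => e e0.
  have [N HN] := @ex_nat_div_lt R 2 e ltac:(lra) e0; exists N => n Nn.
  rewrite -(telescope_sumr (fun i => (u i).1) Nn).
  rewrite (le_trans (ler_norm_sum _ _ _))//.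
  rewrite (le_trans (ler_sum _ (fun i _ => Hx i)))//.
  have -> : \sum_(N <= i < n) 2^-1 ^+ i = 2 * (2^-1 ^+ N - 2^-1 ^+ n) :> R.
    elim: n Nn => [|n IH].
      by rewrite leqn0 => /eqP ->; rewrite big_geq// subrr mulr0.
    rewrite leq_eqVlt => /orP[/eqP ->|]; first by rewrite big_geq// subrr mulr0.
    by rewrite ltnS => Nn; rewrite big_nat_recr//= IH// exprS; lra.
  apply: ltW; apply: le_lt_trans (HN _ (leqnn N)).
  have h1 : 2^-1 ^+ N <= N.+1%:R^-1 :> R.
    by rewrite exprVn lef_pV2 ?posrE ?exprn_gt0// -natrX ler_nat ltn_expl.
  have h2 : 0 <= 2^-1 ^+ n :> R by rewrite exprn_ge0// invr_ge0.
  by rewrite ler_wpM2l// (le_trans _ h1)// gerBl.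
exists (x, f) => // e e0.
have [N1 H1] := Hxl _ e0; have [N2 H2] := Hf _ e0.
exists (maxn N1 N2) => n; rewrite geq_max => /andP[n1 n2].
by apply: Enorm_le; [exact: H1|exact: H2].
Qed.

Definition Espace : seminormed R :=
  @Seminormed R V (@Edom R Y) (@Enorm R Y) Edom0 EdomP EnormD EnormZ Ecomplete.

(** Replacing [C x] by its difference quotient at a small time [s] gives [(1 + h / s) x = (x - h C
    x) + (h / s) W s x] up to a small error, and contractivity cancels the terms in [h / s]. *)
Lemma contraction_dissipative (DC : set Y) (C : Y -> Y) (W : R -> Y -> Y) :
  sg_contraction setT (fun z : Y => `|z|) W ->
  generates setT (fun z : Y => `|z|) (fun x y => DC x /\ y = C x) W ->
  forall x (h : R), DC x -> 0 < h -> `|x| <= `|x - h *: C x|.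
Proof.
move=> hc [hg _] x h Dx h0; apply/ler_addgt0Pr => e e0.
have [_ [_ H]] := hg x (C x) (conj Dx erefl).
have [d [d0 Hd]] := H _ (divr_gt0 e0 h0).
pose s := d / 2; have s0 : 0 < s by rewrite /s; lra.
have {}Hd := Hd s s0 ltac:(rewrite /s; lra).
have {}hc := hc s x (ltW s0) Logic.I; rewrite /= in hc.
have hs0 : 0 < h / s by rewrite divr_gt0.
have b1 : (1 + h / s) * `|x| <= `|x - h *: C x| + h / s * `|W s x| + e.
  have E : (1 + h / s) *: x = (x - h *: C x) + (h / s) *: W s x -
      h *: (s^-1 *: (W s x - x) - C x) by module R.
  rewrite -[X in X * `|x|]gtr0_norm -?normrZ ?E; last by lra.
  rewrite -[X in X * `|W s x|]gtr0_norm// -normrZ.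
  rewrite (le_trans (ler_normB _ _))// lerD ?ler_normD//.
  by rewrite normrZ gtr0_norm// mulrC -ler_pdivlMr// ltW.
have b2 : h / s * `|W s x| <= h / s * `|x| by rewrite ler_pM2l.
lra.
Qed.

(** If the first component carries the max norm, contractivity suffices. If the second one does, the
    boundary term [h |p.1|] is at most [h] times the norm of [p], which is the loss [1 - h]. *)
Lemma diag_dissipative (DC : set Y) (C : Y -> Y) (p q : V) (h : R) :
  (forall x (h : R), DC x -> 0 < h -> `|x| <= `|x - h *: C x|) ->
  diag_graph DC C p q -> 0 < h -> (1 - 1 * h) * Enorm p <= Enorm (p - h *: q).
Proof.
move=> hC [Dp [g [Hg ->]]] h0.
have h1 := le_trans (hC _ _ Dp h0) (Enorm_fst (p - h *: (C p.1, g))).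
have h2 := W11_dissipative h0 Hg.
have h3 := Enorm_snd (p - h *: (C p.1, g)).
rewrite -[(_ - _).2]/(p.2 - h *: g) in h3.
have x0 := normr_ge0 p.1; have hx0 : 0 <= h * `|p.1| by rewrite mulr_ge0// ltW.
rewrite [Enorm p]/Enorm; case: (leP `|p.1| (L1norm p.2)) => c.
  by have hc := ler_wpM2l (ltW h0) c; lra.
by lra.
Qed.

Lemma opnorm_bound (Phi : (R -> Y) -> Y) f : bdd_lin_L1 Phi -> is_L1 f ->
  `|Phi f| <= opnorm_L1 Phi * L1norm f.
Proof.
move=> [lPhi [M HM]] Lf.
have L0 : is_L1 (0 : R -> Y) by exact: (@is_L1_cst R Y 0).
have Phi0 : Phi 0 = 0.
  by apply/eqP; rewrite -normr_le0 (le_trans (HM _ L0))// L1norm0 mulr0.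
have ub : has_ubound [set `|Phi f| | f in [set f | is_L1 f /\ L1norm f <= 1]].
  exists `|M| => _ [k [Lk k1] <-]; rewrite (le_trans (HM _ Lk))//.
  rewrite (le_trans (ler_wpM2r (L1norm_ge0 _) (ler_norm M)))//.
  by rewrite ler_piMr.
(* A null function cannot be normalised; for it the bound [M] forces [Phi f = 0]. *)
have [f0|f0] := eqVneq (L1norm f) 0.
  by rewrite f0 mulr0 (le_trans (HM _ Lf))// f0 mulr0.
have fp : 0 < L1norm f by rewrite lt_neqAle eq_sym f0 L1norm_ge0.
rewrite -ler_pdivrMr//; apply: ub_le_sup => //.
exists ((L1norm f)^-1 *: f).
  split; first exact: is_L1Z.
  by rewrite L1normZ// gtr0_norm ?invr_gt0// mulVf.
have := lPhi (L1norm f)^-1 f 0 Lf L0; rewrite Phi0 !addr0 => ->.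
by rewrite normrZ gtr0_norm ?invr_gt0// mulrC.
Qed.

Lemma B_dissipative (Phi : (R -> Y) -> Y) (K : R) (p q : V) (h : R) : 0 <= K ->
  (forall f, is_L1 f -> `|Phi f| <= K * L1norm f) ->
  B_graph Phi p q -> 0 < h -> (1 - K * h) * Enorm p <= Enorm (p - h *: q).
Proof.
move=> K0 HPhi [Lp ->] h0.
have L0 : is_L1 (0 : R -> Y) by exact: (@is_L1_cst R Y 0).
have dB : Edom (p - h *: (Phi p.2, 0)).
  by apply: (@is_L1B R Y) => //; rewrite /= scaler0.
have dq : @Edom R Y (Phi p.2, 0) by [].
have dhq : @Edom R Y (h *: (Phi p.2, 0)) by rewrite /Edom /= scaler0.
have := EnormD dB dhq; rewrite subrK EnormZ// (gtr0_norm h0).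
have : Enorm (Phi p.2, 0 : R -> Y) <= K * Enorm p.
  apply: Enorm_le => /=.
    by rewrite (le_trans (HPhi _ Lp))// ler_wpM2l// Enorm_snd.
  rewrite L1norm0 mulr_ge0//; apply: le_trans (Enorm_fst _); exact: normr_ge0.
move=> /(ler_wpM2l (ltW h0)); lra.
Qed.

End ProductSpace.

(** * Pointwise liftings of the discretisation operators *)

Section LiftMaps.
Variables (R : realType) (Y Z : completeNormedModType R) (P : {linear Y -> Z}) (K : R).
Hypotheses (bP : forall x, `|P x| <= K * `|x|) (K0 : 0 <= K).

Let lP : linear P.
Proof. by move=> a x y; rewrite linearP. Qed.

Lemma liftE_dom (p : Y * (R -> Y)) : Edom p -> Edom (liftE P p).
Proof. exact: (is_L1_map lP bP K0). Qed.

Lemma liftE_lin (a : R) (u v : Y * (R -> Y)) :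
  liftE P (a *: u + v) = a *: liftE P u + liftE P v.
Proof.
rewrite /liftE /= linearP; congr (_, _).
by apply/funext => s /=; rewrite !fctE linearP.
Qed.

Lemma liftE_bound (p : Y * (R -> Y)) : Edom p -> Enorm (liftE P p) <= K * Enorm p.
Proof.
move=> dp; apply: Enorm_le.
  by rewrite (le_trans (bP _))// ler_wpM2l// Enorm_fst.
have mI := @measurable_Iint R; have II := @subset_refl _ (@Iint R).
rewrite (le_trans (rint_map lP bP K0 mI II dp))// ler_wpM2l//; exact: Enorm_snd.
Qed.

Lemma liftE_lin0 (a : R) (u v : Y * (R -> Y)) : Edom u -> Edom v ->
  Enorm (liftE P (a *: u + v) - (a *: liftE P u + liftE P v)) = 0.
Proof. by move=> _ _; rewrite liftE_lin subrr; exact: (@sn_norm0 R (Espace Z)). Qed.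

End LiftMaps.

(** On a simple function only finitely many values matter, and [Iint] has measure 1; the common
    bound [K] extends the convergence by density. *)
Lemma L1_strong_cvg (R : realType) (X : completeNormedModType R) (A : nat -> X -> X)
    (K : R) (f : R -> X) : 0 <= K -> (forall m, linear (A m)) ->
  (forall m x, `|A m x| <= K * `|x|) ->
  (forall x, (fun m => A m x) @ \oo --> x) -> is_L1 f ->
  forall e : R, 0 < e -> exists N, forall m, (N <= m)%N -> L1norm ((A m \o f) - f) <= e.
Proof.
move=> K0 lA bA cA Lf e e0.
have mI := @measurable_Iint R; have II := @subset_refl _ (@Iint R).
have d0 : 0 < e / 2 / (K + 1) by rewrite !divr_gt0//; lra.
have [s Hs] := is_L1_approx Lf d0; have Ls := @is_L1_sr R X s.
have {}Hs : L1norm (sr_eval s - f) <= e / 2 / (K + 1).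
  by rewrite -lee_fin fineK ?is_L1_fin//; exact: is_L1B.
have n0 : 0 < (sr_n s).+1%:R :> R by rewrite ltr0n.
have c0 : 0 < e / 2 / (sr_n s).+1%:R by rewrite divr_gt0//; lra.
have [N _ HN] : \forall m \near \oo, forall i : 'I_(sr_n s),
    `|A m (sr_x i) - sr_x i| <= e / 2 / (sr_n s).+1%:R.
  apply: filter_forall => i; have /cvgrPdist_le /(_ _ c0) := cA (sr_x i).
  by apply: filterS => m; rewrite distrC.
exists N => m Nm; have {}HN := HN m Nm.
have LA g : is_L1 g -> is_L1 (A m \o g) := is_L1_map (lA m) (bA m) K0 (f := g).
have Lsf : is_L1 (sr_eval s - f) by exact: is_L1B.
have LAs : is_L1 ((A m \o sr_eval s) - sr_eval s) by apply: is_L1B => //; exact: LA.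
have -> : (A m \o f) - f = ((A m \o sr_eval s) - sr_eval s) -
    ((A m \o (sr_eval s - f)) - (sr_eval s - f)).
  by apply/funext => t; rewrite !fctE /= (linfB (lA m)); module R.
have LAsf := LA _ Lsf.
rewrite (le_trans (rintB mI II LAs (is_L1B LAsf Lsf)))//.
have h1 := le_trans (rintB mI II LAsf Lsf)
  (lerD (rint_map (lA m) (bA m) K0 mI II Lsf) (lexx _)).
have h2 : rint (@Iint R) ((A m \o sr_eval s) - sr_eval s) <= e / 2.
  have e20 : 0 <= e / 2 by lra.
  have sb t : `|((A m \o sr_eval s) - sr_eval s) t| <= e / 2.
    have -> : ((A m \o sr_eval s) - sr_eval s) t =
        \sum_(i < sr_n s) \1_(@sr_A R X s i) t *: (A m (sr_x i) - sr_x i).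
      have -> : ((A m \o sr_eval s) - sr_eval s) t =
          sr_eval (sr_map (A m) s) t - sr_eval s t by rewrite (sr_eval_map (lA m)).
      by rewrite -sumrB; apply: eq_bigr => i _; rewrite scalerBr.
    apply: (@le_trans _ _ (\sum_(i < sr_n s) e / 2 / (sr_n s).+1%:R)).
      rewrite (le_trans (ler_norm_sum _ _ _))//; apply: ler_sum => i _.
      rewrite normrZ indicE; case: (_ \in _); first by rewrite normr1 mul1r HN.
      by rewrite normr0 mul0r ltW.
    rewrite sumr_const card_ord -[leLHS]mulr_natr.
    rewrite [leLHS](_ : _ = e / 2 * ((sr_n s)%:R / (sr_n s).+1%:R)); last by ring.
    by rewrite ler_piMr// ler_pdivrMr// mul1r ler_nat.
  have ae_sb : {ae @lebesgue_measure R, forall t, Iint t ->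
      `|((A m \o sr_eval s) - sr_eval s) t| <= e / 2} by apply: aeW => t _; exact: sb.
  have := rint_bound mI II LAs e20 ae_sb.
  by rewrite mu_Iint /= mulr1.
have h3 : (K + 1) * L1norm (sr_eval s - f) <= e / 2 by rewrite mulrC -ler_pdivlMr//; lra.
rewrite -[L1norm _]/(rint (@Iint R) _) in h3; lra.
Qed.

(** * Convergence of the splittings for the delay semigroup *)

Unset Implicit Arguments.

Theorem mainTheorem9
  (R : realType) (X : completeNormedModType R)
  (* C generates the sg_contraction C0-semigroup V on X *)
  (DC : set X) (C : X -> X) (V : R -> X -> X)
  (hV : C0_semigroup setT (fun z : X => `|z|) V)
  (hVc : sg_contraction setT (fun z : X => `|z|) V)
  (hC : generates setT (fun z : X => `|z|) (fun x y => DC x /\ y = C x) V)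
  (* Phi : L^1([-1,0],X) -> X bounded linear *)
  (Phi : (R -> X) -> X) (hPhi : bdd_lin_L1 Phi)
  (* the delay semigroup U generated by G *)
  (U : R -> X * (R -> X) -> X * (R -> X))
  (hU : C0_semigroup (@Edom R X) (@Enorm R X) U)
  (hG : generates (@Edom R X) (@Enorm R X) (delay_graph DC C Phi) U)
  (* spatial approximation spaces *)
  (Xm : nat -> completeNormedModType R)
  (P : forall m, {linear X -> Xm m}) (J : forall m, {linear Xm m -> X})
  (MJ MP : R)
  (hPJ : forall m (y : Xm m), P m (J m y) = y)
  (hJP : forall x : X, (fun m => J m (P m x)) @ \oo --> x)
  (hJ : forall m (y : Xm m), `|J m y| <= MJ * `|y|)
  (hP : forall m (x : X), `|P m x| <= MP * `|x|)
  (* (a) *)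
  (DCm : forall m, set (Xm m)) (Cm : forall m, Xm m -> Xm m)
  (Vm : forall m, R -> Xm m -> Xm m)
  (hVm : forall m, C0_semigroup setT (fun z : (Xm m) => `|z|) (Vm m))
  (hVmc : forall m, sg_contraction setT (fun z : (Xm m) => `|z|) (Vm m))
  (hCm : forall m, generates setT (fun z : (Xm m) => `|z|)
                     (fun x y => DCm m x /\ y = Cm m x) (Vm m))
  (hPD : forall m x, DC x -> DCm m (P m x))
  (hCconv : forall x, DC x -> (fun m => J m (Cm m (P m x))) @ \oo --> C x)
  (* (b) *)
  (Phim : forall m, (R -> Xm m) -> Xm m) (c : R)
  (hPhim : forall m, bdd_lin_L1 (Phim m))
  (hPhimn : forall m, opnorm_L1 (Phim m) <= c * opnorm_L1 Phi)
  (hPhiconv : forall f : R -> X, is_L1 f ->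
     (fun m => J m (Phim m (fun s => P m (f s)))) @ \oo --> Phi f)
  (* the semigroups T_m, S_m generated by A_m, B_m on E_m *)
  (Tm Sm : forall m, R -> Xm m * (R -> Xm m) -> Xm m * (R -> Xm m))
  (hTm : forall m, C0_semigroup (@Edom R (Xm m)) (@Enorm R (Xm m)) (Tm m))
  (hAm : forall m, generates (@Edom R (Xm m)) (@Enorm R (Xm m))
                     (diag_graph (DCm m) (Cm m)) (Tm m))
  (hSm : forall m, C0_semigroup (@Edom R (Xm m)) (@Enorm R (Xm m)) (Sm m))
  (hBm : forall m, generates (@Edom R (Xm m)) (@Enorm R (Xm m))
                     (B_graph (Phim m)) (Sm m)) :
  forall (t : R), 0 < t -> forall (Theta : R), 0 < Theta < 1 ->
  forall (x : X) (f : R -> X), is_L1 f ->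
  forall F : forall m, R -> Xm m * (R -> Xm m) -> Xm m * (R -> Xm m),
    (F = (fun m => seq_split (Tm m) (Sm m)) \/
     F = (fun m => strang_split (Tm m) (Sm m)) \/
     F = (fun m => weighted_split Theta (Tm m) (Sm m))) ->
  forall e : R, 0 < e -> exists N : nat, forall n m : nat, (N <= n)%N -> (N <= m)%N ->
    Enorm (liftE (J m) (iter n (F m (t / n%:R)) (liftE (P m) (x, f)))
           - U t (x, f)) <= e.
Proof.
move=> t t0 Theta thP x f Lf F HF e e0.
(* The absolute value secures a nonnegative constant even when the spaces are trivial. *)
pose K := `|MP|; have K0 : 0 <= K by exact: normr_ge0.
have bP m y : `|P m y| <= K * `|y|.
  by rewrite (le_trans (hP m y))// ler_wpM2r// ler_norm.
pose KJ := `|MJ|; have KJ0 : 0 <= KJ by exact: normr_ge0.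
have bJ m y : `|J m y| <= KJ * `|y|.
  by rewrite (le_trans (hJ m y))// ler_wpM2r// ler_norm.
have lP m : linear (P m) by move=> a y z; rewrite linearP.
have lJ m : linear (J m) by move=> a y z; rewrite linearP.
pose E : completeNormedModType R := squot (Espace X).
pose Em m : completeNormedModType R := squot (Espace (Xm m)).
pose P' m : E -> Em m := @slift R (Espace X) (Espace (Xm m)) (liftE (P m)).
pose U' : R -> E -> E := fun s => @slift R (Espace X) (Espace X) (U s).
pose T' m : R -> Em m -> Em m := fun s => @slift R (Espace (Xm m)) (Espace (Xm m)) (Tm m s).
pose S' m : R -> Em m -> Em m := fun s => @slift R (Espace (Xm m)) (Espace (Xm m)) (Sm m s).
have hU' : csemigroup U' := @csemigroup_lift R (Espace X) U hU.
have hT' m : csemigroup (T' m) := @csemigroup_lift R (Espace (Xm m)) (Tm m) (hTm m).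
have hS' m : csemigroup (S' m) := @csemigroup_lift R (Espace (Xm m)) (Sm m) (hSm m).
have P'spi m v : Edom v -> P' m (spi (Espace X) v) = spi (Espace (Xm m)) (liftE (P m) v).
  exact: (@slift_spi R (Espace X) (Espace (Xm m)) _ (liftE_dom (bP m) K0)
    (liftE_lin0 (P m)) K (liftE_bound (bP m) K0)).
have lP' m : linear (P' m).
  exact: (@slift_linear R (Espace X) (Espace (Xm m)) _ (liftE_dom (bP m) K0)
    (liftE_lin0 (P m)) K (liftE_bound (bP m) K0)).
have bP' m y : `|P' m y| <= K * `|y|.
  exact: (@slift_bound R (Espace X) (Espace (Xm m)) _ (liftE_dom (bP m) K0)
    (liftE_lin0 (P m)) K (liftE_bound (bP m) K0)).
(* Every pair in the generator of the quotient semigroup has representatives in the graph of [A_m],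
   where dissipativity with constant 1 is known. *)
have bT m (h : R) (y : Em m) : 0 <= h -> `|T' m h y| <= expR (2 * 1 * h) * `|y|.
  apply: (dissipative_growth (hT' m) ler01) => {}y a {}h Hy h0.
  have [v [w [dv dw -> -> G]]] := @gen_generates R (Espace (Xm m)) _ _ _ _ (hTm m) (hAm m) Hy.
  have dhw : sn_dom (h *: w) by exact: sn_domZ.
  rewrite -spiZ// -spiB// !norm_spi//; last exact: sn_domB.
  exact: (diag_dissipative (contraction_dissipative (hVmc m) (hCm m)) G h0).
pose KS := `|c * opnorm_L1 Phi|; have KS0 : 0 <= KS by exact: normr_ge0.
have bPhi m g : is_L1 g -> `|Phim m g| <= KS * L1norm g.
  move=> Lg; rewrite (le_trans (opnorm_bound (hPhim m) Lg))//.
  by rewrite ler_wpM2r ?L1norm_ge0// (le_trans (hPhimn m))// ler_norm.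
have bS m (h : R) (y : Em m) : 0 <= h -> `|S' m h y| <= expR (2 * KS * h) * `|y|.
  apply: (dissipative_growth (hS' m) KS0) => {}y a {}h Hy h0.
  have [v [w [dv dw -> -> G]]] := @gen_generates R (Espace (Xm m)) _ _ _ _ (hSm m) (hBm m) Hy.
  have dhw : sn_dom (h *: w) by exact: sn_domZ.
  rewrite -spiZ// -spiB// !norm_spi//; last exact: sn_domB.
  exact: (B_dissipative KS0 (bPhi m) G h0).
have L0 m : is_L1 (0 : R -> Xm m) by exact: (@is_L1_cst R (Xm m) 0).
(* [d m - P m z = P m (J m (d m) - z)] brings convergence in [X] back to [Xm m]; the second
   components agree exactly. *)
have close (d : forall m, Xm m) (z : X) (g : R -> X) (hg : is_L1 g) :
    (fun m => J m (d m)) @ \oo --> z ->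
    forall e : R, 0 < e -> exists N : nat, forall m, (N <= m)%N ->
      `|spi (Espace (Xm m)) (d m, P m \o g) - P' m (spi (Espace X) (z, g))| <= e.
  move=> /cvgrPdist_le cv e' e'0.
  have K1 : 0 < K + 1 by lra.
  have [N _ HN] := cv _ (divr_gt0 e'0 K1); exists N => m Nm.
  have dPg : sn_dom ((d m, P m \o g) : sn_type (Espace (Xm m))).
    exact: (is_L1_map (lP m) (bP m) K0).
  have dzg : sn_dom (liftE (P m) (z, g) : sn_type (Espace (Xm m))).
    exact: (liftE_dom (bP m) K0 (p := (z, g))).
  rewrite P'spi// -spiB// norm_spi; last exact: sn_domB.
  apply: Enorm_le; last first.
    have -> : ((d m, P m \o g) - liftE (P m) (z, g)).2 = (0 : R -> Xm m).
      by rewrite /= subrr.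
    by rewrite L1norm0 ltW.
  rewrite /= -[d m](hPJ m) -(linfB (lP m)) (le_trans (bP m _))//.
  apply: (@le_trans _ _ ((K + 1) * `|J m (d m) - z|)); first by rewrite ler_wpM2r//; lra.
  by rewrite mulrC -ler_pdivlMr// distrC; exact: HN.
have genU y g : gen U' y g -> exists a b,
    [/\ g = a + b, approx_gen P' T' y a & approx_gen P' S' y b].
  move=> Hy; have [v [w [dv dw -> -> [Dv [g' [Wg wE]]]]]] := @gen_generates R (Espace X) _ _ _ _ hU hG Hy.
  have Lg' : is_L1 g' by case: Wg => _ [].
  have LX0 : is_L1 (0 : R -> X) by exact: (@is_L1_cst R X 0).
  exists (spi (Espace X) (C v.1, g')), (spi (Espace X) (Phi v.2, 0)); split.
  - by rewrite wE -spiD//; congr spi; rewrite /GRing.add /= /add_pair /= addr0.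
  - exists (fun m => spi (Espace (Xm m)) (Cm m (P m v.1), P m \o g')); split; last first.
      by apply: close => //; exact: hCconv.
    move=> m; rewrite P'spi//.
    have G : diag_graph (DCm m) (Cm m) (liftE (P m) v) (Cm m (P m v.1), P m \o g').
      split; first exact: hPD.
      by exists (P m \o g'); split => //; exact: (W11_deriv_map (lP m) (bP m) K0).
    have [d1 [d2 H]] := (hAm m).1 _ _ G.
    exact: (@gen_lift R (Espace (Xm m)) _ (hTm m) _ _ d1 d2).1 H.
  - exists (fun m => spi (Espace (Xm m)) (Phim m (P m \o v.2), P m \o (0 : R -> X))); split; last first.
      by apply: close => //; exact: hPhiconv.
    move=> m; rewrite P'spi//.
    have -> : P m \o (0 : R -> X) = (0 : R -> Xm m).
      by apply/funext => s /=; rewrite linear0.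
    have G : B_graph (Phim m) (liftE (P m) v) (Phim m (P m \o v.2), 0).
      by split => //; exact: (liftE_dom (bP m) K0 dv).
    have [d1 [d2 H]] := (hBm m).1 _ _ G.
    exact: (@gen_lift R (Espace (Xm m)) _ (hSm m) _ _ d1 d2).1 H.
(* The scheme acts on representatives and the convergence theorem on classes; invariance of the
   domain allows the correspondence to be iterated. *)
have [F' HF' FF'] : exists2 F' : forall m, R -> Em m -> Em m,
    (F' = (fun m => seq_split (T' m) (S' m)) \/
     F' = (fun m => strang_split (T' m) (S' m)) \/
     F' = (fun m => weighted_split Theta (T' m) (S' m))) &
    forall m (h : R) v, 0 <= h -> Edom v -> Edom (F m h v) /\
      spi (Espace (Xm m)) (F m h v) = F' m h (spi (Espace (Xm m)) v).
  have dT m (h : R) v : 0 <= h -> Edom v -> Edom (Tm m h v).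
    exact: (@C0_dom R (Espace (Xm m)) _ (hTm m)).
  have dS m (h : R) v : 0 <= h -> Edom v -> Edom (Sm m h v).
    exact: (@C0_dom R (Espace (Xm m)) _ (hSm m)).
  have eT m (h : R) v : 0 <= h -> Edom v ->
      T' m h (spi (Espace (Xm m)) v) = spi (Espace (Xm m)) (Tm m h v).
    exact: (@C0_lift R (Espace (Xm m)) _ (hTm m)).
  have eS m (h : R) v : 0 <= h -> Edom v ->
      S' m h (spi (Espace (Xm m)) v) = spi (Espace (Xm m)) (Sm m h v).
    exact: (@C0_lift R (Espace (Xm m)) _ (hSm m)).
  case: HF => [->|[->|->]].
  - exists (fun m => seq_split (T' m) (S' m)); first by left.
    move=> m h v h0 dv; have d1 := dT m h v h0 dv; split; first exact: dS.
    by rewrite /seq_split (eT _ _ _ h0 dv) (eS _ _ _ h0 d1).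
  - exists (fun m => strang_split (T' m) (S' m)); first by right; left.
    move=> m h v h0 dv; have h20 : 0 <= h / 2 by lra.
    have d1 := dT m _ v h20 dv; have d2 := dS m _ _ h0 d1.
    split; first exact: dT.
    by rewrite /strang_split (eT _ _ _ h20 dv) (eS _ _ _ h0 d1) (eT _ _ _ h20 d2).
  - exists (fun m => weighted_split Theta (T' m) (S' m)); first by right; right.
    move=> m h v h0 dv; have d3 := dT m h v h0 dv; have d4 := dS m h v h0 dv.
    have d1 := dS m _ _ h0 d3; have d2 := dT m _ _ h0 d4.
    have d1' := @sn_domZ R (Espace (Xm m)) Theta _ d1.
    have d2' := @sn_domZ R (Espace (Xm m)) (1 - Theta) _ d2.
    split; first exact: (@sn_domD R (Espace (Xm m)) _ _ d1' d2').
    rewrite /weighted_split (eT _ _ _ h0 dv) (eS _ _ _ h0 d3) (eS _ _ _ h0 dv).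
    by rewrite (eT _ _ _ h0 d4) (@spiD R (Espace (Xm m)) _ _ d1' d2') !(@spiZ R (Espace (Xm m))).
pose v0 : sn_type (Espace X) := (x, f); have dv0 : sn_dom v0 by [].
have KJ1 : 0 < KJ + 1 by lra.
have e20 : 0 < e / 2 by lra.
have [N1 HN1] := splitting_cvg lP' bP' K0 hT' hS' (mulr_ge0 (ler0n R 2) ler01)
  (mulr_ge0 (ler0n R 2) KS0) bT bS hU' genU (spi (Espace X) v0) thP HF' t0 (divr_gt0 e20 KJ1).
have dUt : Edom (U t v0) by exact: (@C0_dom R (Espace X) _ hU t v0 (ltW t0) dv0).
have bJP m y : `|J m (P m y)| <= KJ * K * `|y|.
  by rewrite (le_trans (bJ m _))// -mulrA ler_wpM2l// bP.
have lJP m : linear (J m \o P m) by move=> a y z /=; rewrite !linearP.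
have [N2 HN2] := L1_strong_cvg (A := fun m => J m \o P m) (mulr_ge0 KJ0 K0) lJP bJP hJP
  dUt e20.
have /cvgrPdist_le /(_ _ e20)[N3 _ HN3] := hJP (U t v0).1.
exists (maxn 1 (maxn N1 (maxn N2 N3))) => n m; rewrite !geq_max.
move=> /and4P[n1 n2 _ _] /and4P[_ m1 m2 m3].
have h0 : 0 <= t / n%:R by rewrite divr_ge0// ltW.
set h := t / n%:R in h0 *.
have dPv : Edom (liftE (P m) v0) by exact: (liftE_dom (bP m) K0 (p := v0)).
have iterP k : Edom (iter k (F m h) (liftE (P m) v0)) /\
    spi (Espace (Xm m)) (iter k (F m h) (liftE (P m) v0)) =
    iter k (F' m h) (spi (Espace (Xm m)) (liftE (P m) v0)).
  elim: k => [//|k [dk ek]]; rewrite !iterS -ek; exact: FF'.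
have [dI eI] := iterP n.
set it := iter n (F m h) _ in dI eI *.
(* The total error is [J m] applied to the discrete error [it - w], plus the projection error of the
   single vector [U t v0]. *)
pose w := liftE (P m) (U t v0).
have dw : Edom w by exact: (liftE_dom (bP m) K0).
have diw : Edom (it - w) by exact: (@sn_domB R (Espace (Xm m))).
have b1 : Enorm (it - w) <= e / 2 / (KJ + 1).
  have := HN1 n m n2 m1; rewrite -/h P'spi// -eI.
  have -> : U' t (spi (Espace X) v0) = spi (Espace X) (U t v0).
    exact: (@C0_lift R (Espace X) _ hU t v0 (ltW t0) dv0).
  by rewrite P'spi// -(@spiB R (Espace (Xm m)) _ _ dI dw) norm_spi.
have b2 : Enorm (liftE (J m) it - liftE (J m) w) <= e / 2.
  have -> : liftE (J m) it - liftE (J m) w = liftE (J m) (it - w).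
    have := liftE_lin (J m) (-1) w it; rewrite !scaleN1r addrC => ->.
    by rewrite addrC.
  rewrite (le_trans (liftE_bound (bJ m) KJ0 diw))//.
  apply: (@le_trans _ _ ((KJ + 1) * Enorm (it - w))).
    rewrite ler_wpM2r//; last by lra.
    exact: le_trans (normr_ge0 _) (Enorm_fst _).
  by rewrite mulrC -ler_pdivlMr.
have b3 : Enorm (liftE (J m) w - U t v0) <= e / 2.
  apply: Enorm_le; last exact: HN2.
  by rewrite /= distrC; exact: HN3.
have dJi : Edom (liftE (J m) it) by exact: (liftE_dom (bJ m) KJ0).
have dJw : Edom (liftE (J m) w) by exact: (liftE_dom (bJ m) KJ0).
rewrite (le_trans (@sn_dist_trans R (Espace X) _ _ _ dJi dJw dUt))//.
rewrite (le_trans (lerD b2 b3))//; lra.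
Qed.
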